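(* Let $\mathcal H_A,\mathcal H_B$ be finite-dimensional Hilbert spaces. Then the distillable entanglement, viewed as a function $E_d:\mathcal D(\mathcal H_A\otimes\mathcal H_B)\to\mathbb R_{\ge 0}$, is an achievable rate of universal entanglement distillation. That is, for every $\delta>0$ there exist a sequence $\{\Lambda_n\}_n$ of LOCC instruments $\Lambda_n=\{\Lambda_n^x\}_x$ acting on $(\mathcal H_A\otimes\mathcal H_B)^{\otimes n}$ and real numbers $\{r_x^{(n)}\}_{n,x}$ (neither depending on the input state) such that, for every state $\rho_{AB}\in\mathcal D(\mathcal H_A\otimes\mathcal H_B)$, with $p_x=\operatorname{Tr}[\Lambda_n^x(\rho_{AB}^{\otimes n})]$, $$\sum_x p_x\left\|\frac{\Lambda_n^x(\rho_{AB}^{\otimes n})}{p_x}-\Phi_{AB}^{\otimes\lfloor n r_x^{(n)}\rfloor}\right\|_1\xrightarrow[n\to\infty]{}0$$ and $$\Pr_x\left[r_x^{(n)}<E_d(\rho_{AB})-\delta\right]=\sum_{x:\,r_x^{(n)}<E_d(\rho_{AB})-\delta}p_x\xrightarrow[n\to\infty]{}0 .$$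
   Context: $\mathcal D(\mathcal H)$ is the set of density operators on $\mathcal H$; $\|\cdot\|_1$ is the trace norm. $\Phi_{AB}$ is the two-qubit Bell state (projector onto $(|00\rangle+|11\rangle)/\sqrt2$), shared between Alice and Bob; $\Phi_{AB}^{\otimes 0}$ is the trivial state. LOCC means local operations and classical communication between Alice (holding the $A$ systems) and Bob (holding the $B$ systems) with finitely many rounds and finitely many measurement outcomes. An LOCC instrument $\{\Lambda^x\}_x$ is a finite family of completely positive trace-nonincreasing maps with trace-preserving sum, realized by an LOCC protocol in which the classical outcome $x$ is known to both parties at the end; the output of $\Lambda_n^x$ is a bipartite system of $\lfloor n r_x^{(n)}\rfloor$ qubits for Alice and $\lfloor n r_x^{(n)}\rfloor$ qubits for Bob (so the output dimension may depend on $x$, and the $r_x^{(n)}$ are such that $\lfloor n r_x^{(n)}\rfloor\ge 0$). Terms with $p_x=0$ are taken to be zero. The distillable entanglement is $$E_d(\rho_{AB})=\sup\{r\ge0:\ \exists\ \text{LOCC channels }\Lambda_n\text{ with }\|\Lambda_n(\rho_{AB}^{\otimes n})-\Phi_{AB}^{\otimes\lfloor rn\rfloor}\|_1\to0\text{ as }n\to\infty\},$$ where the sequence $\{\Lambda_n\}$ may depend on $\rho_{AB}$. *)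

(* Defs.v *)
From mathcomp Require Export all_boot all_order all_algebra.
From mathcomp Require Export complex.
From mathcomp Require Export all_classical all_reals all_analysis.

Set Implicit Arguments.
Unset Strict Implicit.
Unset Printing Implicit Defensive.
Import Order.TTheory GRing.Theory Num.Theory.
Import numFieldNormedType.Exports.

Local Open Scope classical_set_scope.
Local Open Scope ring_scope.
Local Open Scope sesquilinear_scope.

(* A finite-dimensional Hilbert space is C^I for a finite type I labelling an
   orthonormal basis; C^I (x) C^J is C^(I * J).  The basis vector i : I is the
   coordinate enum_rank i of the matrix. *)
Notation op R I := ('M[R[i]]_#|{: I}|).

Section Operators.
Variable R : realType.
Implicit Types I J K A B : finType.

Definition mkop I (F : I -> I -> R[i]) : op R I :=
  \matrix_(s, t) F (enum_val s) (enum_val t).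

Definition entry I (X : op R I) (i j : I) : R[i] :=
  X (enum_rank i) (enum_rank j).

Definition psd n (X : 'M[R[i]]_n) : Prop :=
  forall v : 'cV[R[i]]_n, 0 <= (v^t* *m X *m v) 0 0.

Definition density I (rho : op R I) : Prop := psd rho /\ \tr rho = 1.

Definition rtrace n (X : 'M[R[i]]_n) : R := complex.Re (\tr X).

(* |X| = sqrt (X^* X), the square root being taken in the spectral
   decomposition of the Hermitian matrix X^* X. *)
Definition mxabs n (X : 'M[R[i]]_n) : 'M[R[i]]_n :=
  let H := X^t* *m X in
  invmx (spectralmx H) *m diag_mx (map_mx sqrtC (spectral_diag H))
    *m spectralmx H.

Definition trnorm n (X : 'M[R[i]]_n) : R := rtrace (mxabs X).

(* f (x) id_K and id_K (x) f : the operator X on C^(I * K) is the sum over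
   k, l of X_kl (x) |k><l|, where X_kl is the block with entries
   X (i, k) (j, l). *)
Definition ampl I J K (f : op R I -> op R J) (X : op R (I * K)) :
    op R (J * K) :=
  mkop (fun x y : J * K =>
    entry (f (mkop (fun i j : I => entry X (i, x.2) (j, y.2)))) x.1 y.1).

Definition ampr I J K (f : op R I -> op R J) (X : op R (K * I)) :
    op R (K * J) :=
  mkop (fun x y : K * J =>
    entry (f (mkop (fun i j : I => entry X (x.1, i) (y.1, j)))) x.2 y.2).

Definition completely_positive I J (f : {linear op R I -> op R J}) : Prop :=
  forall (K : finType) (X : op R (I * K)), psd X -> psd (ampl f X).

(* A quantum instrument; the output space may depend on the outcome. *)
Definition instrument I (M : finType) (J : M -> finType)
    (f : forall m : M, {linear op R I -> op R (J m)}) : Prop :=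
  (forall m, completely_positive (f m)) /\
  (forall X : op R I, \sum_(m : M) \tr (f m X) = \tr X).

(* [locc_instrument Lam]: the family Lam of maps, from operators on A (x) B to
   operators on OA x (x) OB x, is realized by an LOCC protocol.  A protocol is
   a finite tree: at an inner node one party applies a local instrument and
   broadcasts its outcome m, on which the rest of the protocol may depend; at
   a leaf the parties stop and announce the outcome x.  Several leaves may
   carry the same x, so that classical information can be discarded; Lam x is
   the sum over the leaves labelled by x. *)
Inductive locc_instrument (X : finType) (OA OB : X -> finType) :
    forall A B : finType,
      (forall x : X, op R (A * B) -> op R (OA x * OB x)) -> Prop :=
| Locc_stop (x : X)
    (Lam : forall y : X, op R (OA x * OB x) -> op R (OA y * OB y)) of
    (forall T, Lam x T = T) &
    (forall y T, y != x -> Lam y T = 0) :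
    locc_instrument Lam
| Locc_alice (A B M : finType) (A' : M -> finType)
    (f : forall m : M, {linear op R A -> op R (A' m)})
    (Gam : forall (m : M) (x : X),
      op R (A' m * B) -> op R (OA x * OB x))
    (Lam : forall x : X, op R (A * B) -> op R (OA x * OB x)) of
    instrument f &
    (forall m, locc_instrument (Gam m)) &
    (forall x T, Lam x T = \sum_(m : M) Gam m x (ampl (f m) T)) :
    locc_instrument Lam
| Locc_bob (A B M : finType) (B' : M -> finType)
    (f : forall m : M, {linear op R B -> op R (B' m)})
    (Gam : forall (m : M) (x : X),
      op R (A * B' m) -> op R (OA x * OB x))
    (Lam : forall x : X, op R (A * B) -> op R (OA x * OB x)) of
    instrument f &
    (forall m, locc_instrument (Gam m)) &
    (forall x T, Lam x T = \sum_(m : M) Gam m x (ampr (f m) T)) :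
    locc_instrument Lam.

Definition locc_channel (A B OA OB : finType)
    (Lam : op R (A * B) -> op R (OA * OB)) : Prop :=
  @locc_instrument unit (fun=> OA) (fun=> OB) A B (fun=> Lam).

End Operators.

Notation pow I n := {ffun 'I_n -> I}.
Notation qubits k := (pow bool k).

Section Distillation.
Variable R : realType.
Variables A B : finType.

(* rho_AB^{(x) n}, with the n systems of Alice and the n systems of Bob
   grouped together. *)
Definition tensor_pow n (rho : op R (A * B)) : op R (pow A n * pow B n) :=
  mkop (fun x y : pow A n * pow B n =>
    \prod_(k < n) entry rho (x.1 k, x.2 k) (y.1 k, y.2 k)).

End Distillation.

(* Projector onto (|00> + |11>) / sqrt 2. *)
Definition bell (R : realType) : op R (bool * bool) :=
  let v (x : bool * bool) : R[i] := (x.1 == x.2)%:R / sqrtC 2 in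
  mkop (fun x y : bool * bool => v x * Num.conj (v y)).

Definition bells (R : realType) (k : nat) : op R (qubits k * qubits k) :=
  tensor_pow k (bell R).

Definition distillable_rate (R : realType) (A B : finType)
    (rho : op R (A * B)) (r : R) : Prop :=
  0 <= r /\
  exists Lam : forall n : nat,
    op R (pow A n * pow B n) ->
    op R (qubits (Num.truncn (r * n%:R)) * qubits (Num.truncn (r * n%:R))),
  (forall n, locc_channel (Lam n)) /\
  (fun n => trnorm (Lam n (tensor_pow n rho)
                    - bells R (Num.truncn (r * n%:R)))) @ \oo --> (0 : R).

(* 0 is a distillable rate and the distillable rates of a density operator are
   bounded by log2 (min #|A| #|B|), so this real supremum is a genuine one. *)
Definition distillable_entanglement (R : realType) (A B : finType)
    (rho : op R (A * B)) : R :=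
  sup [set r : R | distillable_rate rho r].

(* Main.v *)
Require Import Defs.
From HB Require Import structures.
From mathcomp Require Import all_boot all_order all_algebra.
From mathcomp Require Import complex.
From mathcomp Require Import all_classical all_reals all_analysis.
From mathcomp Require Import ring lra zify.

(* For one state, a distillation protocol on blocks of m copies with output close
   to k Bell pairs can be repeated on many blocks; the outputs are i.i.d. and only
   a small fraction of the blocks is faulty.  A code of rate close to 1 which
   corrects any few faulty blocks (first the bit errors, then, after local
   Hadamard transforms, the phase errors, each time by announcing random
   parities) turns them into Bell pairs with vanishing error, and the code does
   not depend on the state.  So the protocol works for every state which passes
   the test that the block output is close to k Bell pairs.  This test is itself
   LOCC: both parties measure some blocks in the computational basis and others
   in the conjugate basis and count disagreements; the counts concentrate
   uniformly in the state.

   Fidelity after a block protocol is a linear functional of the input, so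
   countably many block protocols approximate all of them.  The universal
   protocol tests the first J = J(n) of them in decreasing order of rate, on a
   negligible part of the n copies, and runs the first one that passes on the
   remaining copies; J(n) grows slowly enough that all error bounds, which are
   uniform in the state for fixed J, tend to 0. *)

Set Implicit Arguments.
Unset Strict Implicit.
Unset Printing Implicit Defensive.
Import Order.TTheory GRing.Theory Num.Theory.
Import numFieldNormedType.Exports.

Local Open Scope complex_scope.
Local Open Scope ring_scope.

(** * Operators through their entries *)

Section Entries.
Variable R : realType.
Implicit Types I J K H A B M : finType.

(** The obstacle is that a distillation sequence is tuned to one state: its error vanishes at an
    unknown speed there, and perhaps not at all nearby. So the sequence is used at a single block
    length, only to lift the fidelity of a block above a threshold; the code alone makes the error
    vanish. A threshold also survives the replacement of a protocol by a close one, and it can be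
    tested with a gap, because the infidelity lies between each of the two disagreement rates and
    their sum. Below 1/(32 c) both tests pass, above 1/c one of them fails, with high probability.
    In between either verdict is harmless: the candidate is within the tolerance, and by the
    ordering its rate is at least that of every candidate still to come. The weights of a tensor
    power on products of Bell vectors multiply even if the block state is not Bell diagonal, so the
    errors of the blocks behave like independent classical trials. *)

Lemma entry_mkop I (F : I -> I -> R[i]) i j : entry (mkop F) i j = F i j.
Proof. by rewrite /entry mxE !enum_rankK. Qed.

Lemma opP I (X Y : op R I) : (forall i j, entry X i j = entry Y i j) -> X = Y.
Proof.
move=> h; apply/matrixP => s t; have := h (enum_val s) (enum_val t).
by rewrite /entry !enum_valK.
Qed.

Lemma entry0 I i j : entry (0 : op R I) i j = 0.
Proof. by rewrite /entry mxE. Qed.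

Lemma entryD I (X Y : op R I) i j : entry (X + Y) i j = entry X i j + entry Y i j.
Proof. by rewrite /entry mxE. Qed.

Lemma entryZ I a (X : op R I) i j : entry (a *: X) i j = a * entry X i j.
Proof. by rewrite /entry mxE. Qed.

Lemma entry_sum I (T : Type) (r : seq T) (P : pred T) (F : T -> op R I) i j :
  entry (\sum_(t <- r | P t) F t) i j = \sum_(t <- r | P t) entry (F t) i j.
Proof. by rewrite /entry summxE. Qed.

Lemma sum_enum_rank I (F : 'I_#|{: I}| -> R[i]) :
  \sum_s F s = \sum_(i : I) F (enum_rank i).
Proof. by rewrite (reindex (@enum_rank I)) //; exact/onW_bij/enum_rank_bij. Qed.

Lemma sum_pair I J (V : nmodType) (F : I * J -> V) :
  \sum_p F p = \sum_i \sum_j F (i, j).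
Proof. by rewrite pair_bigA; apply: eq_bigr => -[]. Qed.

Lemma sum_delta I (i0 : I) (F : I -> R[i]) :
  (forall i, i != i0 -> F i = 0) -> \sum_i F i = F i0.
Proof. by move=> h; rewrite (bigD1 i0) //= big1 ?addr0. Qed.

Lemma tr_entry I (X : op R I) : \tr X = \sum_i entry X i i.
Proof. exact: sum_enum_rank. Qed.

Lemma psdP I (X : op R I) :
  psd X <-> forall v : I -> R[i],
    0 <= \sum_i \sum_j Num.conj (v i) * entry X i j * v j.
Proof.
have E (v : 'cV[R[i]]_#|{: I}|) : (v^t* *m X *m v)%sesqui 0 0 =
    \sum_i \sum_j Num.conj (v (enum_rank i) 0) * entry X i j * v (enum_rank j) 0.
  rewrite mxE sum_enum_rank exchange_big /=; apply: eq_bigr => j _.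
  by rewrite mxE mulr_suml sum_enum_rank; apply: eq_bigr => i _; rewrite !mxE.
split=> [h v|h v]; last by rewrite E.
have := h (\col_s v (enum_val s)); rewrite E.
by under eq_bigr do under eq_bigr do rewrite !mxE !enum_rankK.
Qed.

Lemma psd0 I : psd (0 : op R I).
Proof. by move=> v; rewrite mulmx0 mul0mx mxE. Qed.

Lemma psdD I (X Y : op R I) : psd X -> psd Y -> psd (X + Y).
Proof. by move=> hX hY v; rewrite mulmxDr mulmxDl mxE addr_ge0. Qed.

Lemma psd_sum I (T : Type) (r : seq T) (P : pred T) (F : T -> op R I) :
  (forall t, P t -> psd (F t)) -> psd (\sum_(t <- r | P t) F t).
Proof. by move=> h; elim/big_ind: _ => //; [exact: psd0|exact: psdD]. Qed.

Lemma psd_tr_ge0 I (X : op R I) : psd X -> 0 <= \tr X.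
Proof.
move=> /psdP h; rewrite tr_entry; apply: sumr_ge0 => i _.
have := h (fun j => (j == i)%:R); rewrite (bigD1 i) //= [X in _ + X]big1 ?addr0.
  rewrite (bigD1 i) //= [X in _ + X]big1 ?addr0; last first.
    by move=> j /negPf->; rewrite mulr0.
  by rewrite eqxx conjC1 mul1r mulr1.
by move=> j /negPf ->; rewrite big1 // => k _; rewrite conjC0 !mul0r.
Qed.

(** Conjugation by a 0-1 matrix with one 1 in each row. For a bijective [g] it relabels the basis;
    if [g] fixes a measured label and runs through the residual system, it is one branch of a basis
    measurement. *)
Definition pull I J (g : J -> I) (X : op R I) : op R J :=
  mkop (fun x y => entry X (g x) (g y)).

Lemma entry_pull I J (g : J -> I) X x y : entry (pull g X) x y = entry X (g x) (g y).
Proof. exact: entry_mkop. Qed.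

Lemma pull_linear I J (g : J -> I) a S T :
  pull g (a *: S + T) = a *: pull g S + pull g T.
Proof. by apply: opP => x y; rewrite !(entry_pull, entryD, entryZ). Qed.

Definition kconj I J (K : J -> I -> R[i]) (X : op R I) : op R J :=
  mkop (fun x y => \sum_i \sum_j K x i * entry X i j * Num.conj (K y j)).

Lemma entry_kconj I J (K : J -> I -> R[i]) (X : op R I) x y :
  entry (kconj K X) x y = \sum_i \sum_j K x i * entry X i j * Num.conj (K y j).
Proof. exact: entry_mkop. Qed.

Lemma kconj_linear I J (K : J -> I -> R[i]) a S T :
  kconj K (a *: S + T) = a *: kconj K S + kconj K T.
Proof.
apply: opP => x y; rewrite !(entry_kconj, entryD, entryZ) mulr_sumr -big_split.
apply: eq_bigr => i _ /=; rewrite mulr_sumr -big_split; apply: eq_bigr => j _ /=.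
by rewrite entryD entryZ; ring.
Qed.

Lemma kconj_psd I J (K : J -> I -> R[i]) X : psd X -> psd (kconj K X).
Proof.
move=> /psdP h; apply/psdP => v.
have := h (fun i => \sum_x Num.conj (K x i) * v x).
congr (0 <= _); symmetry.
under eq_bigr do under eq_bigr do
  rewrite entry_kconj mulr_sumr mulr_suml.
rewrite (eq_bigr (fun x => \sum_y \sum_i \sum_j
  Num.conj (v x) * (K x i * entry X i j * Num.conj (K y j)) * v y)); last first.
  move=> x _; apply: eq_bigr => y _; apply: eq_bigr => i _.
  by rewrite mulr_sumr mulr_suml.
transitivity (\sum_i \sum_j \sum_x \sum_y
  Num.conj (v x) * (K x i * entry X i j * Num.conj (K y j)) * v y).
  under eq_bigr do rewrite exchange_big /=.
  rewrite exchange_big /=; apply: eq_bigr => i _.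
  under eq_bigr do rewrite exchange_big /=.
  by rewrite exchange_big.
apply: eq_bigr => i _; apply: eq_bigr => j _.
rewrite rmorph_sum /= !mulr_suml; apply: eq_bigr => x _.
rewrite mulr_sumr; apply: eq_bigr => y _.
by rewrite rmorphM /= conjCK; ring.
Qed.

Lemma eq_kconj I J (K L : J -> I -> R[i]) (X : op R I) :
  (forall x i, K x i = L x i) -> kconj K X = kconj L X.
Proof.
move=> e; apply: opP => x y; rewrite !entry_kconj.
by apply: eq_bigr => i _; apply: eq_bigr => j _; rewrite !e.
Qed.

Lemma kconj_comp I J H (K : H -> J -> R[i]) (L : J -> I -> R[i]) (X : op R I) :
  kconj K (kconj L X) = kconj (fun x i => \sum_y K x y * L y i) X.
Proof.
apply: opP => x y; rewrite !entry_kconj.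
under eq_bigr do under eq_bigr do rewrite entry_kconj mulr_sumr mulr_suml.
under eq_bigr do rewrite exchange_big /=.
rewrite exchange_big /=; apply: eq_bigr => i _.
under eq_bigr do under eq_bigr do rewrite mulr_sumr mulr_suml.
under eq_bigr do rewrite exchange_big /=.
rewrite exchange_big /=; apply: eq_bigr => j _.
rewrite mulr_suml mulr_suml; apply: eq_bigr => k _.
rewrite rmorph_sum mulr_sumr; apply: eq_bigr => l _.
by rewrite rmorphM /=; ring.
Qed.

Lemma pull_kconj I J (g : J -> I) X :
  pull g X = kconj (fun x i => (i == g x)%:R) X.
Proof.
apply: opP => x y; rewrite entry_pull entry_kconj (bigD1 (g x)) //=.
rewrite [X in _ + X]big1 ?addr0; last first.
  by move=> i /negPf ->; rewrite big1 // => j _; rewrite !mul0r.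
rewrite (bigD1 (g y)) //= [X in _ + X]big1 ?addr0; last first.
  by move=> i /negPf ->; rewrite conjC0 mulr0.
by rewrite !eqxx conjC1 mul1r mulr1.
Qed.

Lemma pull_psd I J (g : J -> I) X : psd X -> psd (pull g X).
Proof. by move=> h; rewrite pull_kconj; exact: kconj_psd. Qed.

Lemma pull_comp I J K (g : J -> I) (h : K -> J) X :
  pull h (pull g X) = pull (g \o h) X.
Proof. by apply: opP => x y; rewrite !entry_pull. Qed.

Lemma ampl_pull I J K (g : J -> I) (X : op R (I * K)) :
  ampl (pull g) X = pull (fun z => (g z.1, z.2)) X.
Proof. by apply: opP => x y; rewrite entry_mkop !entry_pull entry_mkop. Qed.

Lemma ampr_pull I J K (g : J -> I) (X : op R (K * I)) :
  ampr (pull g) X = pull (fun z => (z.1, g z.2)) X.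
Proof. by apply: opP => x y; rewrite entry_mkop !entry_pull entry_mkop. Qed.

Lemma ampl_kconj I J K (k : J -> I -> R[i]) (X : op R (I * K)) :
  ampl (kconj k) X = kconj (fun z w => k z.1 w.1 * (z.2 == w.2)%:R) X.
Proof.
apply: opP => x y; rewrite entry_mkop !entry_kconj sum_pair; symmetry.
apply: eq_bigr => i _; rewrite (sum_delta (i0 := x.2)) /=; last first.
  by move=> l /negPf; rewrite eq_sym => ->; rewrite big1 // => j _; rewrite mulr0 !mul0r.
rewrite sum_pair; apply: eq_bigr => j _; rewrite (sum_delta (i0 := y.2)) /=.
  by rewrite !eqxx !mulr1 entry_mkop.
by move=> l /negPf; rewrite eq_sym => ->; rewrite mulr0 conjC0 mulr0.
Qed.

Lemma ampr_kconj I J K (k : J -> I -> R[i]) (X : op R (K * I)) :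
  ampr (kconj k) X = kconj (fun z w => k z.2 w.2 * (z.1 == w.1)%:R) X.
Proof.
apply: opP => x y; rewrite entry_mkop !entry_kconj; symmetry; rewrite sum_pair exchange_big /=.
apply: eq_bigr => i _; rewrite (sum_delta (i0 := x.1)) /=; last first.
  by move=> l /negPf; rewrite eq_sym => ->; rewrite big1 // => j _; rewrite mulr0 !mul0r.
rewrite sum_pair exchange_big /=; apply: eq_bigr => j _.
rewrite (sum_delta (i0 := y.1)) /=.
  by rewrite !eqxx !mulr1 entry_mkop.
by move=> l /negPf; rewrite eq_sym => ->; rewrite mulr0 conjC0 mulr0.
Qed.

Definition prodop A B A' B' (S : op R (A * B)) (U : op R (A' * B')) :
    op R ((A * A') * (B * B')) :=
  mkop (fun x y => entry S (x.1.1, x.2.1) (y.1.1, y.2.1) *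
                   entry U (x.1.2, x.2.2) (y.1.2, y.2.2)).

End Entries.

(** * LOCC protocols *)

Section Locc.
Variable R : realType.
Implicit Types A B I J K M N : finType.

Lemma mkop_linear I (F G : I -> I -> R[i]) a :
  mkop (fun i j => a * F i j + G i j) = a *: mkop F + mkop G.
Proof. by apply: opP => i j; rewrite entryD entryZ !entry_mkop. Qed.

Lemma ampl_linear I J K (f : op R I -> op R J) (fL : linear f) a
    (S T : op R (I * K)) :
  ampl f (a *: S + T) = a *: ampl f S + ampl f T.
Proof.
apply: opP => x y; rewrite entryD entryZ !entry_mkop -entryZ -entryD -fL -mkop_linear.
by congr (entry (f (mkop _)) _ _); apply/funext => i; apply/funext => j;
  rewrite entryD entryZ.
Qed.

Lemma ampr_ampl I J K (f : op R I -> op R J) (X : op R (K * I)) :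
  ampr f X = pull (fun z => (z.2, z.1)) (ampl f (pull (fun z => (z.2, z.1)) X)).
Proof.
apply: opP => x y; rewrite entry_pull !entry_mkop /=.
by congr (entry (f (mkop _)) _ _); apply/funext => i; apply/funext => j;
  rewrite entry_pull.
Qed.

Lemma ampr_linear I J K (f : op R I -> op R J) (fL : linear f) a
    (S T : op R (K * I)) :
  ampr f (a *: S + T) = a *: ampr f S + ampr f T.
Proof. by rewrite !ampr_ampl pull_linear ampl_linear // pull_linear. Qed.

Lemma tr_pull_bij I J (g : J -> I) (X : op R I) : bijective g -> \tr (pull g X) = \tr X.
Proof.
move=> bg; rewrite !tr_entry (reindex g); last exact: onW_bij.
by apply: eq_bigr => x _; rewrite entry_pull.
Qed.

Lemma swap_bij I J : bijective (fun z : I * J => (z.2, z.1)).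
Proof. by exists (fun z => (z.2, z.1)) => -[]. Qed.

Lemma instrument_ampl_tr I M (J : M -> finType) K
    (f : forall m : M, {linear op R I -> op R (J m)}) (T : op R (I * K)) :
  instrument f -> \sum_m \tr (ampl (f m) T) = \tr T.
Proof.
move=> [_ ftr]; rewrite [RHS]tr_entry sum_pair exchange_big /=.
transitivity (\sum_m \sum_k
    \tr (f m (mkop (fun i j => entry T (i, k) (j, k))))).
  apply: eq_bigr => m _; rewrite tr_entry sum_pair exchange_big /=.
  by apply: eq_bigr => k _; rewrite tr_entry; apply: eq_bigr => j _; rewrite entry_mkop.
rewrite exchange_big; apply: eq_bigr => k _ /=; rewrite ftr tr_entry.
by apply: eq_bigr => i _; rewrite entry_mkop.
Qed.

Lemma instrument_ampr_tr I M (J : M -> finType) K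
    (f : forall m : M, {linear op R I -> op R (J m)}) (T : op R (K * I)) :
  instrument f -> \sum_m \tr (ampr (f m) T) = \tr T.
Proof.
move=> fI; rewrite -(tr_pull_bij T (swap_bij I K)) -(instrument_ampl_tr _ fI).
by apply: eq_bigr => m _; rewrite ampr_ampl tr_pull_bij //; exact: swap_bij.
Qed.

Section Properties.
Variables (X : finType) (OA OB : X -> finType).

Lemma locc_linear A B (Lam : forall x : X, op R (A * B) -> op R (OA x * OB x)) :
  locc_instrument Lam -> forall x, linear (Lam x).
Proof.
elim=> {A B Lam} [x Lam h1 h2|A B M A' f Gam Lam _ _ IH h|A B M B' f Gam Lam _ _ IH h] y a S T.
- have [->|yx] := eqVneq y x; first by rewrite !h1.
  by rewrite !h2 // scaler0 addr0.
- rewrite !h scaler_sumr -big_split; apply: eq_bigr => m _ /=.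
  by rewrite ampl_linear ?IH //; exact: linearP.
- rewrite !h scaler_sumr -big_split; apply: eq_bigr => m _ /=.
  by rewrite ampr_linear ?IH //; exact: linearP.
Qed.

Lemma locc_psd A B (Lam : forall x : X, op R (A * B) -> op R (OA x * OB x)) :
  locc_instrument Lam -> forall x T, psd T -> psd (Lam x T).
Proof.
elim=> {A B Lam} [x Lam h1 h2|A B M A' f Gam Lam [fcp _] _ IH h|A B M B' f Gam Lam [fcp _] _ IH h] y T Tp.
- have [->|yx] := eqVneq y x; first by rewrite h1.
  by rewrite h2 //; exact: psd0.
- by rewrite h; apply: psd_sum => m _; apply/IH/fcp.
- rewrite h; apply: psd_sum => m _; apply: IH; rewrite ampr_ampl.
  by apply/pull_psd/fcp/pull_psd.
Qed.

Lemma locc_tr A B (Lam : forall x : X, op R (A * B) -> op R (OA x * OB x)) :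
  locc_instrument Lam -> forall T, \sum_x \tr (Lam x T) = \tr T.
Proof.
elim=> {A B Lam} [x Lam h1 h2|A B M A' f Gam Lam fI _ IH h|A B M B' f Gam Lam fI _ IH h] T.
- by rewrite (bigD1 x) //= h1 big1 ?addr0 // => y yx; rewrite h2 ?mxtrace0.
- rewrite -(instrument_ampl_tr _ fI).
  under eq_bigr do rewrite h raddf_sum /=.
  by rewrite exchange_big; apply: eq_bigr => m _; rewrite IH.
- rewrite -(instrument_ampr_tr _ fI).
  under eq_bigr do rewrite h raddf_sum /=.
  by rewrite exchange_big; apply: eq_bigr => m _; rewrite IH.
Qed.

(** [Locc_alice] expects bundled linear maps, while [pull g], [kconj K] and amplified maps are plain
    functions; the bundling is done once here. *)
Lemma locc_alice_fun A B M (A' : M -> finType) (f : forall m, op R A -> op R (A' m))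
    (Gam : forall (m : M) (x : X), op R (A' m * B) -> op R (OA x * OB x))
    (Lam : forall x : X, op R (A * B) -> op R (OA x * OB x)) :
  (forall m, linear (f m)) ->
  (forall m K (T : op R (A * K)), psd T -> psd (ampl (f m) T)) ->
  (forall T, \sum_m \tr (f m T) = \tr T) ->
  (forall m, locc_instrument (Gam m)) ->
  (forall x T, Lam x T = \sum_m Gam m x (ampl (f m) T)) ->
  locc_instrument Lam.
Proof.
move=> fL fP fT hG hL.
pose g m : {linear op R A -> op R (A' m)} :=
  HB.pack (f m) (GRing.isLinear.Build _ _ _ _ _ (fL m)).
by apply: (@Locc_alice _ _ _ _ _ _ _ _ g Gam) => //; split=> // m; exact: fP.
Qed.

Lemma locc_bob_fun A B M (B' : M -> finType) (f : forall m, op R B -> op R (B' m))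
    (Gam : forall (m : M) (x : X), op R (A * B' m) -> op R (OA x * OB x))
    (Lam : forall x : X, op R (A * B) -> op R (OA x * OB x)) :
  (forall m, linear (f m)) ->
  (forall m K (T : op R (B * K)), psd T -> psd (ampl (f m) T)) ->
  (forall T, \sum_m \tr (f m T) = \tr T) ->
  (forall m, locc_instrument (Gam m)) ->
  (forall x T, Lam x T = \sum_m Gam m x (ampr (f m) T)) ->
  locc_instrument Lam.
Proof.
move=> fL fP fT hG hL.
pose g m : {linear op R B -> op R (B' m)} :=
  HB.pack (f m) (GRing.isLinear.Build _ _ _ _ _ (fL m)).
by apply: (@Locc_bob _ _ _ _ _ _ _ _ g Gam) => //; split=> // m; exact: fP.
Qed.

Lemma pull_instrument_tr I J M (g : M -> J -> I) (T : op R I) :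
  bijective (fun z : M * J => g z.1 z.2) -> \sum_m \tr (pull (g m) T) = \tr T.
Proof.
move=> bg; rewrite [RHS]tr_entry (reindex (fun z : M * J => g z.1 z.2)); last exact: onW_bij.
rewrite sum_pair; apply: eq_bigr => m _; rewrite tr_entry.
by apply: eq_bigr => j _; rewrite entry_pull.
Qed.

(* Both parties measure in the basis labelled by [M], resp. [N], keeping the
   residual system, and announce the outcomes. *)
Lemma locc_measure A B A' B' M N (g : M -> A' -> A) (h : N -> B' -> B)
    (Gam : forall (a : M) (b : N) (x : X), op R (A' * B') -> op R (OA x * OB x))
    (Lam : forall x : X, op R (A * B) -> op R (OA x * OB x)) :
  bijective (fun z : M * A' => g z.1 z.2) ->
  bijective (fun z : N * B' => h z.1 z.2) ->
  (forall a b, locc_instrument (Gam a b)) ->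
  (forall x T, Lam x T =
    \sum_a \sum_b Gam a b x (pull (fun z => (g a z.1, h b z.2)) T)) ->
  locc_instrument Lam.
Proof.
move=> bg bh hG hL.
apply: (@locc_alice_fun _ _ M (fun=> A') (fun a => pull (g a))
   (fun a x T => \sum_b Gam a b x (pull (fun z => (z.1, h b z.2)) T))) => //.
- by move=> m a S T; exact: pull_linear.
- by move=> m K T hT; rewrite ampl_pull; exact: pull_psd.
- by move=> T; exact: pull_instrument_tr.
- move=> a; apply: (@locc_bob_fun _ _ N (fun=> B') (fun b => pull (h b)) (Gam a)) => //.
  + by move=> m b S T; exact: pull_linear.
  + by move=> m K T hT; rewrite ampl_pull; exact: pull_psd.
  + by move=> T; exact: pull_instrument_tr.
  + by move=> x T; apply: eq_bigr => b _; rewrite ampr_pull.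
- move=> x T; rewrite hL; apply: eq_bigr => a _; apply: eq_bigr => b _.
  by rewrite ampl_pull pull_comp.
Qed.

Lemma locc_relabel A B A' B' (g : A' -> A) (h : B' -> B)
    (Gam : forall x : X, op R (A' * B') -> op R (OA x * OB x))
    (Lam : forall x : X, op R (A * B) -> op R (OA x * OB x)) :
  bijective g -> bijective h -> locc_instrument Gam ->
  (forall x T, Lam x T = Gam x (pull (fun z => (g z.1, h z.2)) T)) ->
  locc_instrument Lam.
Proof.
move=> [g' gK g'K] [h' hK h'K] hG hL.
apply: (@locc_measure _ _ A' B' unit unit (fun=> g) (fun=> h) (fun _ _ => Gam)) => //.
- by exists (fun a => (tt, g' a)) => [[[] a]|a] /=; rewrite ?gK ?g'K.
- by exists (fun a => (tt, h' a)) => [[[] a]|a] /=; rewrite ?hK ?h'K.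
- by move=> x T; rewrite hL !(big_const, card_unit) /= !addr0.
Qed.

Definition unitary_kernel I (u : I -> I -> R[i]) :=
  forall i j, \sum_x Num.conj (u x i) * u x j = (i == j)%:R.

Lemma kconj_tr I (u : I -> I -> R[i]) (T : op R I) :
  unitary_kernel u -> \tr (kconj u T) = \tr T.
Proof.
move=> hu; rewrite !tr_entry.
have E i j : \sum_x u x i * entry T i j * Num.conj (u x j) = entry T i j * (j == i)%:R.
  by rewrite -hu mulr_sumr; apply: eq_bigr => x _; ring.
under eq_bigr do rewrite entry_kconj.
rewrite exchange_big; apply: eq_bigr => i _ /=; rewrite exchange_big /=.
under eq_bigr do rewrite E.
by rewrite (sum_delta (i0 := i)) ?eqxx ?mulr1 // => j /negPf ->; rewrite mulr0.
Qed.

Lemma locc_unitary A B (u : A -> A -> R[i]) (v : B -> B -> R[i])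
    (Gam : forall x : X, op R (A * B) -> op R (OA x * OB x))
    (Lam : forall x : X, op R (A * B) -> op R (OA x * OB x)) :
  unitary_kernel u -> unitary_kernel v -> locc_instrument Gam ->
  (forall x T, Lam x T = Gam x (kconj (fun z w => u z.1 w.1 * v z.2 w.2) T)) ->
  locc_instrument Lam.
Proof.
move=> hu hv hG hL.
apply: (@locc_alice_fun _ _ unit (fun=> A) (fun=> kconj u)
   (fun _ x T => Gam x (ampr (kconj v) T))) => //.
- by move=> _ a S T; exact: kconj_linear.
- by move=> _ K T hT; rewrite ampl_kconj; exact: kconj_psd.
- by move=> T; rewrite big_const card_unit /= addr0 kconj_tr.
- move=> _; apply: (@locc_bob_fun _ _ unit (fun=> B) (fun=> kconj v) (fun=> Gam)) => //.
  + by move=> _ a S T; exact: kconj_linear.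
  + by move=> _ K T hT; rewrite ampl_kconj; exact: kconj_psd.
  + by move=> T; rewrite big_const card_unit /= addr0 kconj_tr.
  + by move=> x T; rewrite big_const card_unit /= addr0.
- move=> x T; rewrite big_const card_unit /= addr0 hL ampr_kconj ampl_kconj kconj_comp.
  congr (Gam x _); apply: eq_kconj => y w; symmetry.
  rewrite sum_pair (sum_delta (i0 := y.1)) => [|i /negPf e]; last first.
    by rewrite big1 // => j _ /=; rewrite eq_sym e mulr0 mul0r.
  rewrite (sum_delta (i0 := w.2)) /= ?eqxx ?mulr1 1?mulrC // => j /negPf e.
  by rewrite e !mulr0.
Qed.

End Properties.
End Locc.

(** * Composing protocols: sequences, idle systems, tests, many copies *)

Section Composition.
Variable R : realType.
Implicit Types A B C D H I J K L M N : finType.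

Section Labelled.
Variables (X : finType) (OA OB : X -> finType).

Lemma locc_ext A B (Lam Gam : forall x : X, op R (A * B) -> op R (OA x * OB x)) :
  (forall x T, Lam x T = Gam x T) -> locc_instrument Gam -> locc_instrument Lam.
Proof.
move=> h; have -> // : Lam = Gam.
by apply: functional_extensionality_dep => x; apply/funext => T.
Qed.

Lemma locc_sum A B (Lam : forall x : X, op R (A * B) -> op R (OA x * OB x)) :
  locc_instrument Lam -> forall x (I : Type) (r : seq I) (P : pred I) F,
    Lam x (\sum_(i <- r | P i) F i) = \sum_(i <- r | P i) Lam x (F i).
Proof.
move=> /locc_linear hL x I r P F.
pose g : {linear _ -> _} := HB.pack (Lam x) (GRing.isLinear.Build _ _ _ _ _ (hL x)).
exact: (raddf_sum g).
Qed.

Lemma locc_scale A B (Lam : forall x : X, op R (A * B) -> op R (OA x * OB x)) :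
  locc_instrument Lam -> forall x a T, Lam x (a *: T) = a *: Lam x T.
Proof.
move=> /locc_linear hL x a T.
pose g : {linear _ -> _} := HB.pack (Lam x) (GRing.isLinear.Build _ _ _ _ _ (hL x)).
exact: (linearZZ g).
Qed.

Lemma locc0 A B (Lam : forall x : X, op R (A * B) -> op R (OA x * OB x)) :
  locc_instrument Lam -> forall x, Lam x 0 = 0.
Proof. by move=> h x; rewrite -(scale0r 0) locc_scale // scale0r. Qed.

(** The output space varies with the outcome, so keeping [T] under the label [x] and returning 0
    under the others needs a cast along a decided equality; proof irrelevance makes the cast trivial
    at [x]. *)
Lemma locc_stop_ex (x : X) : exists2 Lam : forall y, op R (OA x * OB x) -> op R (OA y * OB y),
  locc_instrument Lam & (forall T, Lam x T = T) /\ (forall y T, y != x -> Lam y T = 0).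
Proof.
pose Lam y (T : op R (OA x * OB x)) : op R (OA y * OB y) :=
  if pselect (x = y) is left e then ecast z (op R (OA z * OB z)) e T else 0.
have h1 T : Lam x T = T.
  by rewrite /Lam; case: pselect => // e; rewrite (Prop_irrelevance e erefl).
have h2 y T : y != x -> Lam y T = 0.
  by rewrite /Lam; case: pselect => // e /eqP /(_ (esym e)).
by exists Lam => //; exact: (Locc_stop h1 h2).
Qed.

(** Induction on the tree of [Lam]: [Gam y] is grafted at every leaf that announces [y], and
    linearity of [Gam] moves the sum over branches through it. *)
Lemma locc_seq (Y : finType) (PA PB : Y -> finType) A B
    (Lam : forall y : Y, op R (A * B) -> op R (PA y * PB y))
    (Gam : forall (y : Y) (x : X), op R (PA y * PB y) -> op R (OA x * OB x)) :
  locc_instrument Lam -> (forall y, locc_instrument (Gam y)) ->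
  locc_instrument (fun x T => \sum_y Gam y x (Lam y T)).
Proof.
move=> hL hG; elim: hL => {A B Lam} [y Lam h1 h2|A B M A' f Del Lam fI _ IH h|A B M B' f Del Lam fI _ IH h].
- apply: locc_ext (hG y) => x T; rewrite (bigD1 y) //= h1 big1 ?addr0 // => z zy.
  by rewrite h2 ?locc0.
- apply: (Locc_alice fI IH) => x T; rewrite exchange_big; apply: eq_bigr => y _ /=.
  by rewrite h locc_sum.
- apply: (Locc_bob fI IH) => x T; rewrite exchange_big; apply: eq_bigr => y _ /=.
  by rewrite h locc_sum.
Qed.

Lemma ampl_ampl_psd I J K H (f : op R I -> op R J) :
  (forall L (T : op R (I * L)), psd T -> psd (ampl f T)) ->
  forall T : op R ((I * K) * H), psd T -> psd (ampl (ampl f) T).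
Proof.
move=> hf T hT.
have -> : ampl (ampl f) T = pull (fun z : (J * K) * H => (z.1.1, (z.1.2, z.2)))
    (ampl f (pull (fun z => ((z.1, z.2.1), z.2.2)) T)).
  apply: opP => x y; rewrite entry_pull !entry_mkop /=.
  congr (entry (f (mkop _)) _ _); apply/funext => i; apply/funext => j.
  by rewrite entry_pull entry_mkop.
by apply/pull_psd/hf/pull_psd.
Qed.

Lemma linear_mkopZ I J (f : op R I -> op R J) (fL : linear f) (F : I -> I -> R[i]) a :
  f (mkop (fun i j => F i j * a)) = a *: f (mkop F).
Proof.
pose g : {linear op R I -> op R J} := HB.pack f (GRing.isLinear.Build _ _ _ _ _ fL).
rewrite -[RHS](linearZZ g); congr f.
by apply: opP => i j; rewrite entryZ !entry_mkop mulrC.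
Qed.

Lemma ampl_prodop A B C D A' (f : op R A -> op R A') (fL : linear f)
    (S : op R (A * B)) (U : op R (C * D)) :
  ampl (ampl f) (prodop S U) = prodop (ampl f S) U.
Proof.
apply: opP => x y; rewrite !entry_mkop /= mulrC -entryZ -linear_mkopZ //.
congr (entry (f (mkop _)) _ _); apply/funext => i; apply/funext => j.
by rewrite !entry_mkop.
Qed.

Lemma ampr_prodop A B C D B' (f : op R B -> op R B') (fL : linear f)
    (S : op R (A * B)) (U : op R (C * D)) :
  ampr (ampl f) (prodop S U) = prodop (ampr f S) U.
Proof.
apply: opP => x y; rewrite !entry_mkop /= mulrC -entryZ -linear_mkopZ //.
congr (entry (f (mkop _)) _ _); apply/funext => i; apply/funext => j.
by rewrite !entry_mkop.
Qed.

(** [C] and [D] are idle systems: the same tree works with every local instrument amplified by the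
    identity on [C] or [D]. *)
Lemma locc_tensor A B C D (Lam : forall x : X, op R (A * B) -> op R (OA x * OB x)) :
  locc_instrument Lam ->
  exists2 Lam' : forall x : X, op R ((A * C) * (B * D)) -> op R ((OA x * C) * (OB x * D)),
    @locc_instrument R X (fun x => (OA x * C)%type) (fun x => (OB x * D)%type) _ _ Lam' &
    forall x S U, Lam' x (prodop S U) = prodop (Lam x S) U.
Proof.
have prod0 I J (U : op R (C * D)) : prodop (0 : op R (I * J)) U = 0.
  by apply: opP => x y; rewrite entry_mkop !entry0 mul0r.
have prod_sum I J (m : finType) (F : m -> op R (I * J)) (U : op R (C * D)) :
    prodop (\sum_i F i) U = \sum_i prodop (F i) U.
  apply: opP => x y; rewrite entry_mkop !entry_sum mulr_suml.
  by apply: eq_bigr => i _; rewrite entry_mkop.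
elim=> {A B Lam} [x Lam h1 h2|A B M A' f Gam Lam [fP fT] _ IH h|A B M B' f Gam Lam [fP fT] _ IH h].
- pose Lam' y (T : op R ((OA x * C) * (OB x * D))) : op R ((OA y * C) * (OB y * D)) :=
    if pselect (x = y) is left e then ecast z (op R ((OA z * C) * (OB z * D))) e T else 0.
  have h1' T : Lam' x T = T.
    by rewrite /Lam'; case: pselect => // e; rewrite (Prop_irrelevance e erefl).
  have h2' y T : y != x -> Lam' y T = 0.
    by rewrite /Lam'; case: pselect => // e /eqP /(_ (esym e)).
  exists Lam'; first exact: (Locc_stop h1' h2').
  move=> y S U; have [->|yx] := eqVneq y x; first by rewrite h1' h1.
  by rewrite h2' // h2.
- exists (fun x T => \sum_m s2val (cid2 (IH m)) x (ampl (ampl (f m)) T)).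
    apply: (@locc_alice_fun _ _ _ _ _ _ _ (fun m => (A' m * C)%type) (fun m => ampl (f m))
      (fun m => s2val (cid2 (IH m)))) => //.
    + by move=> m a S T; apply: ampl_linear; exact: linearP.
    + by move=> m K T; apply: ampl_ampl_psd; exact: fP.
    + by move=> T; exact: instrument_ampl_tr.
    + by move=> m; exact: s2valP (cid2 (IH m)).
  move=> x S U; rewrite h prod_sum; apply: eq_bigr => m _.
  by rewrite ampl_prodop ?(s2valP' (cid2 (IH m))) //; exact: linearP.
- exists (fun x T => \sum_m s2val (cid2 (IH m)) x (ampr (ampl (f m)) T)).
    apply: (@locc_bob_fun _ _ _ _ _ _ _ (fun m => (B' m * D)%type) (fun m => ampl (f m))
      (fun m => s2val (cid2 (IH m)))) => //.
    + by move=> m a S T; apply: ampl_linear; exact: linearP.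
    + by move=> m K T; apply: ampl_ampl_psd; exact: fP.
    + by move=> T; exact: instrument_ampl_tr.
    + by move=> m; exact: s2valP (cid2 (IH m)).
  move=> x S U; rewrite h prod_sum; apply: eq_bigr => m _.
  by rewrite ampr_prodop ?(s2valP' (cid2 (IH m))) //; exact: linearP.
Qed.

(** Both parties measure their part of [S], announce the results and continue on [U] according to
    the verdict [P]. On a product input the verdict is independent of [U], so its probability comes
    out as a scalar. *)
Lemma locc_test A B C D (P : A -> B -> bool)
    (G1 G0 : forall x : X, op R (C * D) -> op R (OA x * OB x)) :
  locc_instrument G1 -> locc_instrument G0 ->
  exists2 Lam : forall x : X, op R ((A * C) * (B * D)) -> op R (OA x * OB x),
    locc_instrument Lam &
    forall x S U, Lam x (prodop S U) =
      (\sum_(z | P z.1 z.2) entry S z z) *: G1 x U +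
      (\sum_(z | ~~ P z.1 z.2) entry S z z) *: G0 x U.
Proof.
move=> h1 h0; exists (fun x T => \sum_a \sum_b (if P a b then G1 else G0) x
    (pull (fun z => ((a, z.1), (b, z.2))) T)).
  apply: (@locc_measure _ _ _ _ _ _ C D A B pair pair (fun a b => if P a b then G1 else G0)) => //.
  - by exists id => -[].
  - by exists id => -[].
  - by move=> a b; case: ifP.
move=> x S U; rewrite !scaler_suml [X in _ = X + _]big_mkcond [X in _ = _ + X]big_mkcond -big_split sum_pair /=.
apply: eq_bigr => a _; apply: eq_bigr => b _ /=.
have -> : pull (fun z => ((a, z.1), (b, z.2))) (prodop S U) = entry S (a, b) (a, b) *: U.
  by apply: opP => y z; rewrite entry_pull entry_mkop entryZ /= -!surjective_pairing.
by case: ifP => _; rewrite ?addr0 ?add0r locc_scale.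
Qed.

End Labelled.

Lemma locc_after (X : finType) (OA OB : X -> finType) A B A' B'
    (Lam : op R (A * B) -> op R (A' * B'))
    (Gam : forall x : X, op R (A' * B') -> op R (OA x * OB x)) :
  locc_channel Lam -> locc_instrument Gam ->
  locc_instrument (fun x T => Gam x (Lam T)).
Proof.
move=> hL hG; apply: locc_ext (locc_seq hL (fun=> hG)) => x T.
by rewrite big_const card_unit /= addr0.
Qed.

Lemma channel_comp A B A' B' I J (Lam : op R (A * B) -> op R (A' * B'))
    (Gam : op R (A' * B') -> op R (I * J)) :
  locc_channel Lam -> locc_channel Gam -> locc_channel (Gam \o Lam).
Proof. exact: locc_after. Qed.

Lemma channel_id A B : locc_channel (fun T : op R (A * B) => T).
Proof.
by apply: (@Locc_stop _ unit (fun=> A) (fun=> B) tt).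
Qed.

Lemma channel_relabel A B A' B' (g : A' -> A) (h : B' -> B) :
  bijective g -> bijective h ->
  locc_channel (pull (R := R) (fun z => (g z.1, h z.2))).
Proof. by move=> bg bh; apply: (locc_relabel bg bh (channel_id _ _)). Qed.

Lemma channel_tensor A B A' B' C D (Lam : op R (A * B) -> op R (A' * B')) :
  locc_channel Lam ->
  exists2 Lam' : op R ((A * C) * (B * D)) -> op R ((A' * C) * (B' * D)),
    locc_channel Lam' & forall S U, Lam' (prodop S U) = prodop (Lam S) U.
Proof.
move=> hL; have [Lam' h1 h2] := locc_tensor C D hL.
by exists (Lam' tt) => //; apply: locc_ext h1 => -[].
Qed.

Lemma channel_tensor_r A B A' B' C D (Lam : op R (A * B) -> op R (A' * B')) :
  locc_channel Lam ->
  exists2 Lam' : op R ((C * A) * (D * B)) -> op R ((C * A') * (D * B')),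
    locc_channel Lam' & forall S U, Lam' (prodop U S) = prodop U (Lam S).
Proof.
have swapE I J K M (S : op R (I * J)) (U : op R (K * M)) :
    pull (fun z : (K * I) * (M * J) => ((z.1.2, z.1.1), (z.2.2, z.2.1))) (prodop S U)
      = prodop U S.
  by apply: opP => x y; rewrite entry_pull !entry_mkop /= mulrC.
move=> /(channel_tensor C D)[Lam' h1 h2].
exists (pull (fun z => ((z.1.2, z.1.1), (z.2.2, z.2.1))) \o Lam' \o
        pull (fun z => ((z.1.2, z.1.1), (z.2.2, z.2.1)))).
  apply: channel_comp; first exact: (channel_relabel (swap_bij _ _) (swap_bij _ _)).
  by apply: channel_comp => //; exact: (channel_relabel (swap_bij _ _) (swap_bij _ _)).
by move=> S U /=; rewrite swapE h2 swapE.
Qed.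

(** Discarding is measuring and ignoring the outcome: a test that always succeeds, followed by the
    identity. *)
Lemma channel_discard A B C D :
  exists2 Lam : op R ((C * A) * (D * B)) -> op R (A * B),
    locc_channel Lam & forall S U, Lam (prodop S U) = \tr S *: U.
Proof.
have [Lam h1 h2] := locc_test (fun (_ : C) (_ : D) => true) (channel_id A B) (channel_id A B).
exists (Lam tt) => [|S U]; first by apply: locc_ext h1 => -[].
rewrite h2 /= big_pred0_eq scale0r addr0.
by rewrite tr_entry.
Qed.

Definition join_pow A m n (z : pow A m * pow A n) : pow A (m + n) :=
  [ffun i => match fintype.split i with inl j => z.1 j | inr j => z.2 j end].

Lemma join_pow_bij A m n : bijective (@join_pow A m n).
Proof.
exists (fun w : pow A (m + n) => ([ffun j => w (lshift n j)], [ffun j => w (rshift m j)])).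
  by move=> [u v]; congr pair; apply/ffunP => j; rewrite !ffunE ?(unsplitK (inl j)) ?(unsplitK (inr j)).
move=> w; apply/ffunP => i; rewrite !ffunE.
by case: (splitP i) => j ij; rewrite ffunE; congr (w _); apply: val_inj.
Qed.

Lemma tensor_pow_join A B m n (rho : op R (A * B)) :
  pull (fun z => (join_pow z.1, join_pow z.2)) (tensor_pow (m + n) rho) =
  prodop (tensor_pow m rho) (tensor_pow n rho).
Proof.
apply: opP => x y; rewrite entry_pull !entry_mkop big_split_ord /=.
congr (_ * _); apply: eq_bigr => j _; rewrite !ffunE.
  by rewrite !(unsplitK (inl j)).
by rewrite !(unsplitK (inr j)).
Qed.

Definition uncons_pow A n (w : pow A n.+1) : A * pow A n :=
  (w ord0, [ffun i => w (lift ord0 i)]).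

Lemma uncons_pow_bij A n : bijective (@uncons_pow A n).
Proof.
exists (fun z : A * pow A n =>
    [ffun i : 'I_n.+1 => if unlift ord0 i is Some j then z.2 j else z.1] : pow A n.+1).
  move=> w; apply/ffunP => i; rewrite ffunE.
  by case: unliftP => [j|] ->; rewrite ?ffunE.
move=> [a u]; congr pair; first by rewrite ffunE unlift_none.
by apply/ffunP => j; rewrite !ffunE liftK.
Qed.

Lemma tensor_pow_cons A B n (rho : op R (A * B)) :
  tensor_pow n.+1 rho =
  pull (fun z => (uncons_pow z.1, uncons_pow z.2)) (prodop rho (tensor_pow n rho)).
Proof.
apply: opP => x y; rewrite entry_pull !entry_mkop big_ord_recl /=.
by congr (_ * _); apply: eq_bigr => i _; rewrite !ffunE.
Qed.

Lemma channel_pow A B A' B' m (Lam : op R (pow A m * pow B m) -> op R (A' * B')) n :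
  locc_channel Lam ->
  exists2 Lam' : op R (pow A (n * m) * pow B (n * m)) -> op R (pow A' n * pow B' n),
    locc_channel Lam' &
    forall rho, Lam' (tensor_pow (n * m) rho) = tensor_pow n (Lam (tensor_pow m rho)).
Proof.
move=> hL; elim: n => [|n [Lam' h1 h2]].
  (* With no copies every power of a space has a single label, so a relabelling is the whole
     protocol. *)
  have b0 I J : bijective (fun _ : pow I 0 => ffun0 (card_ord 0) : pow J 0).
    by exists (fun=> ffun0 (card_ord 0)) => w; apply/ffunP => -[].
  exists (pull (fun z => (ffun0 (card_ord 0), ffun0 (card_ord 0)))).
    exact: (channel_relabel (b0 _ _) (b0 _ _)).
  by move=> rho; apply: opP => x y; rewrite entry_pull !entry_mkop !big_ord0.
have [L1 hL1 L1E] := channel_tensor (pow A (n * m)) (pow B (n * m)) hL.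
have [L2 hL2 L2E] := channel_tensor_r A' B' h1.
(* [n.+1 * m] unfolds to [m + n * m], so [join_pow] peels off one block of [m] copies without a
   cast. *)
exists (pull (fun z => (uncons_pow z.1, uncons_pow z.2)) \o L2 \o L1 \o
        pull (fun z => (@join_pow _ m (n * m) z.1, @join_pow _ m (n * m) z.2))).
  apply: channel_comp; first exact: (channel_relabel (@join_pow_bij _ _ _) (@join_pow_bij _ _ _)).
  apply: channel_comp => //; apply: channel_comp => //.
  exact: (channel_relabel (@uncons_pow_bij _ _) (@uncons_pow_bij _ _)).
by move=> rho /=; rewrite tensor_pow_join L1E L2E h2 -tensor_pow_cons.
Qed.

End Composition.

(** * Bell weights *)

Section Characters.
Variable R : realType.

Notation bits I := {ffun I -> bool}.

(** The characters of the group [bits I], whose addition is bitwise exclusive or, inherited from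
    [bool]. *)
Definition chi (I : finType) (f z : bits I) : R[i] := \prod_i (-1) ^+ (f i && z i).

Section Chi.
Variable I : finType.
Implicit Types e f z w : bits I.

Lemma chiC f z : chi f z = chi z f.
Proof. by apply: eq_bigr => i _; rewrite andbC. Qed.

Lemma chiD f z w : chi f (z + w) = chi f z * chi f w.
Proof.
rewrite -big_split; apply: eq_bigr => i _ /=; rewrite ffunE -signr_addb.
by case: (f i).
Qed.

Lemma bitsDD z w : z + w + w = z.
Proof. by apply/ffunP => i; rewrite !ffunE; case: (z i) (w i) => -[]. Qed.

Lemma chi_sqr f z : chi f z * chi f z = 1.
Proof.
rewrite -big_split big1 // => i _ /=; rewrite -signr_addb.
by rewrite addbb.
Qed.

Lemma chi_conj f z : Num.conj (chi f z) = chi f z.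
Proof. by rewrite rmorph_prod; apply: eq_bigr => i _; rewrite rmorphXn rmorphN1. Qed.

Lemma sum_chi f : \sum_z chi f z = (f == 0)%:R * #|bits I|%:R.
Proof.
rewrite -(bigA_distr_bigA (fun i (b : bool) => (-1) ^+ (f i && b))) /=.
have [->|/eqP f0] := eqVneq f 0.
  rewrite mul1r card_ffun card_bool natrX -prodr_const; apply: eq_bigr => i _.
  by rewrite big_bool !ffunE /= expr0.
rewrite mul0r; have [i fi] : exists i, f i.
  apply/existsP; apply: contra_notT f0 => /existsPn h.
  by apply/ffunP => i; rewrite ffunE; apply/negbTE/h.
by rewrite (bigD1 i) //= big_bool fi /= expr1 expr0 addNr mul0r.
Qed.

(* The weight of [X] on the Bell vector with bit error [e] and phase error [f],
   |V|^(-1/2) sum_z (-1)^(f.z) |z, z + e>. *)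
Definition bell_weight e f (X : op R (bits I * bits I)) : R[i] :=
  #|bits I|%:R^-1 * \sum_(z : bits I) \sum_(w : bits I) chi f z * chi f w * entry X (z, z + e) (w, w + e).

(** A weight is the single entry of a Kraus image on a one-point space. This gives positivity, and
    also the effect of local unitaries, by composing kernels. *)
Lemma bell_weight_kconj e f X :
  bell_weight e f X = #|bits I|%:R^-1 *
    entry (kconj (fun _ : unit => fun x => chi f x.1 * (x.2 == x.1 + e)%:R) X) tt tt.
Proof.
congr (_ * _); rewrite entry_kconj sum_pair; apply: eq_bigr => z _.
rewrite [RHS](sum_delta (i0 := z + e)) /=; last first.
  by move=> y /negPf ->; rewrite big1 // => w _; rewrite mulr0 !mul0r.
rewrite eqxx mulr1 sum_pair; apply: eq_bigr => w _.
rewrite [RHS](sum_delta (i0 := w + e)) /=; last first.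
  by move=> y /negPf ->; rewrite mulr0 conjC0 mulr0.
by rewrite eqxx mulr1 chi_conj mulrAC.
Qed.

Lemma bell_weight_ge0 e f X : psd X -> 0 <= bell_weight e f X.
Proof.
move=> hX; rewrite bell_weight_kconj mulr_ge0 ?invr_ge0 ?ler0n //.
set Y := kconj _ _; have hY : psd Y by exact: kconj_psd.
by have := psd_tr_ge0 hY; rewrite tr_entry (sum_delta (i0 := tt)) // => -[].
Qed.

Lemma bell_weight_sum e f (T : Type) (r : seq T) (P : pred T) (F : T -> op R (bits I * bits I)) :
  bell_weight e f (\sum_(t <- r | P t) F t) = \sum_(t <- r | P t) bell_weight e f (F t).
Proof.
rewrite -mulr_sumr; congr (_ * _).
rewrite [RHS]exchange_big; apply: eq_bigr => z _ /=.
rewrite [RHS]exchange_big; apply: eq_bigr => w _ /=.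
by rewrite entry_sum mulr_sumr.
Qed.

Lemma card_bits_neq0 : #|bits I|%:R != 0 :> R[i].
Proof. by rewrite card_ffun card_bool natrX expf_neq0 // pnatr_eq0. Qed.

Lemma sum_chi_chi z w : \sum_f chi f z * chi f w = (z == w)%:R * #|bits I|%:R.
Proof.
under eq_bigr do rewrite -chiD chiC.
rewrite sum_chi; congr ((nat_of_bool _)%:R * _).
by apply/eqP/eqP => [h|->]; [rewrite -(bitsDD z w) h add0r|rewrite -[X in X + _]add0r bitsDD].
Qed.

(** Orthogonality of characters removes every off-diagonal entry. What remains is the probability
    that the outcomes in the computational basis differ by [e]: this basis sees the bit error
    only. *)
Lemma sum_bell_weight_phase e X :
  \sum_f bell_weight e f X = \sum_(z : bits I) entry X (z, z + e) (z, z + e).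
Proof.
rewrite -mulr_sumr exchange_big /=.
under eq_bigr do rewrite exchange_big /=.
rewrite mulr_sumr; apply: eq_bigr => z _.
rewrite (sum_delta (i0 := z)) => [|w wz]; rewrite -mulr_suml sum_chi_chi.
  by rewrite eqxx mul1r mulrA mulVf ?mul1r ?card_bits_neq0.
by rewrite eq_sym (negPf wz) !mul0r.
Qed.

Lemma sum_bell_weight X : \sum_e \sum_f bell_weight e f X = \tr X.
Proof.
under eq_bigr do rewrite sum_bell_weight_phase.
rewrite exchange_big tr_entry sum_pair; apply: eq_bigr => z _ /=.
rewrite [RHS](reindex (fun e : bits I => z + e)) //; apply: onW_bij.
by exists (fun e : bits I => z + e) => e; rewrite addrC (addrC z) bitsDD.
Qed.

Lemma bell_weight_shift e f X :
  bell_weight 0 f (pull (fun z : bits I * bits I => (z.1, z.2 + e)) X) = bell_weight e f X.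
Proof.
congr (_ * _); apply: eq_bigr => z _; apply: eq_bigr => w _.
by rewrite entry_pull /= !addr0.
Qed.

Definition hadamard (x z : bits I) : R[i] := chi x z / sqrtC #|bits I|%:R.

Lemma hadamard_unitary : unitary_kernel hadamard.
Proof.
move=> i j; rewrite /hadamard.
have c0 : sqrtC (#|bits I|%:R : R[i]) != 0 by rewrite sqrtC_eq0 card_bits_neq0.
rewrite (eq_bigr (fun x => chi x i * chi x j * #|bits I|%:R^-1)); last first.
  move=> x _; rewrite rmorphM /= chi_conj fmorphV /= geC0_conj ?sqrtC_ge0 ?ler0n //.
  by rewrite -[in RHS](sqrtCK #|bits I|%:R) expr2 invfM; ring.
by rewrite -mulr_suml sum_chi_chi mulfK ?card_bits_neq0.
Qed.

Definition hadamard2 (X : op R (bits I * bits I)) :=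
  kconj (fun z w : bits I * bits I => hadamard z.1 w.1 * hadamard z.2 w.2) X.

(** Fourier duality: the Hadamards exchange shifts and characters. Hence a decoder for bit errors
    also serves for phase errors. *)
Lemma bell_weight_hadamard e f X :
  bell_weight e f (hadamard2 X) = bell_weight f e X.
Proof.
rewrite !bell_weight_kconj /hadamard2 kconj_comp; congr (_ * _).
rewrite !entry_kconj.
pose k (x : bits I * bits I) := \sum_(y : bits I * bits I) chi f y.1 * (y.2 == y.1 + e)%:R * (hadamard y.1 x.1 * hadamard y.2 x.2).
have kE x : k x = chi e x.2 * (x.2 == x.1 + f)%:R.
  rewrite /k sum_pair.
  rewrite (eq_bigr (fun y => chi y (f + x.1 + x.2) * (chi e x.2 / #|bits I|%:R))); last first.
    move=> y _; rewrite (sum_delta (i0 := y + e)) /=; last first.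
      by move=> z /negPf ->; rewrite mulr0 mul0r.
    rewrite eqxx mulr1 /hadamard chiC !chiD (chiC (y + e)) !chiD (chiC x.2 y) (chiC x.2 e).
    rewrite -[in RHS](sqrtCK #|bits I|%:R) expr2 invfM; ring.
  rewrite -mulr_suml.
  under eq_bigr do rewrite chiC.
  rewrite sum_chi (_ : (f + x.1 + x.2 == 0) = (x.2 == x.1 + f)).
    by move: (_ == _) => b; move: card_bits_neq0 => N0; field.
  apply/eqP/eqP => [h|->]; last by rewrite (addrC x.1) -[X in X + _]add0r bitsDD.
  by rewrite -(bitsDD x.2 (x.1 + f)) (addrC x.2) (addrC x.1) h add0r.
(* On the support [x.2 = x.1 + f] the kernel found and the one wanted differ by the sign [chi e f],
   which enters once from each side of [X] and squares to 1. *)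
have cf x y : chi e x.2 * (x.2 == x.1 + f)%:R * entry X x y * Num.conj (chi e y.2 * (y.2 == y.1 + f)%:R) =
  chi e x.1 * (x.2 == x.1 + f)%:R * entry X x y * Num.conj (chi e y.1 * (y.2 == y.1 + f)%:R).
  have [->|_] := eqVneq x.2; last by rewrite !mulr0 !mul0r.
  have [->|_] := eqVneq y.2; last by rewrite !mulr0 conjC0 !mulr0.
  rewrite !mulr1 !chi_conj !chiD; have := chi_sqr e f.
  set a := chi e x.1; set b := chi e f; set c := chi e y.1 => h.
  by rewrite -[RHS]mulr1 -h; ring.
apply: eq_bigr => x _; apply: eq_bigr => y _.
by rewrite -!/(k _) !kE cf.
Qed.

End Chi.
End Characters.

(** * Linear codes: bit errors corrected by announced parities *)

Section Code.
Variable R : realType.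

Notation bits I := {ffun I -> bool}.

Definition unflatten N k L (g : 'I_N * 'I_k -> 'I_L) (z : qubits L) : pow (qubits k) N :=
  [ffun i => [ffun j => z (g (i, j))]].

Section Unflatten.
Variables (N k L : nat) (g : 'I_N * 'I_k -> 'I_L).
Hypothesis g_bij : bijective g.

Lemma unflatten_bij : bijective (unflatten g).
Proof.
have [g' gK g'K] := g_bij.
exists (fun u : pow (qubits k) N => [ffun l => u (g' l).1 (g' l).2]) => u.
  by apply/ffunP => l; rewrite !ffunE -surjective_pairing g'K.
by apply/ffunP => i; apply/ffunP => j; rewrite !ffunE gK.
Qed.

Lemma unflattenD z w i : unflatten g (z + w) i = unflatten g z i + unflatten g w i.
Proof. by apply/ffunP => j; rewrite !ffunE. Qed.

Lemma chi_unflatten f z :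
  chi R f z = \prod_i chi R (unflatten g f i) (unflatten g z i).
Proof.
rewrite /chi (reindex g); last exact: onW_bij.
rewrite (eq_bigr (fun p => (-1) ^+ (f (g (p.1, p.2)) && z (g (p.1, p.2))))); last by case.
rewrite -(pair_bigA _ (fun i j => (-1) ^+ (f (g (i, j)) && z (g (i, j))))) /=.
by apply: eq_bigr => i _; apply: eq_bigr => j _; rewrite !ffunE.
Qed.

(** Characters, entries and normalizations all factor over the blocks, so the error patterns of the
    blocks are distributed like independent trials, whatever coherences [om] has between Bell
    vectors. *)
Lemma bell_weight_pow (om : op R (qubits k * qubits k)) e f :
  bell_weight e f (pull (fun z => (unflatten g z.1, unflatten g z.2)) (tensor_pow N om)) =
  \prod_i bell_weight (unflatten g e i) (unflatten g f i) om.
Proof.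
have cE : #|qubits L| = (#|qubits k| ^ N)%N.
  by rewrite (bij_eq_card unflatten_bij) card_ffun card_ord.
rewrite /bell_weight big_split /= prodr_const card_ord exprVn -natrX cE; congr (_ * _).
rewrite bigA_distr_bigA /= (reindex (unflatten g)); last exact/onW_bij/unflatten_bij.
apply: eq_bigr => z _.
rewrite bigA_distr_bigA /= (reindex (unflatten g)); last exact/onW_bij/unflatten_bij.
apply: eq_bigr => w _.
rewrite entry_pull entry_mkop /= !chi_unflatten -!big_split; apply: eq_bigr => i _ /=.
by rewrite !unflattenD.
Qed.

End Unflatten.

Section Step.
Variable L : nat.

Definition dot (h z : qubits L) : bool := \sum_i h i * z i.

Definition consb (a : bool) (z : qubits L) : qubits L.+1 :=
  [ffun i => if unlift ord0 i is Some j then z j else a].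

Definition tailb (f : qubits L.+1) : qubits L := [ffun j => f (lift ord0 j)].

Lemma consb0 a z : consb a z ord0 = a.
Proof. by rewrite ffunE unlift_none. Qed.

Lemma consbS a z j : consb a z (lift ord0 j) = z j.
Proof. by rewrite ffunE liftK. Qed.

Lemma tail_consb a z : tailb (consb a z) = z.
Proof. by apply/ffunP => j; rewrite ffunE consbS. Qed.

Lemma consb_tail (z : qubits L.+1) : consb (z ord0) (tailb z) = z.
Proof.
apply/ffunP => i; case: (unliftP ord0 i) => [j|] ->.
  by rewrite consbS ffunE.
by rewrite consb0.
Qed.

Lemma consbD a b z w : consb a z + consb b w = consb (a + b) (z + w).
Proof.
apply/ffunP => i; rewrite ffunE; case: (unliftP ord0 i) => [j|] ->.
  by rewrite !consbS ffunE.
by rewrite !consb0.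
Qed.

Lemma dotD h z w : dot h (z + w) = dot h z + dot h w.
Proof. by rewrite -big_split; apply: eq_bigr => i _ /=; rewrite ffunE mulrDr. Qed.

Lemma chi_dot h z : chi R h z = (-1) ^+ dot h z.
Proof.
apply: (big_ind2 (fun (x : R[i]) (b : bool) => x = (-1) ^+ b)) => //.
by move=> x1 b1 x2 b2 -> ->; rewrite -signr_addb.
Qed.

(* A linear change of basis in which the first bit of [z] becomes the parity
   [z ord0 + h . tail z]. *)
Definition shear (h : qubits L) (a : bool) (z : qubits L) : qubits L.+1 :=
  consb (a + dot h z) z.

(* The transpose of [shear h], without its first bit. *)
Definition coshear (h : qubits L) (f : qubits L.+1) : qubits L :=
  tailb f + [ffun j => f ord0 * h j].

Lemma shear_bij h : bijective (fun z : bool * qubits L => shear h z.1 z.2).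
Proof.
exists (fun w : qubits L.+1 => (w ord0 + dot h (tailb w), tailb w)) => [[a z]|w] /=.
  rewrite /shear tail_consb consb0; congr pair.
  by case: a (dot h z) => -[].
rewrite /shear -[RHS]consb_tail; congr consb.
by case: (w ord0) (dot h (tailb w)) => -[].
Qed.

Lemma shearD h a b z w : shear h a z + shear h b w = shear h (a + b) (z + w).
Proof. by rewrite /shear consbD dotD addrACA. Qed.

Lemma chi_shear h f a z :
  chi R f (shear h a z) = (-1) ^+ (f ord0 && a) * chi R (coshear h f) z.
Proof.
rewrite /chi big_ord_recl consb0.
have -> : (-1) ^+ (f ord0 && (a + dot h z)) =
    (-1) ^+ (f ord0 && a) * (-1) ^+ (f ord0 && dot h z) :> R[i].
  by rewrite -signr_addb; case: (f ord0).
rewrite -mulrA; congr (_ * _).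
have -> : (-1) ^+ (f ord0 && dot h z) = \prod_i (-1) ^+ (f ord0 && (h i && z i)) :> R[i].
  case: (f ord0) => /=; first by rewrite -chi_dot.
  by rewrite big1.
rewrite -big_split; apply: eq_bigr => i _ /=.
by rewrite consbS !ffunE -signr_addb; case: (f ord0) (f (lift ord0 i)) (h i) (z i) => -[] [] [].
Qed.

(** A fibre of [coshear h] has two points: the phase bit that the parity measurement destroys is
    free, and it shifts the remaining bits by a multiple of [h]. *)
Lemma sum_coshear h (V : nmodType) f' (F : qubits L.+1 -> V) :
  \sum_(f | coshear h f == f') F f =
  \sum_(b : bool) F (consb b (f' + [ffun j => b * h j])).
Proof.
rewrite (reindex (fun z : bool * qubits L => consb z.1 z.2)) /=; last first.
  apply: onW_bij; exists (fun w : qubits L.+1 => (w ord0, tailb w)) => [[a z]|w] /=.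
    by rewrite consb0 tail_consb.
  by rewrite consb_tail.
rewrite big_mkcond sum_pair; apply: eq_bigr => b _ /=.
rewrite -big_mkcond /= (big_pred1 (f' + [ffun j => b * h j])) // => z.
rewrite /coshear tail_consb consb0; apply/eqP/eqP => [<-|->]; by rewrite bitsDD.
Qed.

Lemma coshear_consb h b f' : coshear h (consb b (f' + [ffun j => b * h j])) = f'.
Proof. by rewrite /coshear tail_consb consb0 bitsDD. Qed.

(** Both parties measure the parity given by [h], with outcomes [a] and [a + c], where [c] is that
    parity of the bit error. Summing over the destroyed phase bit equates the outcome in the row
    index with that in the column index, which is the effect of the measurement. *)
Lemma bell_weight_shear h c e f' (X : op R (qubits L.+1 * qubits L.+1)) :
  \sum_(f | coshear h f == f') bell_weight (shear h c e) f X =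
  \sum_(a : bool) bell_weight e f'
    (pull (fun z => (shear h a z.1, shear h (a + c) z.2)) X).
Proof.
rewrite sum_coshear -mulr_sumr -[RHS]mulr_sumr.
pose T a z a' z' := entry X (shear h a z, shear h (a + c) (z + e))
                            (shear h a' z', shear h (a' + c) (z' + e)).
have E : #|qubits L.+1|%:R = 2 * #|qubits L|%:R :> R[i].
  by rewrite !card_ffun card_bool !card_ord expnS natrM.
rewrite E invfM [2^-1 * _]mulrC -mulrA; congr (_ * _).
(* The sum over [b] is 2 if [a = a'] and 0 otherwise; it absorbs the factor 1/2 from the change of
   dimension. *)
transitivity (2^-1 * \sum_(a : bool) \sum_z \sum_(a' : bool) \sum_w
    (\sum_(b : bool) (-1) ^+ (b && a) * (-1) ^+ (b && a')) *
    (chi R f' z * chi R f' w * T a z a' w)).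
  congr (_ * _).
  transitivity (\sum_(b : bool) \sum_(a : bool) \sum_z \sum_(a' : bool) \sum_w
    (-1) ^+ (b && a) * (-1) ^+ (b && a') * (chi R f' z * chi R f' w * T a z a' w)).
    apply: eq_bigr => b _.
    rewrite (reindex (fun z : bool * qubits L => shear h z.1 z.2)) /=; last exact/onW_bij/shear_bij.
    rewrite sum_pair; apply: eq_bigr => a _; apply: eq_bigr => z _ /=.
    rewrite (reindex (fun z : bool * qubits L => shear h z.1 z.2)) /=; last exact/onW_bij/shear_bij.
    rewrite sum_pair; apply: eq_bigr => a' _; apply: eq_bigr => z' _ /=.
    by rewrite !chi_shear coshear_consb consb0 !shearD /T; ring.
  rewrite exchange_big; apply: eq_bigr => a _ /=.
  rewrite exchange_big; apply: eq_bigr => z _ /=.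
  rewrite exchange_big; apply: eq_bigr => a' _ /=.
  rewrite exchange_big; apply: eq_bigr => w _ /=.
  by rewrite mulr_suml.
rewrite mulr_sumr; apply: eq_bigr => a _; rewrite mulr_sumr; apply: eq_bigr => z _.
rewrite (bigD1 a) //= [X in _ + X]big1 ?addr0 => [|a' a'a]; last first.
  apply: big1 => w _; rewrite big_bool /= !expr0.
  by case: a a' a'a => -[] //= _; rewrite ?expr0 ?expr1 ?mul1r ?mulr1 ?addNr mul0r.
rewrite mulr_sumr; apply: eq_bigr => w _.
rewrite big_bool /= -expr2 sqrr_sign !expr0 mulr1 mulrA mulVf ?mul1r ?pnatr_eq0 //.
by rewrite entry_pull.
Qed.

(** A random parity misses [d] with probability at most 1/2. If the tail of [d] is nonzero the
    character sum over [h] vanishes and the odds are even; otherwise [d] is its first bit alone,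
    which every parity sees. *)
Lemma card_parity0 (d : qubits L.+1) : d != 0 ->
  (2 * #|[set h | (d ord0 + dot h (tailb d))%R == false]| <= #|qubits L|)%N.
Proof.
move=> d0; rewrite -(ler_nat R[i]) natrM -[#|[set _ | _]|]sum1_card natr_sum big_mkcond mulr_sumr /=.
rewrite (eq_bigr (fun h => 1 + (-1) ^+ d ord0 * chi R (tailb d) h)); last first.
  move=> h _; rewrite inE chiC chi_dot -signr_addb -[d ord0 (+) _]/(d ord0 + dot h (tailb d)).
  by case: (d ord0 + _); rewrite /= ?expr1 ?expr0 ?mulr0 ?mulr1 ?subrr.
rewrite big_split /= sumr_const -mulr_sumr sum_chi gerDl.
have [t0|] := eqVneq (tailb d) 0; last by rewrite mul0r mulr0.
case: (d ord0) (consb_tail d) => dE; first by rewrite mul1r expr1 mulN1r oppr_le0 ler0n.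
by case/eqP: d0; rewrite -dE t0; apply/ffunP => i; rewrite !ffunE; case: unlift => [j|//]; rewrite ffunE.
Qed.

(** The random parity is derandomized by double counting pairs of a parity [h] and a difference [d]:
    for some [h] at most half of [D] has parity 0. *)
Lemma halving_shear (D : {set qubits L.+1}) : 0 \notin D ->
  exists h, (2 * #|[set d | shear h false d \in D]| <= #|D|)%N.
Proof.
move=> D0; apply: contrapT => /forallNP /= hD.
pose bad h := [set d in D | d ord0 + dot h (tailb d) == false].
have le h : (#|[set d | shear h false d \in D]| <= #|bad h|)%N.
  rewrite -(card_imset _ (f := shear h false)); last first.
    by move=> u v; case: (shear_bij h) => g gK _ /(congr1 g); rewrite !(gK (false, _)) => -[].
  apply/subset_leq_card/fintype.subsetP => _ /imsetP[u + ->]; rewrite !inE => -> /=.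
  by rewrite /shear consb0 tail_consb add0r; case: (dot h u).
have : (\sum_(h : qubits L) #|D| < \sum_h 2 * #|bad h|)%N.
  rewrite [X in (X < _)%N](bigD1 (0 : qubits L)) //= [X in (_ < X)%N](bigD1 (0 : qubits L)) //=.
  have lt h : (#|D| < 2 * #|bad h|)%N.
    by rewrite (leq_trans _ (leq_mul (leqnn 2) (le h))) // ltnNge; apply/negP/hD.
  by rewrite -addSn leq_add // leq_sum // => h _; exact: ltnW.
rewrite ltnNge => /negP; apply.
rewrite -big_distrr /=.
have -> : (\sum_h #|bad h| = \sum_(d in D) #|[set h | (d ord0 + dot h (tailb d))%R == false]|)%N.
  under eq_bigr do rewrite -sum1_card big_mkcond /=.
  rewrite exchange_big [RHS]big_mkcond; apply: eq_bigr => d _ /=.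
  case: ifP => dD; last by rewrite big1 // => h _; rewrite inE dD.
  by rewrite -sum1_card [RHS]big_mkcond; apply: eq_bigr => h _; rewrite !inE dD.
rewrite big_distrr /= [X in (_ <= X)%N]sum_nat_const mulnC -sum_nat_const.
apply: leq_sum => d dD; apply: card_parity0.
by apply: contraNneq D0 => <-.
Qed.

End Step.

(** [D] holds the differences of the error patterns to be told apart. A well chosen parity halves
    it, so after [s] parities it is empty and the announced bits determine the pattern. [pi] records
    what becomes of the phase errors. It precedes [S] because the two values of a parity leave
    different pattern sets, with differences in one common smaller [D], and both must use the same
    [pi]. *)
Lemma decode_bits s L (D : {set qubits (s + L)}) :
  0 \notin D -> (#|D| < 2 ^ s)%N ->
  exists2 pi : qubits (s + L) -> qubits L, pi 0 = 0 &
  forall S : {set qubits (s + L)},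
    (forall u v, u \in S -> v \in S -> u != v -> u + v \in D) ->
  exists2 Lam : op R (qubits (s + L) * qubits (s + L)) -> op R (qubits L * qubits L),
    locc_channel Lam &
    forall X f', psd X ->
      \sum_(e in S) \sum_(f | pi f == f') bell_weight e f X <= bell_weight 0 f' (Lam X).
Proof.
elim: s D => [|s IH] D D0 cD.
  exists (fun f : qubits L => f) => //; rewrite -[qubits (0 + L)]/(qubits L) => S hS.
  (* Now [D] is empty, so [S] has at most one pattern, and a local shift undoes it. *)
  have [S0|[e eS]] := set_0Vmem S.
    exists id; first exact: channel_id.
    by move=> X f' hX; rewrite S0 big_set0; exact: bell_weight_ge0.
  have SE : S = [set e].
    apply/eqP; rewrite finset.eqEsubset finset.sub1set eS andbT; apply/fintype.subsetP => u uS.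
    rewrite inE; apply: contraTT cD => ue.
    by rewrite -leqNgt expn0 card_gt0; apply/set0Pn; exists (u + e); exact: hS.
  exists (pull (fun z : qubits L * qubits L => (z.1, z.2 + e))).
    apply: (@channel_relabel _ _ _ _ _ id (fun z : qubits L => z + e)); first by exists id.
    by exists (fun z : qubits L => z + e) => z; rewrite bitsDD.
  move=> X f' _; rewrite SE big_set1 (big_pred1 f') // bell_weight_shift //.
have [h hh] := halving_shear D0.
have [||pi pi0 hpi] := IH [set d | shear h false d \in D].
- rewrite inE (_ : shear h false 0 = 0) //.
  by apply: (addrI (shear h false 0)); rewrite shearD !addr0.
- by rewrite -(ltn_pmul2l (isT : 0 < 2)%N) -expnS; exact: leq_ltn_trans cD.
exists (pi \o coshear h) => [|S hS].
  rewrite /= (_ : coshear h 0 = 0) //; apply/ffunP => i.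
  by rewrite !ffunE mul0r.
(* The patterns still possible when the announced parities differ by [c]. *)
pose Sc c : {set qubits (s + L)} := [set e | shear h c e \in S].
have hSc c u v : u \in Sc c -> v \in Sc c -> u != v -> u + v \in [set d | shear h false d \in D].
  rewrite !inE => uS vS uv.
  rewrite (_ : false = c + c) -?shearD; last by case: c {uS vS}.
  apply: hS => //; apply: contra_neq uv => /(congr1 (@tailb _)).
  by rewrite !tail_consb.
pose Lc c := s2val (cid2 (hpi (Sc c) (hSc c))).
have Lc_chan c : locc_channel (Lc c) := s2valP (cid2 (hpi (Sc c) (hSc c))).
have LcE c := s2valP' (cid2 (hpi (Sc c) (hSc c))).
exists (fun X => \sum_a \sum_b Lc (a + b) (pull (fun z => (shear h a z.1, shear h b z.2)) X)).
  apply: (@locc_measure _ _ _ _ _ _ _ _ bool bool (shear h) (shear h)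
    (fun a b => fun=> Lc (a + b))) => //; [exact: shear_bij|exact: shear_bij|].
  by move=> a b; exact: Lc_chan.
move=> X f' hX; rewrite bell_weight_sum.
under [leRHS]eq_bigr do rewrite bell_weight_sum.
apply: (@le_trans _ _ (\sum_(a : bool) \sum_(c : bool) \sum_(e in Sc c) \sum_(f | pi f == f')
   bell_weight e f (pull (fun z => (shear h a z.1, shear h (a + c) z.2)) X))); last first.
  apply: ler_sum => a _; rewrite [leRHS](reindex (fun c => a + c)); last first.
    by apply: onW_bij; exists (fun c => a + c); case: a => -[].
  apply: ler_sum => c _; rewrite addrA (_ : a + a + c = c); last by case: a c => -[].
  by apply: LcE; exact: pull_psd.
rewrite [leRHS]exchange_big /= [leLHS](reindex (fun z : bool * qubits (s + L) => shear h z.1 z.2)) /=; last first.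
  exact/onW_bij/shear_bij.
rewrite [leLHS]big_mkcond sum_pair; apply: ler_sum => c _ /=.
rewrite [leRHS]exchange_big /= [leRHS]big_mkcond; apply: ler_sum => e _ /=.
rewrite inE; case: ifP => // _.
rewrite [leRHS]exchange_big /= [leLHS](partition_big (coshear h) (fun f => pi f == f')) //=.
apply: ler_sum => f /eqP pif; rewrite -bell_weight_shear le_eqVlt; apply/orP; left.
apply/eqP/eq_bigl => g; have [->|_] := eqVneq (coshear h g) f; last by rewrite andbF.
by rewrite pif eqxx.
Qed.

End Code.

(** * An exponential tail bound for independent trials *)

Section Tail.
Variable K : numFieldType.

Lemma sum_pow_pair (V : nmodType) (A B : finType) N (F : pow A N -> pow B N -> V) :
  \sum_a \sum_b F a b =
  \sum_(u : pow (A * B)%type N) F [ffun i => (u i).1] [ffun i => (u i).2].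
Proof.
rewrite -(sum_pair (fun z => F z.1 z.2)).
rewrite (reindex (fun u : pow (A * B)%type N => ([ffun i => (u i).1], [ffun i => (u i).2]))) //.
apply: onW_bij; exists (fun z : pow A N * pow B N => [ffun i => (z.1 i, z.2 i)] : pow (A * B)%type N) => [u|[a b]] /=.
  by apply/ffunP => i; rewrite !ffunE -surjective_pairing.
by congr pair; apply/ffunP => i; rewrite !ffunE.
Qed.

Definition hits (T : finType) (b : pred T) N (u : pow T N) : nat := #|[set i | b (u i)]|.

(* Markov's inequality for [x ^+ hits], which is multiplicative. *)
Lemma exp_markov (T : finType) (p : T -> K) (b : pred T) N (P : pred (pow T N)) (x : K) t :
  (forall a, 0 <= p a) -> 0 <= x ->
  (forall u, P u -> x ^+ t <= x ^+ hits b u) ->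
  x ^+ t * (\sum_(u | P u) \prod_i p (u i)) <= (\sum_a p a * x ^+ b a) ^+ N.
Proof.
move=> p0 x0 hP; rewrite -[N in leRHS]card_ord -prodr_const bigA_distr_bigA /=.
rewrite mulr_sumr [leRHS](bigID P) /= ler_wpDr ?sumr_ge0 //.
  by move=> u _; apply: prodr_ge0 => i _; rewrite mulr_ge0 ?exprn_ge0.
apply: ler_sum => u Pu; rewrite big_split /= mulrC ler_wpM2l ?prodr_ge0 //.
rewrite (_ : \prod_i x ^+ b (u i) = x ^+ hits b u) ?hP // /hits -sum1_card.
by rewrite [in RHS]big_mkcond expr_sum; apply: eq_bigr => i _; rewrite inE; case: (b _).
Qed.

End Tail.

(** * Correction of bit and phase errors together; fidelity *)

Section Css.
Variable R : realType.

Lemma channel_psd (A B A' B' : finType) (Lam : op R (A * B) -> op R (A' * B')) X :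
  locc_channel Lam -> psd X -> psd (Lam X).
Proof. by move=> hL hX; exact: (@locc_psd _ _ _ _ _ _ _ hL tt). Qed.

Lemma channel_tr (A B A' B' : finType) (Lam : op R (A * B) -> op R (A' * B')) X :
  locc_channel Lam -> \tr (Lam X) = \tr X.
Proof. by move=> hL; rewrite -(locc_tr hL) big_const card_unit /= addr0. Qed.

Lemma channel_hadamard k :
  locc_channel (fun X : op R (qubits k * qubits k) => hadamard2 X).
Proof.
have hu := @hadamard_unitary R 'I_k.
by apply: (locc_unitary hu hu (channel_id R (qubits k) (qubits k))).
Qed.

(** [S] has at most [#|S| ^ 2] differences, so [s] parities suffice in each basis. The first round
    sets the bit error to 0 and maps the phase error by [pi] into a set no larger than [S]; after
    the Hadamards the second round treats it as a bit error. [pi2 0 = 0] keeps the cleared error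
    clear. *)
Lemma decode_css s L (S : {set qubits (s + (s + L))}) : (#|S| ^ 2 < 2 ^ s)%N ->
  exists2 Lam : op R (qubits (s + (s + L)) * qubits (s + (s + L))) -> op R (qubits L * qubits L),
    locc_channel Lam &
    forall X, psd X -> \sum_(e in S) \sum_(f in S) bell_weight e f X <= bell_weight 0 0 (Lam X).
Proof.
move=> cS.
pose diffs n (W : {set qubits n}) := 
  (fun u : qubits n * qubits n => u.1 + u.2) @:
    [set u : qubits n * qubits n | [&& u.1 \in W, u.2 \in W & u.1 != u.2]].
have diffs0 n (W : {set qubits n}) : 0 \notin diffs n W.
  apply/imsetP => -[u]; rewrite inE => /and3P[_ _ /eqP u12] e; apply: u12.
  by rewrite -(bitsDD u.1 u.2) -e add0r.
have cdiffs n (W : {set qubits n}) : (#|diffs n W| <= #|W| ^ 2)%N.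
  apply: leq_trans (leq_imset_card _ _) _; rewrite expnS expn1 -cardsX.
  by apply/subset_leq_card/fintype.subsetP => -[u v]; rewrite !inE => /and3P[-> ->].
have diffsP n (W : {set qubits n}) u v : u \in W -> v \in W -> u != v -> u + v \in diffs n W.
  by move=> uW vW uv; apply/imsetP; exists (u, v); rewrite // inE uW vW.
have [pi pi0 /(_ S (@diffsP _ S))[L1 hL1 L1E]] :=
  decode_bits R (diffs0 _ S) (leq_ltn_trans (cdiffs _ S) cS).
pose S2 := [set pi f | f in S].
have cS2 : (#|S2| ^ 2 < 2 ^ s)%N.
  by apply: leq_ltn_trans cS; rewrite leq_exp2r ?leq_imset_card.
have [pi2 pi20 /(_ S2 (@diffsP _ S2))[L2 hL2 L2E]] :=
  decode_bits R (diffs0 _ S2) (leq_ltn_trans (cdiffs _ S2) cS2).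
exists (L2 \o (@hadamard2 R _) \o L1).
  by apply: channel_comp hL1 _; apply: channel_comp (channel_hadamard _) hL2.
move=> X hX /=; have hY : psd (L1 X) := channel_psd hL1 hX.
have hZ : psd (hadamard2 (L1 X)) by exact: kconj_psd.
apply: le_trans (L2E _ 0 hZ).
apply: (@le_trans _ _ (\sum_(e in S2) bell_weight 0 e (L1 X))); last first.
  apply: ler_sum => e _; rewrite (bigD1 (0 : qubits (s + L))) ?pi20 ?eqxx //=.
  rewrite bell_weight_hadamard ler_wpDr // sumr_ge0 // => f _; exact: bell_weight_ge0.
apply: (@le_trans _ _ (\sum_(e in S2) \sum_(e' in S) \sum_(f | pi f == e) bell_weight e' f X)); last first.
  by apply: ler_sum => e _; exact: L1E.
rewrite [leRHS]exchange_big /=; apply: ler_sum => e _.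
rewrite (partition_big pi (mem S2)) /=; last by move=> f fS; apply/imsetP; exists f.
apply: ler_sum => g _; rewrite [leRHS](bigID (mem S)) /=.
rewrite (eq_bigl (fun f => (pi f == g) && (f \in S))); last by move=> f; rewrite andbC.
by rewrite ler_wpDr // sumr_ge0 // => f _; exact: bell_weight_ge0.
Qed.

Lemma leC_Re (x y : R[i]) : x <= y -> complex.Re x <= complex.Re y.
Proof. by rewrite lecE => /andP[]. Qed.

(** The overlap of [X] with the vector of [k] Bell pairs. [X] may be subnormalized, and then this is
    the joint weight of an outcome and a correct output. *)
Definition fidelity k (X : op R (qubits k * qubits k)) : R :=
  complex.Re (bell_weight 0 0 X).

Lemma fidelityE k (X : op R (qubits k * qubits k)) : psd X ->
  bell_weight 0 0 X = (fidelity X)%:C.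
Proof. by move=> /(bell_weight_ge0 0 0) /ger0_Im h; rewrite [LHS]complexE /fidelity h mulr0 addr0. Qed.

End Css.

(** * Positive matrices and the trace norm *)

Section Dagger.
Local Open Scope sesquilinear_scope.
Variable R : realType.
Implicit Types m n p : nat.

Lemma dagM m n p (A : 'M[R[i]]_(m, n)) (B : 'M[R[i]]_(n, p)) :
  (A *m B)^t* = B^t* *m A^t*.
Proof. by rewrite trmx_mul map_mxM. Qed.

Lemma dagD m n (A B : 'M[R[i]]_(m, n)) : (A + B)^t* = A^t* + B^t*.
Proof. by rewrite linearD map_mxD. Qed.

Lemma dagB m n (A B : 'M[R[i]]_(m, n)) : (A - B)^t* = A^t* - B^t*.
Proof. by rewrite linearB map_mxB. Qed.

Lemma dagZ m n a (A : 'M[R[i]]_(m, n)) : (a *: A)^t* = Num.conj a *: A^t*.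
Proof. by rewrite linearZ map_mxZ. Qed.

Lemma dag1 n : (1%:M : 'M[R[i]]_n)^t* = 1%:M.
Proof. by rewrite trmx1 map_mx1. Qed.

Lemma tr_dag n (A : 'M[R[i]]_n) : \tr (A^t*) = Num.conj (\tr A).
Proof. by rewrite /mxtrace rmorph_sum; apply: eq_bigr => i _; rewrite !mxE. Qed.

Lemma rtrace_dag n (A : 'M[R[i]]_n) : rtrace (A^t*) = rtrace A.
Proof. by rewrite /rtrace tr_dag; case: (\tr A). Qed.

Lemma rtraceD n (A B : 'M[R[i]]_n) : rtrace (A + B) = rtrace A + rtrace B.
Proof. by rewrite /rtrace linearD raddfD. Qed.

Lemma rtraceB n (A B : 'M[R[i]]_n) : rtrace (A - B) = rtrace A - rtrace B.
Proof. by rewrite /rtrace linearB raddfB. Qed.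

Lemma ReZ (a : R) (z : R[i]) : complex.Re (a%:C * z) = a * complex.Re z.
Proof. by case: z => x y /=; rewrite mul0r subr0. Qed.

Lemma rtraceZ n a (A : 'M[R[i]]_n) : rtrace (a%:C *: A) = a * rtrace A.
Proof. by rewrite /rtrace linearZ /= ReZ. Qed.

Lemma conjCr (a : R) : Num.conj (a%:C : R[i]) = a%:C.
Proof. by rewrite /Num.conj /= oppr0. Qed.

Lemma psd_gram m n (G : 'M[R[i]]_(m, n)) : psd (G^t* *m G).
Proof.
move=> v; rewrite !mulmxA -dagM -mulmxA mxE sumr_ge0 // => i _.
by rewrite !mxE mulrC mul_conjC_ge0.
Qed.

Lemma psd_conj m n (Y : 'M[R[i]]_n) (A : 'M[R[i]]_(m, n)) :
  psd Y -> psd (A *m Y *m A^t*).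
Proof.
move=> hY v; have := hY (A^t* *m v).
by rewrite dagM trmxCK !mulmxA.
Qed.

Lemma psd_rtrace_ge0 n (Y : 'M[R[i]]_n) : psd Y -> 0 <= rtrace Y.
Proof.
move=> hY; suff /leC_Re : 0 <= \tr Y by [].
apply: sumr_ge0 => i _; have := hY (delta_mx i 0).
rewrite (_ : ((delta_mx i 0)^t* *m Y *m delta_mx i 0) 0 0 = Y i i) //.
by rewrite trmx_delta map_delta_mx -rowE -colE !mxE.
Qed.

(** Being nonnegative in [R[i]] includes being real, so the quadratic form of [Y^t* - Y] vanishes on
    every vector; polarization with [v] and ['i *: v] makes the matrix vanish. *)
Lemma psd_herm n (Y : 'M[R[i]]_n) : psd Y -> Y^t* = Y.
Proof.
move=> hY; apply/eqP; rewrite -subr_eq0; apply/eqP; set H := _ - Y.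
pose f (u v : 'cV[R[i]]_n) := (u^t* *m H *m v) 0 0.
have f0 v : f v v = 0.
  rewrite /f mulmxBr mulmxBl mxE [X in _ + X]mxE.
  have -> : v^t* *m Y^t* *m v = (v^t* *m Y *m v)^t*.
    by rewrite !dagM trmxCK mulmxA.
  have /geC0_conj h := hY v; by rewrite mxE mxE h subrr.
have fD u v : f (u + v) (u + v) = f u v + f v u.
  have fl x y w : f (x + y) w = f x w + f y w by rewrite /f dagD !mulmxDl mxE.
  have fr x y w : f w (x + y) = f w x + f w y by rewrite /f mulmxDr mxE.
  by rewrite fl !fr !f0 addr0 add0r.
have fZ u v : f u ('i *: v) = 'i * f u v /\ f ('i *: v) u = - 'i * f v u.
  by rewrite /f dagZ -!scalemxAl -scalemxAr conjCi; split; rewrite mxE.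
have e u v : f u v = 0.
  have h1 := fD u v; have h2 := fD u ('i *: v).
  move: h1 h2; rewrite !f0 (fZ u v).1 (fZ u v).2 => h1 h2.
  have : 'i * (f u v + f u v) = 0.
    by rewrite -[RHS]addr0 {1}h2 -[0](mulr0 'i) h1; ring.
  by move/eqP; rewrite mulf_eq0 (negPf (neq0Ci _)) -mulr2n mulrn_eq0 /= => /eqP.
apply/matrixP => i j; rewrite [RHS]mxE -(e (delta_mx i 0) (delta_mx j 0)) /f.
by rewrite trmx_delta map_delta_mx -rowE -colE [RHS]mxE [RHS]mxE.
Qed.

Lemma psd_spectral n (Y : 'M[R[i]]_n) (P := spectralmx Y) (d := spectral_diag Y) :
  psd Y -> [/\ P *m P^t* = 1%:M, P^t* *m P = 1%:M, Y = P^t* *m diag_mx d *m P &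
    forall i, 0 <= d 0 i].
Proof.
rewrite {}/P {}/d.
move=> hY; have hN : Y \is normalmx by apply/normalmxP; rewrite psd_herm.
have uP := spectral_unitarymx Y.
have /orthomx_spectralP := hN; rewrite invmx_unitary // => YE.
have PP : spectralmx Y *m (spectralmx Y)^t* = 1%:M by exact/unitarymxP.
have PP' : (spectralmx Y)^t* *m spectralmx Y = 1%:M.
  by rewrite -invmx_unitary // mulVmx // unitarymx_unit.
split=> // i.
move: YE PP {PP'}; set Q := spectralmx Y; set d := spectral_diag Y => YE PP.
have := hY (Q^t* *m delta_mx i 0).
rewrite YE dagM trmxCK !mulmxA -(mulmxA _ Q (Q^t*)) PP mulmx1.
rewrite -(mulmxA _ Q (Q^t*)) PP mulmx1 trmx_delta map_delta_mx -rowE -colE.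
by rewrite !mxE eqxx mulr1n.
Qed.

Lemma diag_sqrt n (d : 'rV[R[i]]_n) (S := diag_mx (map_mx sqrtC d)) :
  (forall i, 0 <= d 0 i) -> S^t* *m S = diag_mx d.
Proof.
move=> d0; rewrite /S tr_diag_mx map_diag_mx mulmx_diag; congr diag_mx; apply/rowP => i.
by rewrite !mxE /= geC0_conj ?sqrtC_ge0 // -expr2 sqrtCK.
Qed.

Lemma psd_factor n (Y : 'M[R[i]]_n) : psd Y -> exists G : 'M[R[i]]_n, Y = G^t* *m G.
Proof.
move=> /psd_spectral; set P := spectralmx Y; set d := spectral_diag Y; move=> [_ _ -> d0].
set S := diag_mx (map_mx sqrtC d).
by exists (S *m P); rewrite dagM mulmxA -(mulmxA (P^t*) (S^t*) S) diag_sqrt.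
Qed.

Lemma rtraceC m n (A : 'M[R[i]]_(m, n)) (B : 'M[R[i]]_(n, m)) :
  rtrace (A *m B) = rtrace (B *m A).
Proof. by rewrite /rtrace mxtrace_mulC. Qed.

Lemma psd_trace_contract n (Z E : 'M[R[i]]_n) :
  psd Z -> psd (1%:M - E) -> rtrace (Z *m E) <= rtrace Z.
Proof.
move=> /psd_factor[G ->] hE; rewrite -subr_ge0 -rtraceB -{1}[_ *m G]mulmx1 -mulmxBr.
rewrite -mulmxA rtraceC; exact/psd_rtrace_ge0/psd_conj.
Qed.

(** In an eigenbasis, each eigenvalue is at most the sum of all. *)
Lemma psd_le_trace n (Z : 'M[R[i]]_n) (w : 'cV[R[i]]_n) : psd Z ->
  rtrace (w^t* *m Z *m w) <= rtrace Z * rtrace (w^t* *m w).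
Proof.
move=> /psd_spectral; move: (spectralmx Z) (spectral_diag Z) => P d [PP PP' -> d0].
have dR i : d 0 i = (complex.Re (d 0 i))%:C.
  by rewrite {1}[d 0 i]complexE (ger0_Im (d0 i)) mulr0 addr0.
have dR0 i : 0 <= complex.Re (d 0 i) by have /leC_Re := d0 i.
have -> : rtrace (P^t* *m diag_mx d *m P) = \sum_i complex.Re (d 0 i).
  rewrite rtraceC mulmxA PP mul1mx /rtrace mxtrace_diag raddf_sum.
  by apply: eq_bigr => i _.
have [c cE] : {c | c = P *m w} by exists (P *m w).
have -> : w^t* *m (P^t* *m diag_mx d *m P) *m w = c^t* *m (diag_mx d *m c).
  by rewrite cE dagM !mulmxA.
have -> : w^t* *m w = c^t* *m c.
  by rewrite cE dagM mulmxA -(mulmxA (w^t*)) PP' mulmx1.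
pose a i := complex.Re (Num.conj (c i 0) * c i 0).
have a0 i : 0 <= a i.
  by have /leC_Re := mul_conjC_ge0 (c i 0); rewrite mulrC.
have -> : rtrace (c^t* *m c) = \sum_i a i.
  rewrite /rtrace /mxtrace big_ord1 mxE raddf_sum.
  by apply: eq_bigr => i _; rewrite !mxE.
have -> : rtrace (c^t* *m (diag_mx d *m c)) = \sum_i complex.Re (d 0 i) * a i.
  rewrite /rtrace /mxtrace big_ord1 mxE raddf_sum; apply: eq_bigr => i _.
  by rewrite mul_diag_mx !mxE mulrCA /= {1}dR ReZ.
rewrite mulr_suml; apply: ler_sum => i _; apply: ler_wpM2l => //.
by rewrite (bigD1 i) //= lerDl sumr_ge0.
Qed.

(* Cauchy-Schwarz for the sesquilinear form tr (A Y B'), B' the adjoint of B,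
   combined with the inequality of means. *)
Lemma psd_young m n (Y : 'M[R[i]]_n) (A B : 'M[R[i]]_(m, n)) (t : R) :
  psd Y -> 0 < t ->
  2 * rtrace (A *m Y *m B^t*) <=
    t * rtrace (A *m Y *m A^t*) + rtrace (B *m Y *m B^t*) / t.
Proof.
move=> hY t0.
have expand (c : R[i]) (A' B' : 'M[R[i]]_(n, m)) :
    (c *: A - B) *m Y *m (c *: A' - B') =
    (c * c) *: (A *m Y *m A') - c *: (A *m Y *m B') - c *: (B *m Y *m A') + B *m Y *m B'.
  rewrite (mulmxBl (c *: A) B Y) mulmxBl !(mulmxBr _ (c *: A') B').
  rewrite -(scalemxAl c A Y) -(scalemxAr c _ A') -(scalemxAl c _ A') -(scalemxAl c _ B').
  by rewrite scalerA -(scalemxAr c _ A') opprD opprK addrA.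
have := psd_rtrace_ge0 (psd_conj (t%:C *: A - B) hY).
rewrite dagB dagZ conjCr expand -(_ : (A *m Y *m B^t*)^t* = B *m Y *m A^t*); last first.
  by rewrite dagM trmxCK dagM (psd_herm hY) mulmxA.
rewrite -rmorphM.
rewrite rtraceD !rtraceB !rtraceZ rtrace_dag.
move: (rtrace (A *m Y *m A^t*)) (rtrace (A *m Y *m B^t*)) (rtrace (B *m Y *m B^t*)) => y x z h.
rewrite -(ler_pM2l t0) mulrDr [t * (z / t)]mulrC divfK ?gt_eqF //.
by rewrite -subr_ge0; apply: le_trans h _; rewrite le_eqVlt; apply/orP; left; apply/eqP; ring.
Qed.

End Dagger.

(** * Tensor products of states, polar decomposition and the trace norm *)

Section TraceNorm.
Local Open Scope sesquilinear_scope.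
Variable R : realType.

(** Schur's product argument: a Gram factorization of [S] writes the product as a sum of diagonal
    scalings of a pulled back [U]. *)
Lemma psd_prodop (A B C D : finType) (S : op R (A * B)) (U : op R (C * D)) :
  psd S -> psd U -> psd (prodop S U).
Proof.
move=> /psd_factor[G SE] hU.
have -> : prodop S U = \sum_k kconj (fun z w : (A * C) * (B * D) =>
    Num.conj (G k (enum_rank (z.1.1, z.2.1))) * (w == z)%:R)
      (mkop (fun x y => entry U (x.1.2, x.2.2) (y.1.2, y.2.2))).
  apply: opP => x y; rewrite entry_mkop entry_sum {1}/entry SE mxE mulr_suml.
  apply: eq_bigr => k _; rewrite entry_kconj (sum_delta (i0 := x)) => [|z /negPf ->]; last first.
    by rewrite big1 // => w _; rewrite mulr0 !mul0r.
  rewrite (sum_delta (i0 := y)) => [|w /negPf ->]; last by rewrite mulr0 conjC0 mulr0.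
  rewrite !eqxx !mulr1 conjCK entry_mkop !mxE /=; ring.
apply: psd_sum => k _; apply: kconj_psd.
exact: (pull_psd (fun z : (A * C) * (B * D) => (z.1.2, z.2.2)) hU).
Qed.

Lemma tr_prodop (A B C D : finType) (S : op R (A * B)) (U : op R (C * D)) :
  \tr (prodop S U) = \tr S * \tr U.
Proof.
rewrite !tr_entry mulr_suml.
under [RHS]eq_bigr do rewrite mulr_sumr.
rewrite pair_bigA /= (reindex (fun z : (A * C) * (B * D) => ((z.1.1, z.2.1), (z.1.2, z.2.2)))) /=.
  by apply: eq_bigr => z _; rewrite entry_mkop.
apply: onW_bij; exists (fun z : (A * B) * (C * D) => ((z.1.1, z.2.1), (z.1.2, z.2.2))).
  by move=> [[a c] [b d]].
by move=> [[a c] [b d]].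
Qed.

Lemma density_tensor_pow (A B : finType) n (rho : op R (A * B)) :
  density rho -> density (tensor_pow n rho).
Proof.
move=> [hP hT]; elim: n => [|n [IP IT]].
  pose J : op R (unit * unit) := mkop (fun _ _ => 1).
  have hJ : psd J.
    apply/psdP => v; rewrite (sum_delta (i0 := (tt, tt))); last by case=> -[] [].
    rewrite (sum_delta (i0 := (tt, tt))); last by case=> -[] [].
    by rewrite entry_mkop mulr1 mulrC mul_conjC_ge0.
  have tJ : \tr J = 1.
    by rewrite tr_entry (sum_delta (i0 := (tt, tt))) ?entry_mkop //; case=> -[] [].
  have b0 I : bijective (fun _ : pow I 0 => tt).
    by exists (fun=> ffun0 (card_ord 0)) => [w|[]] //; apply/ffunP => -[].
  have -> : tensor_pow 0 rho = pull (fun z => (tt, tt)) J.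
    by apply: opP => x y; rewrite entry_pull !entry_mkop big_ord0.
  split; first exact: pull_psd.
  rewrite tr_pull_bij //; exists (fun _ => (ffun0 (card_ord 0), ffun0 (card_ord 0))).
    by move=> [x y]; congr pair; apply/ffunP => -[].
  by move=> [[] []].
rewrite tensor_pow_cons; split; first exact/pull_psd/psd_prodop.
rewrite tr_pull_bij ?tr_prodop ?hT ?IT ?mulr1 //.
have [gA gAK gAK'] := @uncons_pow_bij A n; have [gB gBK gBK'] := @uncons_pow_bij B n.
by exists (fun z => (gA z.1, gB z.2)) => -[x y] /=; rewrite ?gAK ?gBK ?gAK' ?gBK'.
Qed.

Lemma mxabsE n (X : 'M[R[i]]_n) (P := spectralmx (X^t* *m X))
    (d := spectral_diag (X^t* *m X)) :
  mxabs X = P^t* *m diag_mx (map_mx sqrtC d) *m P.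
Proof. by rewrite /mxabs -/P invmx_unitary // spectral_unitarymx. Qed.

(** Polar decomposition: [W] is the pseudo-inverse of [mxabs X] times [X^t*]. As [0^-1 = 0],
    inverting singular values entrywise yields this pseudo-inverse, and [W *m W^t*] is the projector
    onto its support. *)
Lemma mxabs_spec n (X : 'M[R[i]]_n) :
  exists W : 'M[R[i]]_n, [/\ psd (mxabs X), mxabs X *m mxabs X = X^t* *m X,
    W *m X = mxabs X & psd (1%:M - W *m W^t*)].
Proof.
have hH := psd_gram X; have := psd_spectral hH; rewrite mxabsE.
set H := X^t* *m X in hH *; set P := spectralmx H; set d := spectral_diag H.
move=> [PP PP' HE d0].
have mulS (u v : 'rV[R[i]]_n) : (P^t* *m diag_mx u *m P) *m (P^t* *m diag_mx v *m P) =
    P^t* *m diag_mx (\row_i (u 0 i * v 0 i)) *m P.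
  by rewrite !mulmxA -(mulmxA _ P (P^t*)) PP mulmx1 -(mulmxA (P^t*)) mulmx_diag.
have dagS (u : 'rV[R[i]]_n) : (P^t* *m diag_mx u *m P)^t* =
    P^t* *m diag_mx (map_mx Num.conj u) *m P.
  by rewrite !dagM trmxCK tr_diag_mx map_diag_mx mulmxA.
have psdS (u : 'rV[R[i]]_n) : (forall i, 0 <= u 0 i) -> psd (P^t* *m diag_mx u *m P).
  move=> u0; have := psd_gram (diag_mx (map_mx sqrtC u) *m P).
  set S := diag_mx (map_mx _ _).
  by rewrite dagM mulmxA -(mulmxA (P^t*) (S^t*) S) diag_sqrt.
pose s : 'rV[R[i]]_n := map_mx sqrtC d.
have s0 i : 0 <= s 0 i by rewrite mxE sqrtC_ge0.
pose W := P^t* *m diag_mx (map_mx GRing.inv s) *m P *m X^t*.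
exists W; split.
- exact: psdS.
- rewrite mulS (_ : \row_i _ = d) -?HE //; apply/rowP => i.
  by rewrite !mxE -expr2 sqrtCK.
- rewrite /W -(mulmxA _ (X^t*) X) -/H HE mulS (_ : \row_i _ = s) //; apply/rowP => i.
  rewrite !mxE -[X in _ * X](sqrtCK (d 0 i)) expr2 mulrA.
  have [->|h] := eqVneq (sqrtC (d 0 i)) 0; first by rewrite mulr0.
  by rewrite mulVf ?mul1r.
- have -> : W *m W^t* = P^t* *m diag_mx (map_mx (fun x => (x != 0)%:R) s) *m P.
    rewrite /W (dagM _ (X^t*)) trmxCK mulmxA -(mulmxA _ (X^t*) X) -/H HE dagS !mulS.
    rewrite (_ : \row_i _ = map_mx (fun x => (x != 0)%:R) s) //; apply/rowP => i.
    rewrite !mxE /= fmorphV /= geC0_conj ?sqrtC_ge0 // -[X in _ * X * _](sqrtCK (d 0 i)).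
    have [->|h] := eqVneq (sqrtC (d 0 i)) 0; first by rewrite invr0 mul0r mul0r.
    by rewrite expr2 mulrA mulVf // mul1r mulfV.
  have -> : 1%:M = P^t* *m diag_mx (const_mx 1) *m P by rewrite diag_const_mx mulmx1 PP'.
  rewrite -(mulmxBl (P^t* *m _) _ P) -(mulmxBr (P^t*)) -linearB; apply: psdS => i; rewrite !mxE.
  by case: (_ == 0); rewrite ?subr0 ?subrr ?ler01.
Qed.

Lemma trnorm_ge0 n (X : 'M[R[i]]_n) : 0 <= trnorm X.
Proof. by have [W [/psd_rtrace_ge0]] := mxabs_spec X. Qed.

End TraceNorm.

Section TraceNorm.
Local Open Scope sesquilinear_scope.
Variable R : realType.

(** The size of <u, X u> is at most the length of X u, which is at most the largest singular value
    and so at most the sum of all. *)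
Lemma trnorm_lower n (X : 'M[R[i]]_n) (u : 'cV[R[i]]_n) : rtrace (u^t* *m u) = 1 ->
  - rtrace (u^t* *m X *m u) <= trnorm X.
Proof.
move=> u1; have [W [hS SS _ _]] := mxabs_spec X.
set t := trnorm X; have t0 : 0 <= t := trnorm_ge0 X.
have q : rtrace (u^t* *m (X^t* *m X) *m u) <= t * t.
  have [G GE] := psd_factor hS.
  have -> : rtrace (u^t* *m (X^t* *m X) *m u) =
      rtrace ((G *m u)^t* *m (G *m G^t*) *m (G *m u)).
    by rewrite -SS {1 2}GE (dagM G u) !mulmxA.
  have hG : psd (G *m G^t*) by have := psd_gram (G^t*); rewrite trmxCK.
  apply: le_trans (psd_le_trace _ hG) _.
  rewrite rtraceC -GE -/t ler_wpM2l // (dagM G u) -(mulmxA (u^t*)) (mulmxA _ G) -GE mulmxA.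
  by apply: le_trans (psd_le_trace _ hS) _; rewrite u1 mulr1.
rewrite leNgt; apply/negP => lt.
set m := - _ in lt; have m0 : 0 < m by exact: le_lt_trans lt.
(* Cauchy-Schwarz in disguise: the squared length of m u + X u is q - m^2, with q the squared length
   of X u. *)
have := psd_rtrace_ge0 (psd_gram (m%:C *: u + X *m u)).
have -> : (m%:C *: u + X *m u)^t* *m (m%:C *: u + X *m u) =
    (m * m)%:C *: (u^t* *m u) + m%:C *: (u^t* *m X *m u) +
    m%:C *: (u^t* *m X *m u)^t* + u^t* *m (X^t* *m X) *m u.
  have -> : (u^t* *m X *m u)^t* = (X *m u)^t* *m u by rewrite !dagM trmxCK mulmxA.
  have -> : u^t* *m (X^t* *m X) *m u = (X *m u)^t* *m (X *m u) by rewrite dagM !mulmxA.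
  rewrite dagD dagZ conjCr rmorphM /= mulmxDl !(mulmxDr _ (m%:C *: u)).
  rewrite -(mulmxA (u^t*) X u) -(scalemxAl _ (u^t*)) -(scalemxAr _ (u^t*)) scalerA.
  by rewrite -(scalemxAl _ (u^t*)) -(scalemxAr _ _ u) !addrA.
rewrite !rtraceD !rtraceZ rtrace_dag u1 mulr1.
have -> : rtrace (u^t* *m X *m u) = - m by rewrite opprK.
move: q; move: (rtrace _) => q qt.
have tm : t * t < m * m by apply: ltr_pM.
by move=> h; lra.
Qed.

End TraceNorm.

Section TraceNorm.
Local Open Scope sesquilinear_scope.
Variable R : realType.

Fact half_norm_arith (x y : R) : x <= 1 -> 0 <= x + y + (y + 1) -> - y <= 1.
Proof. lra. Qed.

Fact trnorm_arith (t z x y w F : R) :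
  2 * x <= t + z -> 2 * y <= t + z -> - ((1 - F) * w) <= 1 - F -> 1 - F <= z ->
  x + y + F * w - w <= t + 2 * z.
Proof. lra. Qed.

(** A gentle measurement bound. With [t] of order sqrt (1 - F) it has the familiar square-root form;
    a free [t] keeps it affine in the fidelity, so that it can be averaged over outcomes. *)
Lemma trnorm_upper n (Y : 'M[R[i]]_n) (u : 'cV[R[i]]_n) (t : R) :
  psd Y -> \tr Y = 1 -> u^t* *m u = 1%:M -> 0 < t -> t <= 1 ->
  trnorm (Y - u *m u^t*) <= t + 2 * (1 - rtrace (u^t* *m Y *m u)) / t.
Proof.
move=> hY tY u1 t0 t1; set P := u *m u^t*; set F := rtrace _.
have [W [_ _ WX hW]] := mxabs_spec (Y - P).
pose Q := 1%:M - P.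
have tY1 : rtrace Y = 1 by rewrite /rtrace tY.
have r1 : rtrace (1%:M : 'M[R[i]]_1) = 1 by rewrite /rtrace mxtrace1.
have Pdag : P^t* = P by rewrite dagM trmxCK.
have PP : P *m P = P by rewrite /P mulmxA -(mulmxA u) u1 mulmx1.
have Qdag : Q^t* = Q by rewrite dagB dag1 Pdag.
have QQ : Q *m Q = Q by rewrite mulmxBl mul1mx mulmxBr mulmx1 PP subrr subr0.
have FE : F = rtrace (P *m Y) by rewrite /F (rtraceC _ u) mulmxA.
have QY : rtrace (Q *m Y) = 1 - F by rewrite mulmxBl mul1mx rtraceB tY1 FE.
set Z := Q *m Y *m Q^t*.
have hZ : psd Z by exact: psd_conj.
have tZ : rtrace Z = 1 - F by rewrite /Z Qdag rtraceC mulmxA QQ QY.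
have F1 : 0 <= 1 - F by rewrite -tZ; exact: psd_rtrace_ge0.
have F0 : 0 <= F.
  by have := psd_rtrace_ge0 (psd_conj (u^t*) hY); rewrite trmxCK.
pose a := W^t* *m u.
have a1 : rtrace (a^t* *m a) <= 1.
  rewrite /a dagM trmxCK mulmxA -(mulmxA _ W).
  have := psd_rtrace_ge0 (psd_conj (u^t*) hW).
  by rewrite trmxCK mulmxBr mulmx1 mulmxBl u1 rtraceB r1 subr_ge0.
(* [tr (W Y)] is cut along 1 = P + Q; the pieces involving Q are small by
   Cauchy-Schwarz. *)
have e : rtrace (W *m Y) = rtrace (1%:M *m Y *m (W^t* *m Q)^t*) +
    rtrace (a^t* *m Q *m Y *m u^t*^t*) + F * rtrace (u^t* *m W *m u).
  have uYu : u^t* *m Y *m u = F%:C%:M.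
    rewrite [LHS]mx11_scalar; congr (_%:M); rewrite /F /rtrace /mxtrace big_ord1.
    by rewrite [LHS]complexE (ger0_Im (hY u)) mulr0 addr0.
  have YE : Y = Y *m Q + Y *m P by rewrite -mulmxDr subrK mulmx1.
  have e1 : rtrace (W *m Y) = rtrace (W *m (Y *m Q)) + rtrace (W *m (Y *m P)).
    by rewrite -rtraceD -mulmxDr -YE.
  have e2 : rtrace (W *m (Y *m P)) = rtrace (W *m Q *m Y *m P) + rtrace (W *m P *m Y *m P).
    by rewrite -rtraceD -!mulmxDl -mulmxDr subrK mulmx1 mulmxA.
  have e3 : rtrace (W *m (Y *m Q)) = rtrace (1%:M *m Y *m (W^t* *m Q)^t*).
    by rewrite dagM trmxCK Qdag mul1mx (rtraceC W) !mulmxA.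
  have e4 : rtrace (W *m Q *m Y *m P) = rtrace (a^t* *m Q *m Y *m u^t*^t*).
    by rewrite /a dagM !trmxCK /P (mulmxA _ u) (rtraceC _ (u^t*)) !mulmxA.
  have e5 : rtrace (W *m P *m Y *m P) = F * rtrace (u^t* *m W *m u).
    rewrite /P (mulmxA _ u) (rtraceC _ (u^t*)).
    have -> : u^t* *m (W *m (u *m u^t*) *m Y *m u) = (u^t* *m W *m u) *m (u^t* *m Y *m u).
      by rewrite !mulmxA.
    by rewrite uYu mul_mx_scalar rtraceZ.
  by rewrite e1 e2 e3 e4 e5 addrA.
have y1 := psd_young 1%:M (W^t* *m Q) hY t0.
have y2 := psd_young (u^t*) (a^t* *m Q) hY t0.
have y2' : rtrace (u^t* *m Y *m (a^t* *m Q)^t*) = rtrace (a^t* *m Q *m Y *m u^t*^t*).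
  by rewrite -[LHS]rtrace_dag !dagM !trmxCK (psd_herm hY) !mulmxA.
have b1 : rtrace (1%:M *m Y *m (1%:M : 'M[R[i]]_n)^t*) = 1.
  by rewrite dag1 mulmx1 mul1mx.
have b2 : rtrace (W^t* *m Q *m Y *m (W^t* *m Q)^t*) <= 1 - F.
  rewrite (dagM _ Q) trmxCK.
  have -> : W^t* *m Q *m Y *m (Q^t* *m W) = W^t* *m (Z *m W) by rewrite /Z !mulmxA.
  rewrite rtraceC -mulmxA.
  by apply: le_trans (psd_trace_contract hZ hW) _; rewrite tZ.
have b3 : rtrace (u^t* *m Y *m u^t*^t*) = F by rewrite trmxCK.
have b4 : rtrace (a^t* *m Q *m Y *m (a^t* *m Q)^t*) <= 1 - F.
  have -> : a^t* *m Q *m Y *m (a^t* *m Q)^t* = a^t* *m Z *m a.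
    by rewrite (dagM _ Q) trmxCK /Z !mulmxA.
  apply: le_trans (psd_le_trace a hZ) _.
  by rewrite tZ -[leRHS]mulr1 ler_wpM2l.
have b5 : - rtrace (u^t* *m W *m u) <= 1.
  have wE : a^t* = u^t* *m W by rewrite /a (dagM _ u) trmxCK.
  have uaE : rtrace (u^t* *m a) = rtrace (a^t* *m u).
    by rewrite -rtrace_dag (dagM _ a) trmxCK.
  have := psd_rtrace_ge0 (psd_gram (a + u)).
  rewrite dagD mulmxDl !(mulmxDr _ a u) !rtraceD uaE u1 r1 -wE.
  exact: half_norm_arith.
have tr0 : trnorm (Y - P) = rtrace (W *m Y) - rtrace (u^t* *m W *m u).
  rewrite /trnorm -WX mulmxBr rtraceB; congr (_ - _).
  by rewrite /P mulmxA rtraceC mulmxA.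
rewrite tr0 e -y2'.
rewrite b1 in y1; rewrite b3 in y2.
have y1' : 2 * rtrace (1%:M *m Y *m (W^t* *m Q)^t*) <= t + (1 - F) / t.
  by apply: le_trans y1 _; rewrite mulr1 lerD2l ler_pM2r ?invr_gt0.
have y2'' : 2 * rtrace (u^t* *m Y *m (a^t* *m Q)^t*) <= t + (1 - F) / t.
  apply: le_trans y2 _; rewrite lerD ?ler_pM2r ?invr_gt0 //.
  by rewrite -[leRHS]mulr1 ler_pM2l // -subr_ge0.
have b6 : - ((1 - F) * rtrace (u^t* *m W *m u)) <= 1 - F.
  by rewrite -mulrN -[leRHS]mulr1 ler_wpM2l.
have b7 : 1 - F <= (1 - F) / t.
  by rewrite ler_pdivlMr // -[leRHS]mulr1 ler_wpM2l.
by rewrite -mulrA; exact: trnorm_arith y1' y2'' b6 b7.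
Qed.
End TraceNorm.

(** * Bell pairs as a rank-one projector; fidelity against trace norm *)

Section Bells.
Local Open Scope sesquilinear_scope.
Variables (R : realType) (k : nat).

Definition bell_amp (z : qubits k * qubits k) : R[i] :=
  (z.1 == z.2)%:R / sqrtC 2 ^+ k.

Definition bell_vec : 'cV[R[i]]_#|{: qubits k * qubits k}| :=
  \col_s bell_amp (enum_val s).

Lemma sqrt2_sqr : (sqrtC 2 ^+ k)^-1 * (sqrtC 2 ^+ k)^-1 = #|qubits k|%:R^-1 :> R[i].
Proof. by rewrite -invfM -exprMn -expr2 sqrtCK card_ffun card_bool card_ord natrX. Qed.

Lemma bell_amp_conj z : Num.conj (bell_amp z) = bell_amp z.
Proof.
by rewrite /bell_amp rmorphM /= conjC_nat fmorphV /= rmorphXn /= geC0_conj ?sqrtC_ge0 ?ler0n.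
Qed.

Lemma bellsE : bells R k = bell_vec *m bell_vec^t*.
Proof.
apply: opP => x y; rewrite entry_mkop [RHS]/entry [RHS]mxE big_ord1 !mxE /= !enum_rankK bell_amp_conj.
have E (z : qubits k * qubits k) :
    \prod_(i < k) ((z.1 i == z.2 i)%:R / sqrtC 2 : R[i]) = bell_amp z.
  rewrite big_split /= prodr_const card_ord exprVn; congr (_ / _).
  have [->|ne] := eqVneq z.1 z.2; first by rewrite big1 // => i _; rewrite eqxx.
  have [i hi] : exists i, z.1 i != z.2 i.
    apply/existsP; apply: contraNT ne => /existsPn h; apply/eqP/ffunP => i.
    by apply/eqP; have := h i; rewrite negbK.
  by rewrite (bigD1 i) //= (negPf hi) mul0r.
rewrite -!E -big_split; apply: eq_bigr => i _ /=; rewrite /bell entry_mkop /=; congr (_ * _).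
by rewrite rmorphM /= conjC_nat fmorphV /= geC0_conj ?sqrtC_ge0 ?ler0n.
Qed.

Lemma bell_vec_norm : bell_vec^t* *m bell_vec = 1%:M.
Proof.
rewrite [LHS]mx11_scalar; congr (_%:M); rewrite mxE sum_enum_rank sum_pair.
rewrite (eq_bigr (fun=> #|qubits k|%:R^-1)) => [|z _].
  by rewrite sumr_const cardE -cardE -[_ *+ _]mulr_natr mulVf // card_bits_neq0.
rewrite (sum_delta (i0 := z)) => [|w /negPf wz].
  by rewrite !mxE /= enum_rankK bell_amp_conj /bell_amp /= eqxx !mul1r sqrt2_sqr.
by rewrite !mxE /= enum_rankK bell_amp_conj /bell_amp /= eq_sym wz !mul0r.
Qed.

Lemma fidelity_bell_vec (Y : op R (qubits k * qubits k)) :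
  rtrace (bell_vec^t* *m Y *m bell_vec) = fidelity Y.
Proof.
rewrite /rtrace /mxtrace big_ord1 /fidelity; congr complex.Re.
rewrite mxE sum_enum_rank sum_pair exchange_big.
transitivity (\sum_w \sum_z bell_amp (z, z) * entry Y (z, z) (w, w) * bell_amp (w, w)).
  apply: eq_bigr => w _; rewrite (sum_delta (i0 := w)) => [|v /negPf vw]; last first.
    by rewrite [X in _ * X]mxE enum_rankK /bell_amp /= vw !mul0r mulr0.
  rewrite [X in _ * X]mxE enum_rankK -mulr_suml; congr (_ * _).
  rewrite mxE sum_enum_rank sum_pair; apply: eq_bigr => z _.
  rewrite (sum_delta (i0 := z)) => [|v /negPf vz].
    by rewrite !mxE /= enum_rankK bell_amp_conj.
  by rewrite !mxE /= enum_rankK bell_amp_conj /bell_amp /= eq_sym vz !mul0r.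
rewrite exchange_big /bell_weight mulr_sumr; apply: eq_bigr => z _ /=.
rewrite mulr_sumr; apply: eq_bigr => w _.
rewrite /bell_amp /= !eqxx !addr0 !mul1r mulrAC sqrt2_sqr.
have chi0 (v : qubits k) : chi R 0 v = 1 by rewrite /chi big1 // => i _; rewrite ffunE.
by rewrite !chi0 !mul1r.
Qed.

Lemma fidelity_ge_trnorm (Y : op R (qubits k * qubits k)) :
  1 - fidelity Y <= trnorm (Y - bells R k).
Proof.
have u1 : rtrace (bell_vec^t* *m bell_vec) = 1 by rewrite bell_vec_norm /rtrace mxtrace1.
have := trnorm_lower (Y - bells R k) u1; apply: le_trans.
rewrite mulmxBr mulmxBl rtraceB fidelity_bell_vec opprB bellsE.
by rewrite mulmxA bell_vec_norm mul1mx u1.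
Qed.

Lemma trnorm_le_fidelity (Y : op R (qubits k * qubits k)) (t : R) :
  density Y -> 0 < t -> t <= 1 ->
  trnorm (Y - bells R k) <= t + 2 * (1 - fidelity Y) / t.
Proof.
move=> [hY tY] t0 t1; rewrite bellsE -fidelity_bell_vec.
by apply: trnorm_upper => //; exact: bell_vec_norm.
Qed.

End Bells.

(** * Error of the code on independent blocks *)

Section CodeRate.
Local Open Scope sesquilinear_scope.
Variable R : realType.

Lemma fidelity_le_tr k (om : op R (qubits k * qubits k)) : psd om -> fidelity om <= rtrace om.
Proof.
move=> hom; rewrite /rtrace -sum_bell_weight; apply: leC_Re.
rewrite (bigD1 (0 : qubits k)) //= (bigD1 (0 : qubits k)) //= -addrA lerDl addr_ge0 ?sumr_ge0 //.
  by move=> f _; exact: bell_weight_ge0.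
by move=> e _; apply: sumr_ge0 => f _; exact: bell_weight_ge0.
Qed.

Lemma fidelity_ge0 k (om : op R (qubits k * qubits k)) : psd om -> 0 <= fidelity om.
Proof. by move=> /(bell_weight_ge0 0 0) /leC_Re. Qed.

Lemma fidelity_le1 k (om : op R (qubits k * qubits k)) : density om -> fidelity om <= 1.
Proof. by move=> [h t1]; apply: le_trans (fidelity_le_tr h) _; rewrite /rtrace t1. Qed.

(** A block is faulty with probability 1 - F, so 2 to the number of faulty blocks has mean (F + 2 (1
    - F))^N = (2 - F)^N. A bit or phase pattern outside [S] touches more than [t] blocks, and
    Markov's inequality applies. *)
Lemma sum_bell_weight_out N k L (g : 'I_N * 'I_k -> 'I_L) (om : op R (qubits k * qubits k)) t
    (X := pull (fun z => (unflatten g z.1, unflatten g z.2)) (tensor_pow N om))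
    (S := [set z : qubits L | (#|[set i | unflatten g z i != 0%R]| <= t)%N]) :
  bijective g -> density om ->
  2 ^+ t * (1 - \sum_(e in S) \sum_(f in S) bell_weight e f X) <=
  (2 - bell_weight 0 0 om) ^+ N.
Proof.
move=> bg [hom tom].
have trX : \tr X = 1.
  have [gi gK gK'] := unflatten_bij bg.
  rewrite tr_pull_bij; first by have [] := density_tensor_pow N (conj hom tom).
  by exists (fun z => (gi z.1, gi z.2)) => -[x y] /=; rewrite ?gK ?gK'.
pose p (z : qubits k * qubits k) := bell_weight z.1 z.2 om.
pose b (z : qubits k * qubits k) := z != (0, 0).
pose F (z : pow (qubits k * qubits k)%type N) := \prod_i p (z i).
have sumE (P : rel (pow (qubits k) N)) :
    \sum_(e : qubits L) \sum_(f : qubits L | P (unflatten g e) (unflatten g f)) bell_weight e f X =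
    \sum_(u : pow (qubits k * qubits k)%type N | P [ffun i => (u i).1] [ffun i => (u i).2]) F u.
  pose G u v : R[i] := if P u v then \prod_i bell_weight (u i) (v i) om else 0.
  transitivity (\sum_u \sum_v G u v).
    rewrite [RHS](reindex (unflatten g)); last exact/onW_bij/unflatten_bij.
    apply: eq_bigr => e _; rewrite [RHS](reindex (unflatten g)); last exact/onW_bij/unflatten_bij.
    by rewrite big_mkcond; apply: eq_bigr => f _; rewrite /G bell_weight_pow.
  rewrite sum_pow_pair [RHS]big_mkcond; apply: eq_bigr => u _; rewrite /G; case: ifP => // _.
  by apply: eq_bigr => i _; rewrite !ffunE.
pose small (u : pow (qubits k) N) := (#|[set i | u i != 0%R]| <= t)%N.
pose P u v := small u && small v.
pose P' (u : pow (qubits k * qubits k)%type N) := P [ffun i => (u i).1] [ffun i => (u i).2].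
have -> : \sum_(e in S) \sum_(f in S) bell_weight e f X = \sum_(u | P' u) F u.
  rewrite -(sumE P) [LHS]big_mkcond; apply: eq_bigr => e _; rewrite /P inE -/(small _).
  case: (small (unflatten g e)) => /=; last by rewrite big_pred0.
  by apply: eq_bigl => f; rewrite inE.
have -> : 1 - \sum_(u | P' u) F u = \sum_(u | ~~ P' u) F u.
  rewrite -[X in X - _]trX -sum_bell_weight (sumE (fun _ _ => true)) /=.
  by rewrite [X in X - _](bigID P') /= addrAC subrr add0r.
have p0 a : 0 <= p a by exact: bell_weight_ge0.
have -> : 2 - bell_weight 0 0 om = \sum_a p a * 2 ^+ b a.
  have tp : \sum_a p a = 1 by rewrite sum_pair sum_bell_weight.
  rewrite (bigD1 ((0, 0) : qubits k * qubits k)) //= /b eqxx mulr1.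
  rewrite (eq_bigr (fun a => p a * 2)) => [|a ->]; last by rewrite expr1.
  rewrite -mulr_suml; move: tp; rewrite (bigD1 ((0, 0) : qubits k * qubits k)) //= => /(canRL (addKr _)) ->.
  by rewrite /p /=; ring.
apply: (@exp_markov _ _ _ b N (fun u => ~~ P' u)) => //.
move=> u; rewrite negb_and => h; apply: ler_weXn2l; first by rewrite ler1n.
have le (h' : qubits k * qubits k -> qubits k) : (forall z, h' z != 0 -> z != (0, 0)) ->
    ~~ small [ffun i => h' (u i)] -> (t <= hits b u)%N.
  move=> hz; rewrite -ltnNge => /ltnW/leq_trans; apply; apply/subset_leq_card/fintype.subsetP => i.
  by rewrite !inE ffunE => /hz.
case/orP: h; apply: le => z; apply: contraNneq => ->//.
Qed.

(** With no output qubits the target is the trivial state, so discarding everything is a perfect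
    protocol of rate 0, the fallback when no candidate passes. *)
Lemma channel_trash (A B : finType) :
  exists2 Lam : op R (A * B) -> op R (qubits 0 * qubits 0),
    locc_channel Lam & forall X, fidelity (Lam X) = rtrace X.
Proof.
have b0 I : bijective (fun z : I * qubits 0 => z.1).
  exists (fun a => (a, 0)) => [[a z]|a] //=; congr pair; apply/ffunP => -[] //.
have hL : locc_channel (fun T : op R (A * B) =>
    \sum_a \sum_b pull (fun _ : qubits 0 * qubits 0 => (a, b)) T).
  exact: (@locc_measure _ _ _ _ _ _ _ _ A B (fun a _ => a) (fun b _ => b)
    (fun _ _ _ T => T) _ (b0 A) (b0 B) (fun _ _ => channel_id _ _ _)).
eexists; first exact: hL.
move=> X; rewrite /fidelity /rtrace -(channel_tr X hL) -sum_bell_weight.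
have z0 (z : qubits 0) : z = 0 by apply/ffunP => -[].
by congr complex.Re; rewrite !(sum_delta (i0 := 0 : qubits 0)) // => e /eqP[]; rewrite (z0 e).
Qed.

Definition low_weight k N t : {set pow (qubits k) N} :=
  [set u : pow (qubits k) N | (#|[set i | u i != 0%R]| <= t)%N].

Lemma code_fixed k N s t : (#|low_weight k N t| ^ 2 < 2 ^ s)%N ->
  exists2 Lam : op R (pow (qubits k) N * pow (qubits k) N) ->
      op R (qubits (N * k - (s + s)) * qubits (N * k - (s + s))),
    locc_channel Lam & forall om, density om ->
      1 - fidelity (Lam (tensor_pow N om)) <= (2 - fidelity om) ^+ N / 2 ^+ t.
Proof.
move=> cS; set L := (N * k - (s + s))%N.
have fid2 (om : op R (qubits k * qubits k)) : density om -> 0 <= 2 - fidelity om.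
  by move=> /fidelity_le1 h; rewrite subr_ge0 (le_trans h) // ler1n.
(* Truncated subtraction: if the parities would consume more than all qubits, [L] is 0 and
   everything is discarded. *)
have [le|gt] := leqP (s + s) (N * k); last first.
  rewrite /L (eqP (ltnW gt)); have [Lam hL LE] := channel_trash (pow (qubits k) N) (pow (qubits k) N).
  exists Lam => // om hom; rewrite LE /rtrace (density_tensor_pow N hom).2 subrr.
  by rewrite divr_ge0 ?exprn_ge0 ?fid2.
have dim : #|{: 'I_N * 'I_k}| = (s + (s + L))%N.
  by rewrite card_prod !card_ord addnA subnKC.
pose g (z : 'I_N * 'I_k) := cast_ord dim (enum_rank z).
have bg : bijective g.
  apply: (bij_comp (f := cast_ord dim) (h := @enum_rank _)); last exact: enum_rank_bij.
  by exists (cast_ord (esym dim)); [exact: cast_ordK|exact: cast_ordKV].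
pose S := [set z : qubits (s + (s + L)) | (#|[set i | unflatten g z i != 0%R]| <= t)%N].
have cS' : (#|S| ^ 2 < 2 ^ s)%N.
  suff -> : #|S| = #|low_weight k N t| by [].
  have [gi gK gK'] := unflatten_bij bg.
  rewrite -(card_imset _ (can_inj gK)); apply: eq_card => u.
  apply/imsetP/idP => [[z zS ->]|uS]; first by move: zS; rewrite !inE.
  by exists (gi u); rewrite ?gK' // inE gK'; move: uS; rewrite inE.
have [Lam hL LE] := @decode_css R s L S cS'.
exists (Lam \o pull (fun z => (unflatten g z.1, unflatten g z.2))).
  by apply: channel_comp hL; apply: channel_relabel; exact: unflatten_bij.
move=> om hom /=; set X := pull _ _.
have hX : psd X by apply: pull_psd; exact: (density_tensor_pow N hom).1.
have := sum_bell_weight_out t bg hom; rewrite -/X -/S => h.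
have le1 : 2 ^+ t * (1 - bell_weight 0 0 (Lam X)) <= (2 - bell_weight 0 0 om) ^+ N.
  apply: le_trans h; rewrite ler_wpM2l ?exprn_ge0 ?ler0n // lerD2l lerN2.
  exact: LE.
move: le1; rewrite (fidelityE (channel_psd hL hX)) (fidelityE hom.1).
have e1 (f : R) : 2 ^+ t * (1 - f%:C) = (2 ^+ t * (1 - f))%:C.
  by rewrite rmorphM rmorphXn rmorphB rmorph1 /= rmorph_nat.
have e2 (f : R) : (2 - f%:C) ^+ N = ((2 - f) ^+ N)%:C.
  by rewrite rmorphXn rmorphB /= rmorph_nat.
rewrite e1 e2 lecR => le1.
by rewrite ler_pdivlMr ?exprn_gt0 // mulrC.
Qed.

End CodeRate.

(** * Rate of the error-correcting code *)

Section CodeRate.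
Variable R : realType.

Lemma expR1_le4 : expR (1 : R) <= 4.
Proof.
have h := expR_ge1Dx (- 2^-1 : R).
have e : expR (1 : R) = (expR (- 2^-1))^-1 ^+ 2.
  by rewrite expRN invrK -expRM_natl; congr expR; field.
have p : 0 < (2^-1 : R) by rewrite invr_gt0.
have h' : 2^-1 <= expR (- 2^-1 : R) by apply: le_trans h; lra.
rewrite e; have : (expR (- 2^-1 : R))^-1 <= 2.
  by rewrite -[2 in leRHS]invrK lef_pV2 ?posrE // (lt_le_trans p).
move=> h2; apply: (@le_trans _ _ (2 ^+ 2)); last by rewrite -natrX.
by rewrite ler_pXn2r ?nnegrE // invr_ge0 expR_ge0.
Qed.

(** (1 + 1/c)^c is at most e, hence at most 4; the successor covers an [N] that is not a multiple of
    [c]. *)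
Lemma exp_le_pow4 (x : R) c N : (0 < c)%N -> 0 <= x -> x <= c%:R^-1 ->
  (1 + x) ^+ N <= 4 ^+ (N %/ c).+1.
Proof.
move=> c0 x0 xc.
have c1 : 1 <= 1 + x by rewrite lerDl.
apply: (@le_trans _ _ ((1 + x) ^+ (c * (N %/ c).+1))).
  by apply: ler_weXn2l => //; rewrite mulnS mulnC {1}(divn_eq N c) addnC leq_add2r ltnW // ltn_mod.
rewrite exprM; apply: lerXn2r; rewrite ?nnegrE ?exprn_ge0 ?ler0n ?(le_trans ler01) //.
apply: le_trans expR1_le4.
rewrite -[in leRHS](divff (x := c%:R)) ?pnatr_eq0 -?lt0n // expRM_natl.
apply: lerXn2r; rewrite ?nnegrE ?expR_ge0 ?(le_trans ler01) //.
by apply: le_trans (expR_ge1Dx _); rewrite lerD2l.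
Qed.

(** [exp_markov] with all weights 1 counts patterns. The choice [x = 2 ^- (k + l)] makes a block
    contribute at most [1 + 2 ^- l], all its [2 ^ k] values included. *)
Lemma card_low_weight k l N t :
  (#|low_weight k N t| <= 2 ^ ((k + l) * t) * 4 ^ (N %/ 2 ^ l).+1)%N.
Proof.
pose x : R := 2 ^- (k + l).
have x0 : 0 < x by rewrite invr_gt0 exprn_gt0.
have x1 : x <= 1 by rewrite invf_le1 ?exprn_gt0 // exprn_ege1 // ler1n.
have := @exp_markov R (qubits k) (fun=> 1) (fun a => a != 0) N
  (mem (low_weight k N t)) x t (fun=> ler01) (ltW x0).
move=> /(_ _)/le_trans-h.
rewrite -(ler_nat R) natrM !natrX exprM.
have -> : (2 ^+ (k + l)) ^+ t = x ^- t :> R by rewrite /x exprVn invrK.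
rewrite mulrC ler_pdivlMr ?exprn_gt0 // mulrC.
have -> : #|low_weight k N t|%:R = \sum_(u in low_weight k N t) \prod_(i < N) 1 :> R.
  by rewrite -sum1_card natr_sum; apply: eq_bigr => u _; rewrite big1.
apply: h => [u|].
  move=> hu; have : u \in low_weight k N t by [].
  by rewrite inE => hu'; apply: (ler_wiXn2l (ltW x0) x1).
apply: (@le_trans _ _ ((1 + 2 ^- l) ^+ N)); last first.
  by apply: exp_le_pow4; rewrite ?expn_gt0 ?natrX ?invr_ge0 ?exprn_ge0.
apply: lerXn2r; rewrite ?nnegrE ?addr_ge0 ?invr_ge0 ?exprn_ge0 ?sumr_ge0 //.
  by move=> a _; rewrite mul1r exprn_ge0 // ltW.
have -> : 1 + 2 ^- l = \sum_(a : qubits k) ((a == 0)%:R + x).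
  rewrite big_split /= (bigD1 (0 : qubits k)) //= big1 => [|a /negPf ->//].
  rewrite eqxx addr0 mulr1n sumr_const card_ffun card_bool card_ord -[x *+ _]mulr_natl natrX /x exprD invfM.
  by rewrite mulrA mulfV ?mul1r // expf_neq0 // pnatr_eq0.
apply: ler_sum => a _; rewrite mul1r.
by case: (a == 0); rewrite ?expr0 ?expr1 ?add0r // lerDl ltW.
Qed.

(* Errors confined to a fraction of the blocks are corrected by a linear code
   whose redundancy per block is a small multiple of the block length. *)
Lemma code_rate (mu : R) : 0 < mu -> exists2 c, (0 < c)%N & forall k (eta : R), 0 < eta ->
  exists N0, forall N, (N0 <= N)%N -> exists2 K, (k%:R - mu * k.+1%:R) * N%:R <= K%:R :> R &
  exists2 Lam : op R (pow (qubits k) N * pow (qubits k) N) -> op R (qubits K * qubits K),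
    locc_channel Lam & forall om, density om -> 1 - fidelity om <= c%:R^-1 ->
      1 - fidelity (Lam (tensor_pow N om)) <= eta.
Proof.
move=> mu0.
(* [l] and [c] depend on [mu] alone. They bound each of the two terms of the redundancy that grow
   with [N] by a quarter of the loss; the constant term [C] gets the other half once [N] is
   large. *)
pose l := (Num.truncn (32 / mu)).+1.
pose c := (Num.truncn (64 * l.+1%:R / mu)).+1.
have hl : 8 / (2 ^ l)%:R <= mu / 4.
  have : 32 / mu < l%:R by exact: truncnS_gt.
  rewrite ltr_pdivrMr // => h; rewrite ler_pdivrMr ?ltr0n ?expn_gt0 //.
  have : l%:R <= (2 ^ l)%:R :> R by rewrite ler_nat ltnW // ltn_expl.
  move: (l%:R : R) ((2 ^ l)%:R : R) h => a b h h'.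
  by have : a * mu <= b * mu; [rewrite ler_pM2r|lra].
have hc : 16 * l.+1%:R / c%:R <= mu / 4.
  have : 64 * l.+1%:R / mu < c%:R by exact: truncnS_gt.
  rewrite ltr_pdivrMr // => h; rewrite ler_pdivrMr ?ltr0n //.
  by move: (l.+1%:R : R) (c%:R : R) h => a b; lra.
exists c => // k eta eta0.
pose C := (16 * (k + l) + 10)%N.
pose N1 := (Num.truncn (2 * C%:R / mu)).+1.
pose J := (Num.truncn (eta^-1)).+1.
exists (maxn N1 (c * J)) => N; rewrite geq_max => /andP[NN1 NJ].
(* With this threshold [2 ^ t] is the square of the [4 ^ (N %/ c).+1] from [exp_le_pow4], so one
   such factor survives as the decay. *)
pose t := (4 * (N %/ c).+1)%N.
(* The exponent of 2 in the square of the bound of [card_low_weight]; the final 1 makes the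
   inequality strict. *)
pose s := (2 * ((k + l) * t) + 4 * (N %/ 2 ^ l).+1 + 1)%N.
have cS : (#|low_weight k N t| ^ 2 < 2 ^ s)%N.
  have := card_low_weight k l N t; rewrite -(leq_exp2r _ _ (isT : 0 < 2)%N) => /leq_ltn_trans; apply.
  rewrite (_ : 4 = 2 ^ 2)%N // -expnM -expnD -expnM ltn_exp2l // /s; lia.
have [Lam hL LE] := code_fixed R cS.
exists (N * k - (s + s))%N; last first.
  exists Lam => // om hom F; apply: le_trans (LE om hom) _.
  have F0 : 0 <= 1 - fidelity om by rewrite subr_ge0 fidelity_le1.
  have -> : 2 - fidelity om = 1 + (1 - fidelity om) by lra.
  apply: (@le_trans _ _ (4 ^+ (N %/ c).+1 / 2 ^+ t)).
    by rewrite ler_pM2r ?invr_gt0 ?exprn_gt0 //; exact: exp_le_pow4.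
  have -> : 2 ^+ t = 4 ^+ (N %/ c).+1 * 4 ^+ (N %/ c).+1 :> R.
    rewrite -exprD -[4]/((2 ^ 2)%N%:R) natrX -exprM; congr (_ ^+ _); rewrite /t; lia.
  rewrite invfM mulrA divff ?mul1r ?expf_neq0 ?pnatr_eq0 //.
  rewrite -[eta]invrK lef_pV2 ?posrE ?invr_gt0 ?exprn_gt0 //.
  apply: (@le_trans _ _ J%:R); first by apply/ltW/truncnS_gt.
  rewrite -natrX ler_nat; apply: (@leq_trans (N %/ c)); first by rewrite leq_divRL // mulnC.
  by rewrite ltnW // (leq_trans (ltn_expl _ (isT : 1 < 4)%N)) // leq_exp2l.
have dle d : (0 < d)%N -> (N %/ d)%:R <= N%:R / d%:R :> R.
  by move=> d0; rewrite ler_pdivlMr ?ltr0n // -natrM ler_nat leq_divM.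
have sE : ((s + s)%N%:R : R) <= 16 * (k + l)%:R * (N%:R / c%:R) + 8 * (N%:R / (2 ^ l)%:R) + C%:R.
  have -> : (s + s = 16 * (k + l) * (N %/ c) + 8 * (N %/ 2 ^ l) + C)%N by rewrite /s /t /C; lia.
  rewrite natrD [in leLHS]natrD [(16 * _ * _)%:R]natrM [(16 * _)%:R]natrM [(8 * _)%:R]natrM lerD2r.
  by apply: lerD; rewrite ler_wpM2l ?mulr_ge0 ?ler0n ?dle ?expn_gt0 // natrX.
have subE : ((N * k)%N%:R - (s + s)%N%:R : R) <= (N * k - (s + s))%N%:R.
  by rewrite lerBlDr -natrD ler_nat; lia.
have b1 : 16 * (k + l)%:R * (N%:R / c%:R) <= k.+1%:R * N%:R * (mu / 4).
  apply: (@le_trans _ _ (k.+1%:R * N%:R * (16 * l.+1%:R / c%:R))); last first.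
    by rewrite ler_wpM2l ?mulr_ge0 ?ler0n.
  have kl : ((k + l)%:R : R) <= k.+1%:R * l.+1%:R by rewrite -natrM ler_nat; lia.
  have -> : k.+1%:R * N%:R * (16 * l.+1%:R / c%:R) = 16 * (k.+1%:R * l.+1%:R) * (N%:R / c%:R) :> R.
    by ring.
  by rewrite ler_wpM2r ?divr_ge0 ?ler0n // ler_pM2l.
have b2 : 8 * (N%:R / (2 ^ l)%:R) <= k.+1%:R * N%:R * (mu / 4).
  have -> : 8 * (N%:R / (2 ^ l)%:R) = N%:R * (8 / (2 ^ l)%:R) :> R by ring.
  apply: (@le_trans _ _ (N%:R * (mu / 4))); first by rewrite ler_wpM2l ?ler0n.
  rewrite -mulrA -[leLHS]mul1r ler_wpM2r ?ler1n // mulr_ge0 ?ler0n //.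
  by apply: le_trans hl; rewrite divr_ge0 ?ler0n.
have b3 : C%:R <= k.+1%:R * N%:R * (mu / 2).
  have : 2 * C%:R / mu < N1%:R by exact: truncnS_gt.
  rewrite ltr_pdivrMr // => h.
  have N1N : (N1%:R : R) <= N%:R by rewrite ler_nat.
  apply: (@le_trans _ _ (N%:R * (mu / 2))).
    have : N1%:R * mu <= N%:R * mu by rewrite ler_pM2r.
    by move: (N1%:R : R) (N%:R : R) (C%:R : R) h {N1N} => x y z; lra.
  by rewrite -mulrA -[leLHS]mul1r ler_wpM2r ?ler1n // mulr_ge0 ?ler0n // divr_ge0 // ltW.
apply: le_trans subE; rewrite natrM mulrBl [k%:R * _]mulrC lerD2l lerN2.
apply: le_trans sE _; apply: le_trans (lerD (lerD b1 b2) b3) _.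
by rewrite le_eqVlt; apply/orP; left; apply/eqP; field.
Qed.
End CodeRate.

(** * Testing a candidate *)

Section BasisTest.
Variable R : realType.

Definition diag_prob (Q : finType) (om : op R (Q * Q)) (z : Q * Q) : R :=
  complex.Re (entry om z z).

Definition mismatch (Q : finType) (om : op R (Q * Q)) : R :=
  \sum_(z | z.1 != z.2) diag_prob om z.

Definition unequal (Q : finType) (z : Q * Q) : bool := z.1 != z.2.

(* The probability that measuring [T] copies of [om] in the computational basis
   yields at most [t] disagreements. *)
Definition pass_prob (Q : finType) T t (om : op R (Q * Q)) : R :=
  \sum_(u : pow (Q * Q)%type T | (hits (@unequal Q) u <= t)%N) \prod_i diag_prob om (u i).

Section State.
Variables (Q : finType) (om : op R (Q * Q)).
Hypothesis hom : density om.

Lemma entry_diag_ge0 z : 0 <= entry om z z.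
Proof.
have /psdP h := hom.1; have := h (fun w => (w == z)%:R).
rewrite (sum_delta (i0 := z)) => [|i /negPf ->]; last by rewrite big1 // => j _; rewrite conjC0 !mul0r.
rewrite (sum_delta (i0 := z)) => [|i /negPf ->]; last by rewrite mulr0.
by rewrite eqxx conjC1 mul1r mulr1.
Qed.

Lemma entry_diag z : entry om z z = (diag_prob om z)%:C.
Proof. by rewrite [LHS]complexE (ger0_Im (entry_diag_ge0 z)) mulr0 addr0. Qed.

Lemma diag_prob_ge0 z : 0 <= diag_prob om z.
Proof. exact: leC_Re (entry_diag_ge0 z). Qed.

Lemma sum_diag_prob : \sum_z diag_prob om z = 1.
Proof. by rewrite /diag_prob -raddf_sum -tr_entry hom.2. Qed.

Lemma mismatch_ge0 : 0 <= mismatch om.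
Proof. by apply: sumr_ge0 => z _; exact: diag_prob_ge0. Qed.

Lemma mismatch_le1 : mismatch om <= 1.
Proof.
rewrite -sum_diag_prob [leRHS](bigID (@unequal Q)) /= lerDl.
by apply: sumr_ge0 => z _; exact: diag_prob_ge0.
Qed.

Lemma sum_diag_equal : \sum_(z | ~~ unequal z) diag_prob om z = 1 - mismatch om.
Proof.
apply/eqP; rewrite eq_sym subr_eq addrC; apply/eqP.
by rewrite -[LHS]sum_diag_prob [LHS](bigID (@unequal Q)).
Qed.

Lemma sum_diag_exp (x : R) :
  \sum_z diag_prob om z * x ^+ unequal z = 1 - mismatch om + mismatch om * x.
Proof.
rewrite (bigID (@unequal Q)) /= addrC; congr (_ + _).
  by rewrite -sum_diag_equal; apply: eq_bigr => z /negPf ->; rewrite mulr1.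
by rewrite mulr_suml; apply: eq_bigr => z ->.
Qed.

Lemma pass_prob_total T t :
  pass_prob T t om + \sum_(u : pow (Q * Q)%type T | (t < hits (@unequal Q) u)%N)
    \prod_i diag_prob om (u i) = 1.
Proof.
rewrite -[RHS](expr1n R T) -[T in RHS]card_ord -prodr_const.
rewrite -[X in \prod_(i in _) X]sum_diag_prob bigA_distr_bigA /= [RHS](bigID (fun u => (hits (@unequal Q) u <= t)%N)) /=.
by congr (_ + _); apply: eq_bigl => u; rewrite ltnNge.
Qed.

Lemma pass_prob_ge0 T t : 0 <= pass_prob T t om.
Proof. by apply: sumr_ge0 => u _; apply: prodr_ge0 => i _; exact: diag_prob_ge0. Qed.

Lemma pass_prob_le1 T t : pass_prob T t om <= 1.
Proof.
rewrite -(pass_prob_total T t) lerDl.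
by apply: sumr_ge0 => u _; apply: prodr_ge0 => i _; exact: diag_prob_ge0.
Qed.

(** [c * w] trials have at most [w] disagreements on average, a quarter of the threshold. Markov's
    inequality for 2 to the number of disagreements gives [4 ^ w.+1 / 16 ^ w]. *)
Lemma pass_prob_complete c w : (0 < c)%N -> mismatch om <= c%:R^-1 ->
  1 - pass_prob (c * w) (4 * w) om <= 4 / 4 ^+ w.
Proof.
move=> c0 hf; rewrite -{1}(pass_prob_total (c * w) (4 * w)) addrC addKr.
set S := \sum_(u | _) _.
have : 2 ^+ (4 * w) * S <= (1 + mismatch om) ^+ (c * w).
  have -> : 1 + mismatch om = \sum_z diag_prob om z * 2 ^+ unequal z.
    by rewrite sum_diag_exp; ring.
  apply: exp_markov => [z||u /ltnW h]; [exact: diag_prob_ge0|exact: ler0n|].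
  by apply: ler_weXn2l => //; rewrite ler1n.
move=> h; have {}h := le_trans h (exp_le_pow4 _ c0 mismatch_ge0 hf).
move: h; rewrite mulKn // exprM (_ : 2 ^+ 4 = 4 * 4); last by ring.
rewrite exprMn exprS -mulrA => h.
have p4 : 0 < 4 ^+ w :> R by rewrite exprn_gt0.
rewrite ler_pdivlMr // mulrC -(ler_pM2l p4); apply: le_trans h _.
by rewrite mulrC.
Qed.

(** Here the mean is at least [16 * w], four times the threshold. With base 1/2 the exponential has
    mean at most exp (- 8 w), thus at most [2 ^- 8] to the power [w]; dividing by the 1/2 to the
    power [4 * w] of the threshold leaves more than the decay claimed. *)
Lemma pass_prob_sound c w : (16 <= c)%N -> 16 / c%:R <= mismatch om ->
  pass_prob (c * w) (4 * w) om <= 4 / 4 ^+ w.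
Proof.
move=> c16 hf; have c0 : (0 < c)%N by apply: leq_trans c16.
have cR : 0 < c%:R :> R by rewrite ltr0n.
have : 2^-1 ^+ (4 * w) * pass_prob (c * w) (4 * w) om <= (1 - mismatch om / 2) ^+ (c * w).
  have -> : 1 - mismatch om / 2 = \sum_z diag_prob om z * 2^-1 ^+ unequal z.
    by rewrite sum_diag_exp; field.
  apply: exp_markov => [z||u h]; [exact: diag_prob_ge0|by rewrite invr_ge0|].
  by apply: ler_wiXn2l => //; rewrite ?invr_ge0 // invf_le1 ?ler1n.
move=> h; have {}h : 2^-1 ^+ (4 * w) * pass_prob (c * w) (4 * w) om <= (2 ^- 8) ^+ w.
  have m2 : 0 <= 1 - mismatch om / 2.
    by rewrite subr_ge0 ler_pdivrMr // mul1r (le_trans mismatch_le1) // ler1n.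
  apply: le_trans h _; rewrite exprM; apply: lerXn2r; rewrite ?nnegrE;
    [exact: exprn_ge0|by rewrite invr_ge0 exprn_ge0|].
  apply: (@le_trans _ _ (expR (- (8 / c%:R)) ^+ c)).
    apply: lerXn2r; rewrite ?nnegrE ?expR_ge0 //.
    apply: le_trans (expR_ge1Dx _); rewrite lerD2l lerN2 ler_pdivlMr //.
    by apply: le_trans hf; rewrite le_eqVlt; apply/orP; left; apply/eqP; field; rewrite gt_eqF.
  rewrite -expRM_natl mulrN mulrC divfK ?gt_eqF // expRN lef_pV2 ?posrE ?expR_gt0 ?exprn_gt0 //.
  rewrite -[8]mulr1 expRM_natl; apply: lerXn2r; rewrite ?nnegrE ?expR_ge0 ?ler0n //.
  by have := expR_ge1Dx (1 : R); rewrite -(natrD _ 1 1).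
have p4 : 0 < 4 ^+ w :> R by rewrite exprn_gt0.
rewrite ler_pdivlMr //.
have e1 : 2^-1 ^+ (4 * w) = ((4 ^+ w) * (4 ^+ w))^-1 :> R.
  by rewrite exprVn exprM (_ : 2 ^+ 4 = 4 * 4) ?exprMn //; ring.
have e2 : (2 ^- 8) ^+ w = ((4 ^+ w * 4 ^+ w) * (4 ^+ w * 4 ^+ w))^-1 :> R.
  by rewrite exprVn (_ : 2 ^+ 8 = (4 * 4) * (4 * 4)) ?exprMn //; ring.
move: h; rewrite e1 e2 [X in _ <= X]invfM ler_pM2l ?invr_gt0 ?mulr_gt0 // => h.
have p1 : 1 <= 4 ^+ w :> R by rewrite exprn_ege1 // ler1n.
apply: (@le_trans _ _ ((4 ^+ w * 4 ^+ w)^-1 * 4 ^+ w)); first by rewrite ler_pM2r.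
rewrite invfM -mulrA mulVf ?gt_eqF // mulr1.
by apply: (@le_trans _ _ 1); [rewrite invf_le1|rewrite ler1n].
Qed.

End State.

Section BellMismatch.
Variables (k : nat) (om : op R (qubits k * qubits k)).
Hypothesis hom : density om.

Lemma match_prob : 1 - mismatch om = complex.Re (\sum_f bell_weight 0 f om).
Proof.
rewrite -(sum_diag_equal hom) big_mkcond sum_pair sum_bell_weight_phase raddf_sum /=.
apply: eq_bigr => z _; rewrite addr0 (bigD1 z) //= /unequal eqxx big1 ?addr0 // => w /negPf.
by rewrite /= eq_sym => ->.
Qed.

Lemma density_hadamard2 : density (hadamard2 om).
Proof.
have hc := @channel_hadamard R k; split; first exact: channel_psd hc hom.1.
by rewrite (channel_tr om hc) hom.2.
Qed.

End BellMismatch.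

Lemma mismatch_le k (om : op R (qubits k * qubits k)) : density om ->
  mismatch om <= 1 - fidelity om.
Proof.
move=> hom; rewrite lerBrDl addrC -lerBrDl (match_prob hom); apply: leC_Re.
rewrite (bigD1 (0 : qubits k)) //= lerDl; apply: sumr_ge0 => f _.
by apply: bell_weight_ge0; exact: hom.1.
Qed.

Lemma mismatch_hadamard_le k (om : op R (qubits k * qubits k)) : density om ->
  mismatch (hadamard2 om) <= 1 - fidelity om.
Proof.
move=> hom; apply: le_trans (mismatch_le (density_hadamard2 hom)) _.
by rewrite /fidelity bell_weight_hadamard.
Qed.

(* A weight other than (0, 0) has a nonzero bit part or a nonzero phase part. *)
Lemma infidelity_le_mismatch k (om : op R (qubits k * qubits k)) : density om ->
  1 - fidelity om <= mismatch om + mismatch (hadamard2 om).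
Proof.
move=> hom; have h1 := match_prob hom; have h2 := match_prob (density_hadamard2 hom).
have p0 e f : 0 <= bell_weight e f om by apply: bell_weight_ge0; exact: hom.1.
suff h3 : (\sum_f bell_weight 0 f om) + (\sum_f bell_weight 0 f (hadamard2 om)) <=
    1 + bell_weight 0 0 om.
  move: (leC_Re h3); rewrite !raddfD /= -h1 -h2 -/(fidelity om).
  by move: (mismatch om) (mismatch _) (fidelity om) => x y z; lra.
under [X in _ + X <= _]eq_bigr do rewrite bell_weight_hadamard.
rewrite -hom.2 -sum_bell_weight [X in _ <= X + _](bigD1 (0 : qubits k)) //= -addrA lerD2l.
rewrite [leLHS](bigD1 (0 : qubits k)) //= [leRHS]addrC lerD2l; apply: ler_sum => e _.
by rewrite (bigD1 (0 : qubits k)) //= lerDl; apply: sumr_ge0.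
Qed.

End BasisTest.

(** * Protocols on many copies *)

Section Protocols.
Variables (R : realType) (A B : finType).

Notation labelled n M Lam :=
  (@locc_instrument R 'I_M (fun x => qubits x) (fun x => qubits x) (pow A n) (pow B n) Lam).

(* An LOCC protocol on [n] copies, whose outcome [x < M] is the number of
   output qubits, with outcome probabilities [p] and subnormalized fidelities
   [w]. *)
Definition protocol n M (p w : op R (A * B) -> 'I_M -> R) : Prop :=
  exists2 Lam : forall x : 'I_M, op R (pow A n * pow B n) -> op R (qubits x * qubits x),
    labelled n M Lam &
    forall rho, density rho -> forall x,
      rtrace (Lam x (tensor_pow n rho)) = p rho x /\
      fidelity (Lam x (tensor_pow n rho)) = w rho x.

Arguments protocol n M p w : clear implicits.

Lemma protocol_bounds n M p w : protocol n M p w -> forall rho, density rho ->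
  (forall x, 0 <= w rho x <= p rho x) /\ \sum_x p rho x = 1.
Proof.
move=> [Lam hL hpw] rho hrho; have [hP hT] := density_tensor_pow n hrho; split=> [x|].
  have [<- <-] := hpw rho hrho x.
  have h : psd (Lam x (tensor_pow n rho)) by apply: (locc_psd hL).
  by rewrite fidelity_ge0 // fidelity_le_tr.
rewrite (eq_bigr (fun x => rtrace (Lam x (tensor_pow n rho)))) => [|x _]; last first.
  by have [] := hpw rho hrho x.
by rewrite /rtrace -raddf_sum (locc_tr hL) hT.
Qed.

Lemma fidelityD k (X Y : op R (qubits k * qubits k)) : fidelity (X + Y) = fidelity X + fidelity Y.
Proof.
rewrite /fidelity -raddfD; congr complex.Re.
have := bell_weight_sum 0 0 [:: X; Y] xpredT id.
by rewrite !big_cons !big_nil !addr0.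
Qed.

Lemma fidelityZ k (a : R) (X : op R (qubits k * qubits k)) : fidelity (a%:C *: X) = a * fidelity X.
Proof.
rewrite /fidelity -ReZ; congr complex.Re; rewrite /bell_weight mulrCA; congr (_ * _).
rewrite mulr_sumr; apply: eq_bigr => z _; rewrite mulr_sumr; apply: eq_bigr => w _.
by rewrite entryZ mulrCA.
Qed.

Lemma fidelity0 k : fidelity (0 : op R (qubits k * qubits k)) = 0.
Proof. by rewrite -(scale0r 0) (fidelityZ 0) mul0r. Qed.

Lemma protocol_run n M K (Lam : op R (pow A n * pow B n) -> op R (qubits K * qubits K)) :
  locc_channel Lam -> (K < M)%N ->
  protocol n M (fun _ x => (x == K :> nat)%:R)
    (fun rho x => (x == K :> nat)%:R * fidelity (Lam (tensor_pow n rho))).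
Proof.
move=> hL KM; pose x0 := Ordinal KM.
have [St hSt [St1 St0]] := @locc_stop_ex R 'I_M (fun x => qubits x) (fun x => qubits x) x0.
exists (fun x T => St x (Lam T)); first exact: locc_after hL hSt.
move=> rho hrho x; have [->|ne] := eqVneq x x0.
  rewrite St1 eqxx mul1r; split=> //.
  by rewrite /rtrace (channel_tr _ hL) (density_tensor_pow n hrho).2.
rewrite St0 // (_ : (x == K :> nat) = false); last exact: negbTE ne.
by rewrite mul0r fidelity0 /rtrace mxtrace0.
Qed.

Lemma channel_split m n :
  locc_channel (pull (R := R)
    (fun z : (pow A m * pow A n) * (pow B m * pow B n) => (join_pow z.1, join_pow z.2))).
Proof. exact: (channel_relabel _ (@join_pow_bij A m n) (@join_pow_bij B m n)). Qed.

(** The [T * m] measured copies are independent of the other [n], so verdict and continuation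
    factorize: probabilities and subnormalized fidelities are mixed with the same weight [g]. *)
Lemma protocol_gate k m (Lam : op R (pow A m * pow B m) -> op R (qubits k * qubits k)) T t n M p1 w1 p0 w0 :
  locc_channel Lam -> protocol n M p1 w1 -> protocol n M p0 w0 ->
  let g rho := pass_prob T t (Lam (tensor_pow m rho)) in
  protocol (T * m + n) M
    (fun rho x => g rho * p1 rho x + (1 - g rho) * p0 rho x)
    (fun rho x => g rho * w1 rho x + (1 - g rho) * w0 rho x).
Proof.
move=> hL [G1 hG1 G1E] [G0 hG0 G0E] g.
pose P (a b : pow (qubits k) T) := (#|[set i | a i != b i]| <= t)%N.
have [Te hTe TeE] := locc_test P hG1 hG0.
have [Lp hLp LpE] := channel_pow T hL.
have [Ls hLs LsE] := channel_tensor (pow A n) (pow B n) hLp.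
exists (fun x => Te x \o Ls \o pull (fun z => (join_pow z.1, join_pow z.2))).
  exact: (locc_after (channel_split _ _) (locc_after hLs hTe)).
move=> rho hrho x /=; rewrite tensor_pow_join LsE LpE TeE.
set om := Lam (tensor_pow m rho).
have hom : density om.
  have [h1 h2] := density_tensor_pow m hrho.
  by split; [exact: channel_psd hL h1|rewrite (channel_tr _ hL)].
have gE : \sum_(z | P z.1 z.2) entry (tensor_pow T om) z z = (g rho)%:C.
  rewrite big_mkcond sum_pair.
  rewrite (sum_pow_pair (fun a b => if P a b then entry (tensor_pow T om) (a, b) (a, b) else 0)) /=.
  rewrite /g /pass_prob rmorph_sum [RHS]big_mkcond; apply: eq_bigr => u _ /=.
  rewrite (_ : P _ _ = (hits (@unequal _) u <= t)%N); last first.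
    by rewrite /P /hits; congr (_ <= _)%N; apply: eq_card => i; rewrite !inE !ffunE.
  case: ifP => // _; rewrite rmorph_prod entry_mkop; apply: eq_bigr => i _.
  by rewrite !ffunE -surjective_pairing entry_diag.
have gE' : \sum_(z | ~~ P z.1 z.2) entry (tensor_pow T om) z z = (1 - g rho)%:C.
  rewrite rmorphB rmorph1 /= -gE -(density_tensor_pow T hom).2 tr_entry.
  by rewrite [X in _ = X - _](bigID (fun z => P z.1 z.2)) /= addrAC subrr add0r.
rewrite gE gE' rtraceD fidelityD !rtraceZ !fidelityZ.
by have [-> ->] := G1E rho hrho x; have [-> ->] := G0E rho hrho x.
Qed.

(** The [r] extra copies, a remainder modulo the block length, are discarded. *)
Lemma channel_blocks k m N r K (Lam : op R (pow A m * pow B m) -> op R (qubits k * qubits k))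
    (Co : op R (pow (qubits k) N * pow (qubits k) N) -> op R (qubits K * qubits K)) :
  locc_channel Lam -> locc_channel Co ->
  exists2 Ru : op R (pow A (r + N * m) * pow B (r + N * m)) -> op R (qubits K * qubits K),
    locc_channel Ru & forall rho, density rho ->
      Ru (tensor_pow (r + N * m) rho) = Co (tensor_pow N (Lam (tensor_pow m rho))).
Proof.
move=> hL hC; have [Lp hLp LpE] := channel_pow N hL.
have [D hD DE] := channel_discard R (pow A (N * m)) (pow B (N * m)) (pow A r) (pow B r).
exists (Co \o Lp \o D \o pull (fun z => (join_pow z.1, join_pow z.2))).
  apply: channel_comp (channel_split _ _) _; apply: channel_comp hD _.
  exact: channel_comp hLp hC.
move=> rho hrho /=; rewrite tensor_pow_join DE (density_tensor_pow r hrho).2 scale1r.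
by rewrite LpE.
Qed.

End Protocols.

Arguments protocol {R A B} n M p w.

(** * Choosing among finitely many candidates *)

Section Selection.
Variables (R : realType) (A B : finType).

(* A candidate maps blocks of [cand_len] copies to [cand_out] qubits; a fraction
   [cand_loss] of the output is reserved for error correction. *)
Record candidate := Candidate {
  cand_len : nat;
  cand_len_gt0 : (0 < cand_len)%N;
  cand_out : nat;
  cand_loss : R;
  cand_loss_gt0 : 0 < cand_loss;
  cand_map : op R (pow A cand_len * pow B cand_len) ->
             op R (qubits cand_out * qubits cand_out);
  cand_locc : locc_channel cand_map }.

Arguments cand_map : clear implicits.

(** Extracted by choice as a function of the loss alone, so that candidates with equal loss share a
    tolerance whatever their block length. The value 1 is a dummy for [mu <= 0]. *)
Definition code_tol (mu : R) : nat :=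
  if pselect (0 < mu) is left mu0 then s2val (cid2 (code_rate mu0)) else 1.

Definition cand_tol (c : candidate) : nat := code_tol (cand_loss c).

Lemma code_tol_gt0 mu : (0 < code_tol mu)%N.
Proof. by rewrite /code_tol; case: pselect => // h; exact: s2valP (cid2 (code_rate h)). Qed.

Lemma cand_tol_gt0 c : (0 < cand_tol c)%N.
Proof. exact: code_tol_gt0. Qed.

Definition cand_rate (c : candidate) : R :=
  ((cand_out c)%:R - cand_loss c * (cand_out c).+1%:R) / (cand_len c)%:R.

Definition cand_state c (rho : op R (A * B)) := cand_map c (tensor_pow (cand_len c) rho).

(** With C the tolerance constant, 32 leaves room for the tests: a good candidate has disagreement
    rates at most 1/(32 C), rates from 16/(32 C) = 1/(2 C) on are rejected, and two rates below that
    keep the infidelity within 1/C. *)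
Definition good (c : candidate) (rho : op R (A * B)) : Prop :=
  1 - fidelity (cand_state c rho) <= (32 * cand_tol c)%:R^-1.

Lemma density_cand_state c rho : density rho -> density (cand_state c rho).
Proof.
move=> hrho; have [h1 h2] := density_tensor_pow (cand_len c) hrho.
by split; [exact: channel_psd (cand_locc c) h1|rewrite (channel_tr _ (cand_locc c))].
Qed.

(** The surplus [r] and the label bound [M] are quantified after [K]: when candidates are combined,
    all branches must share one label set and use up the given number of copies. *)
Lemma cand_run c (eta : R) : 0 < eta -> exists N0, forall N, (N0 <= N)%N ->
  exists2 K : nat, cand_rate c * (N * cand_len c)%:R <= K%:R &
  forall r M, (K < M)%N -> exists2 f : op R (A * B) -> R,
    protocol (r + N * cand_len c) M (fun _ x => (x == K :> nat)%:R)
      (fun rho x => (x == K :> nat)%:R * f rho) &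
    forall rho, density rho -> 0 <= f rho <= 1 /\
      (1 - fidelity (cand_state c rho) <= (cand_tol c)%:R^-1 -> 1 - f rho <= eta).
Proof.
move=> eta0; have [N0 hN0] : exists N0, forall N, (N0 <= N)%N ->
    exists2 K, ((cand_out c)%:R - cand_loss c * (cand_out c).+1%:R) * N%:R <= K%:R :> R &
    exists2 Lam : op R (pow (qubits (cand_out c)) N * pow (qubits (cand_out c)) N) ->
        op R (qubits K * qubits K),
      locc_channel Lam & forall om, density om -> 1 - fidelity om <= (cand_tol c)%:R^-1 ->
        1 - fidelity (Lam (tensor_pow N om)) <= eta.
  rewrite /cand_tol /code_tol; case: pselect => [h|]; last by rewrite cand_loss_gt0.
  exact: (s2valP' (cid2 (code_rate h))).
exists N0 => N /hN0[K hK [Co hCo CoE]]; exists K.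
  rewrite /cand_rate natrM [N%:R * _]mulrC mulrA divfK //.
  by rewrite pnatr_eq0 -lt0n cand_len_gt0.
move=> r M KM; have [Ru hRu RuE] := channel_blocks r (cand_locc c) hCo.
exists (fun rho => fidelity (Ru (tensor_pow (r + N * cand_len c) rho))).
  exact: protocol_run hRu KM.
move=> rho hrho; have [h1 h2] := density_tensor_pow (r + N * cand_len c) hrho.
have hRd : density (Ru (tensor_pow (r + N * cand_len c) rho)).
  by split; [exact: channel_psd hRu h1|rewrite (channel_tr _ hRu)].
rewrite fidelity_ge0 ?fidelity_le1 //; last exact: hRd.1.
split=> // F; rewrite RuE //; apply: CoE => //; exact: density_cand_state.
Qed.

Lemma protocol_trash n M : (0 < M)%N ->
  protocol n M (fun (_ : op R (A * B)) x => (x == 0 :> nat)%:R) (fun _ x => (x == 0 :> nat)%:R).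
Proof.
move=> M0; have [Tr hTr TrE] := channel_trash R (pow A n) (pow B n).
have [Lam hL LE] := protocol_run hTr M0; exists Lam => // rho hrho x.
have [-> ->] := LE rho hrho x; rewrite TrE /rtrace (density_tensor_pow n hrho).2.
by rewrite mulr1.
Qed.

Fact mix_le (g a b e : R) : 0 <= g <= 1 -> a <= e -> b <= e -> g * a + (1 - g) * b <= e.
Proof.
move=> /andP[g0 g1] ae be; have -> : e = g * e + (1 - g) * e by ring.
by rewrite lerD ?ler_wpM2l ?subr_ge0.
Qed.

Fact mix_small (g a b e e' : R) : 0 <= g <= 1 -> g <= e' -> a <= 1 -> b <= e -> 0 <= e ->
  g * a + (1 - g) * b <= e' + e.
Proof.
move=> /andP[g0 g1] ge a1 be e0; apply: lerD.
  by apply: le_trans ge; rewrite -[leRHS]mulr1 ler_wpM2l.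
apply: (@le_trans _ _ ((1 - g) * e)); first by rewrite ler_wpM2l ?subr_ge0.
by rewrite -[leRHS]mul1r ler_wpM2r // gerBl.
Qed.

Fact mix_large (g a b e e' : R) : 0 <= g <= 1 -> 1 - g <= e' -> b <= 1 -> a <= e -> 0 <= e ->
  g * a + (1 - g) * b <= e' + e.
Proof.
move=> /andP[g0 g1] ge b1 ae e0; rewrite addrC.
have := @mix_small (1 - g) b a e e'; rewrite subKr; apply => //.
by rewrite subr_ge0 g1 gerBl.
Qed.

Fact sixth_third (x : R) : 0 < x -> x / 6 + (x / 6 + x / 3) <= x.
Proof. lra. Qed.

Fact third_le (x : R) : 0 < x -> x / 3 <= x.
Proof. lra. Qed.

Fact big_mismatch (C : nat) (F x y : R) : (0 < C)%N -> C%:R^-1 < F -> F <= x + y ->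
  x < 16 / (32 * C)%:R -> 16 / (32 * C)%:R <= y.
Proof.
move=> C0; have -> : 16 / (32 * C)%:R = C%:R^-1 / 2 :> R.
  by rewrite natrM; field; rewrite pnatr_eq0 -lt0n C0.
move: (C%:R^-1 : R) => z; lra.
Qed.

Variable cand : nat -> candidate.

Definition guarantee (L : seq nat) (eta delta : R) n M (p w : op R (A * B) -> 'I_M -> R) :=
  forall rho, density rho ->
    \sum_x (p rho x - w rho x) <= eta /\
    forall j, j \in L -> good (cand j) rho ->
      \sum_(x : 'I_M | x%:R < (cand_rate (cand j) - delta) * n%:R) p rho x <= eta.

(** Tests consume [a] copies, at most [amax]. Once [n] is large against [amax], the rate lost to
    them is at most [delta / 2]. *)
Lemma gate_length (rate bnd delta : R) (n n' a amax : nat) : (n = a + n')%N -> (a <= amax)%N ->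
  rate <= bnd -> 0 <= bnd -> 0 < delta -> (Num.truncn (2 * bnd * amax%:R / delta) < n)%N ->
  (rate - delta) * n%:R <= (rate - delta / 2) * n'%:R.
Proof.
move=> nE am rb b0 d0 hn; have : 2 * bnd * amax%:R / delta < n%:R.
  by apply: lt_le_trans (truncnS_gt _) _; rewrite ler_nat.
rewrite ltr_pdivrMr // => h.
have h1 : rate * a%:R <= bnd * amax%:R.
  by apply: (@le_trans _ _ (bnd * a%:R)); rewrite ?ler_wpM2r ?ler_wpM2l ?ler_nat.
have h2 : 0 <= delta * a%:R by rewrite mulr_ge0 // ltW.
have h3 : (n%:R : R) = a%:R + n'%:R by rewrite nE natrD.
move: h h1 h2; rewrite -mulrA; move: (bnd * amax%:R) => z; rewrite h3 => h h1 h2.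
by rewrite -subr_ge0; lra.
Qed.

(** Induction along the list. The head is tested in both bases and run if it passes twice. The tail
    takes over after the first or the second test, so the induction hypothesis is needed at two
    different lengths. *)
Lemma select_list (L : seq nat) :
  sorted (fun i j => cand_rate (cand j) <= cand_rate (cand i)) L ->
  forall delta eta : R, 0 < delta -> 0 < eta ->
  exists n0, forall n, (n0 <= n)%N -> exists M0, forall M, (M0 <= M)%N ->
  exists p w, protocol n M p w /\ guarantee L eta delta n p w.
Proof.
elim: L => [|j L IH] sL delta eta d0 e0.
  exists 0%N => n _; exists 1%N => M M1.
  exists (fun _ x => (x == 0 :> nat)%:R), (fun _ x => (x == 0 :> nat)%:R).
  split; first exact: protocol_trash.
  move=> rho _; split=> [|j]; last by rewrite in_nil.
  by rewrite big1 ?ltW // => x _; rewrite subrr.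
have sL' : sorted (fun i j => cand_rate (cand j) <= cand_rate (cand i)) L := path_sorted sL.
have minL i : i \in L -> cand_rate (cand i) <= cand_rate (cand j).
  move=> iL; have tr : transitive (fun i j => cand_rate (cand j) <= cand_rate (cand i)).
    by move=> y x z h1 h2; exact: le_trans h2 h1.
  by have /allP := order_path_min tr sL; exact.
(* Half of the rate slack pays for the test copies. The error budget is [eta / 6] for each test and
   [eta / 3] for the branch then followed. *)
have [||n0 hn0] := IH sL' (delta / 2) (eta / 3); [by rewrite divr_gt0|by rewrite divr_gt0|].
set c := cand j in minL.
have e3 : 0 < eta / 3 by rewrite divr_gt0.
have [N0 hN0] := cand_run c e3.
pose m := cand_len c; pose rt := cand_rate c.
have [v hv] : exists v, 4 / 4 ^+ v <= eta / 6.
  exists (Num.truncn (24 / eta)).+1; rewrite ler_pdivrMr ?exprn_gt0 //.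
  set v := (Num.truncn (24 / eta)).+1; have h : 24 / eta < v%:R by exact: truncnS_gt.
  rewrite ltr_pdivrMr // in h.
  have h' : v%:R <= 4 ^+ v :> R by rewrite -natrX ler_nat ltnW // ltn_expl.
  have h'' : eta * v%:R <= eta * 4 ^+ v by rewrite ler_pM2l.
  by move: (v%:R : R) (4 ^+ v : R) h h' h'' => x y; lra.
(* Trial count of the pass lemmas for the constant [32 * cand_tol c] and [w := v], where [v] makes a
   wrong verdict cost at most [eta / 6]. *)
pose T := (32 * cand_tol c * v)%N; pose a := (T * m)%N.
exists (maxn (a + (a + (n0 + N0 * m))) (Num.truncn (2 * `|rt| * (a + (a + m))%:R / delta)).+1).
move=> n; rewrite geq_max => /andP[n_ge n_gt].
have m0 : (0 < m)%N by exact: cand_len_gt0.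
(* Two tests of length [a], then whole blocks for the candidate and a remainder. *)
have [N [r [nE rm]]] : exists N r, n = (a + (a + (r + N * m)))%N /\ (r < m)%N.
  exists ((n - (a + a)) %/ m)%N, ((n - (a + a)) %% m)%N; rewrite ltn_mod m0; split=> //.
  by rewrite [X in (_ + (_ + X))%N]addnC -divn_eq; lia.
have N_ge : (N0 <= N)%N.
  rewrite leqNgt; apply/negP => lt; have : ((N.+1) * m <= N0 * m)%N by rewrite leq_mul2r lt orbT.
  by move: n_ge; rewrite nE mulSn; lia.
have [K hK hrun] := hN0 N N_ge.
have [|M2 hM2] := hn0 (r + N * m)%N; first by move: n_ge; rewrite nE; lia.
have [|M1 hM1] := hn0 (a + (r + N * m))%N; first by move: n_ge; rewrite nE; lia.
exists (maxn K.+1 (maxn M1 M2)) => M; rewrite !geq_max => /and3P[KM M1M M2M].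
have [f run_p run_f] := hrun r M KM.
have [p2 [w2 [prot2 guar2]]] := hM2 M M2M.
have [p1 [w1 [prot1 guar1]]] := hM1 M M1M.
have hH : locc_channel ((@hadamard2 R _) \o cand_map c).
  by apply: channel_comp (cand_locc c) _; exact: channel_hadamard.
have inner := protocol_gate T (4 * v) hH run_p prot2.
have outer := protocol_gate T (4 * v) (cand_locc c) inner prot1.
rewrite -/m -/a -nE in outer.
eexists; eexists; split; first exact: outer.
move=> rho hrho /=.
have dom := density_cand_state c hrho.
rewrite -/(cand_state c rho).
set g := pass_prob T _ (cand_state c rho).
set g' := pass_prob T _ (hadamard2 (cand_state c rho)).
have gb : 0 <= g <= 1 by rewrite pass_prob_ge0 ?pass_prob_le1.
have gb' : 0 <= g' <= 1.
  by rewrite pass_prob_ge0 ?pass_prob_le1 //; exact: density_hadamard2.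
have [f01 fgood] := run_f rho hrho.
have [G1 G1'] := guar1 rho hrho; have [G2 G2'] := guar2 rho hrho.
have [B1 S1] := protocol_bounds prot1 hrho; have [B2 S2] := protocol_bounds prot2 hrho.
pose xK := Ordinal KM.
have sumK (F : 'I_M -> R) (P : pred 'I_M) : \sum_(x | P x) (x == K :> nat)%:R * F x = (P xK)%:R * F xK.
  rewrite big_mkcond (bigD1 xK) //= eqxx mul1r big1 ?addr0; first by case: (P xK); rewrite ?mul1r ?mul0r.
  by move=> x xK'; rewrite (_ : (x == K :> nat) = false) ?mul0r ?if_same //; exact: negbTE.
have e3_0 : 0 <= eta / 3 := ltW e3.
have e66 := sixth_third e0; have e33 := third_le e0.
have e6_0 : 0 <= eta / 6 by rewrite divr_ge0 // ltW.
have e6 : eta / 6 + eta / 3 <= eta by apply: le_trans e66; rewrite lerDr.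
have tol16 : (16 <= 32 * cand_tol c)%N.
  by rewrite (leq_trans (n := 32)) // leq_pmulr // cand_tol_gt0.
have tol0 : (0 < 32 * cand_tol c)%N by rewrite muln_gt0 cand_tol_gt0.
split.
- rewrite (_ : \sum_x _ = g * (g' * (1 - f rho) + (1 - g') * \sum_x (p2 rho x - w2 rho x)) +
     (1 - g) * \sum_x (p1 rho x - w1 rho x)); last first.
    rewrite -[1 - f rho](mul1r) -(sumK (fun=> 1 - f rho) xpredT) !mulr_sumr -big_split mulr_sumr -big_split.
    by apply: eq_bigr => x _ /=; ring.
  (* Within the tolerance every branch has small error, whatever the tests say. Beyond it one of the
     two disagreement rates is too large, and that test is passed with probability at most
     [eta / 6]. *)
  have [F|F] := leP (1 - fidelity (cand_state c rho)) (cand_tol c)%:R^-1.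
    exact: le_trans (mix_le gb (mix_le gb' (fgood F) G2) G1) e33.
  have F1 : 1 - f rho <= 1 by rewrite gerBl; case/andP: f01.
  have mm := infidelity_le_mismatch dom.
  have [h|h] := leP (16 / (32 * cand_tol c)%:R) (mismatch (cand_state c rho)).
    have gs : g <= eta / 6 by apply: le_trans hv; exact: (pass_prob_sound dom v tol16 h).
    apply: le_trans e6; apply: mix_small => //; apply: (mix_le gb' F1).
    rewrite -S2 ler_sum // => x _; rewrite gerBl.
    by have /andP[] := B2 x.
  have h' := big_mismatch (cand_tol_gt0 c) F mm h.
  have gs : g' <= eta / 6.
    by apply: le_trans hv; exact: (pass_prob_sound (density_hadamard2 dom) v tol16 h').
  apply: (@le_trans _ _ (eta / 6 + eta / 3)) => //; apply: (mix_le gb).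
    exact: mix_small.
  by apply: le_trans G1 _; rewrite lerDr.
- move=> i iL hi; set th := _ * n%:R.
  pose Q2 := \sum_(x : 'I_M | x%:R < th) p2 rho x.
  pose Q1 := \sum_(x : 'I_M | x%:R < th) p1 rho x.
  rewrite (_ : \sum_(x | _) _ = g * (g' * (K%:R < th)%R%:R + (1 - g') * Q2) +
     (1 - g) * Q1); last first.
    rewrite -[(K%:R < th)%R%:R](mulr1) -(sumK (fun=> 1) (fun x : 'I_M => x%:R < th)).
    rewrite !mulr_sumr -big_split mulr_sumr -big_split.
    by apply: eq_bigr => x _ /=; ring.
  have rt_i : cand_rate (cand i) <= `|rt|.
    apply: (@le_trans _ _ rt); last exact: ler_norm.
    by move: iL; rewrite inE => /orP[/eqP->//|]; exact: minL.
  have rate_i : cand_rate (cand i) <= rt.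
    by move: iL; rewrite inE => /orP[/eqP->//|]; exact: minL.
  have trunc_gt x n' : (n = x + n')%N -> (x <= a + (a + m))%N -> th <= (cand_rate (cand i) - delta / 2) * n'%:R.
    by move=> h1 h2; exact: gate_length h1 h2 rt_i (normr_ge0 _) d0 n_gt.
  (* The head has the largest rate, so running it meets the rate demanded by any candidate of the
     list. *)
  have -> : (K%:R < th) = false.
    apply/negbTE; rewrite -leNgt; apply: le_trans hK.
    apply: le_trans (trunc_gt (a + (a + r))%N (N * m)%N _ _) _.
    - by rewrite nE !addnA.
    - by rewrite !leq_add2l ltnW.
    rewrite ler_wpM2r ?ler0n //; apply: le_trans rate_i.
    by rewrite gerBl divr_ge0 // ltW.
  have sub_th (p : 'I_M -> R) th' : (forall x, 0 <= p x) -> th <= th' ->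
      \sum_(x : 'I_M | x%:R < th) p x <= \sum_(x : 'I_M | x%:R < th') p x.
    move=> p_ge0 le; rewrite big_mkcond [leRHS]big_mkcond; apply: ler_sum => x _.
    by case: ifP => [h|_]; [rewrite (lt_le_trans h le)|case: ifP].
  have p1_ge0 x : 0 <= p1 rho x by have /andP[h1 h2] := B1 x; exact: le_trans h2.
  have p2_ge0 x : 0 <= p2 rho x by have /andP[h1 h2] := B2 x; exact: le_trans h2.
  (* If the good candidate is the head, both tests pass with high probability; if it is in the tail,
     the induction hypothesis covers each branch that does not run the head. *)
  rewrite mulr0; have [iE|ij] := eqVneq i j.
    have Q_le1 (p : 'I_M -> R) : (forall x, 0 <= p x) -> \sum_x p x = 1 -> \sum_(x : 'I_M | x%:R < th) p x <= 1.
      move=> p_ge0 p_1; apply: (@le_trans _ _ (\sum_x p x)); last by rewrite p_1.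
      by rewrite [leRHS](bigID (fun x : 'I_M => x%:R < th)) /= lerDl sumr_ge0.
    rewrite iE in hi; have hi' := le_trans (mismatch_le dom) hi.
    have hi'' := le_trans (mismatch_hadamard_le dom) hi.
    have gs := le_trans (pass_prob_complete dom v tol0 hi') hv.
    have gs' := le_trans (pass_prob_complete (density_hadamard2 dom) v tol0 hi'') hv.
    apply: le_trans e66; apply: mix_large => //; [exact: Q_le1| |exact: addr_ge0].
    by rewrite -[0](mulr0 g'); apply: mix_large => //; exact: Q_le1.
  have iL' : i \in L by move: iL; rewrite inE (negPf ij).
  apply: le_trans e33; apply: (mix_le gb); last first.
    apply: le_trans (G1' i iL' hi); apply: sub_th => //.
    by apply: (trunc_gt a) => //; exact: leq_addr.
  rewrite -[0](mulr0 g'); apply: (mix_le gb') => //.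
  apply: le_trans (G2' i iL' hi); apply: sub_th => //.
  by apply: (trunc_gt (a + a)%N); rewrite ?nE ?addnA // leq_addr.
Qed.

End Selection.

(** * A countable dense family of candidates *)

Section Density.
Variables (R : realType) (A B : finType).

Definition unit_op (I : finType) (i j : I) : op R I :=
  mkop (fun x y => ((x == i) && (y == j))%:R).

Lemma op_sum_unit (I : finType) (X : op R I) :
  X = \sum_i \sum_j entry X i j *: unit_op i j.
Proof.
apply: opP => x y; rewrite entry_sum (sum_delta (i0 := x)) => [|i /negPf ix]; last first.
  by rewrite entry_sum big1 // => j _; rewrite entryZ entry_mkop eq_sym ix mulr0.
rewrite entry_sum (sum_delta (i0 := y)) => [|j /negPf jy]; last first.
  by rewrite entryZ entry_mkop [y == j]eq_sym jy andbF mulr0.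
by rewrite entryZ entry_mkop !eqxx mulr1.
Qed.

Section Coefficients.
Variables (m k : nat).
Notation block := (pow A m * pow B m)%type.
Implicit Types Lam : op R block -> op R (qubits k * qubits k).

Definition fid_coef Lam (z : block * block) : R[i] := bell_weight 0 0 (Lam (unit_op z.1 z.2)).

Lemma bell_weightZ (a : R[i]) (Y : op R (qubits k * qubits k)) :
  bell_weight 0 0 (a *: Y) = a * bell_weight 0 0 Y.
Proof.
rewrite /bell_weight mulrCA; congr (_ * _).
rewrite mulr_sumr; apply: eq_bigr => z _; rewrite mulr_sumr; apply: eq_bigr => w _.
by rewrite entryZ mulrCA.
Qed.

Lemma fidelity_coef Lam X : locc_channel Lam ->
  fidelity (Lam X) = \sum_z (complex.Re (entry X z.1 z.2) * complex.Re (fid_coef Lam z)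
                            - complex.Im (entry X z.1 z.2) * complex.Im (fid_coef Lam z)).
Proof.
move=> hL; rewrite {1}(op_sum_unit X) /fidelity.
have sumL (T : finType) (F : T -> op R block) : Lam (\sum_t F t) = \sum_t Lam (F t).
  exact: (locc_sum hL tt).
have scL a (Y : op R block) : Lam (a *: Y) = a *: Lam Y by exact: (locc_scale hL tt).
rewrite sumL bell_weight_sum raddf_sum [RHS]sum_pair; apply: eq_bigr => i _ /=.
rewrite sumL bell_weight_sum raddf_sum; apply: eq_bigr => j _ /=.
rewrite scL bell_weightZ -[bell_weight _ _ _]/(fid_coef Lam (i, j)).
by case: (entry X i j) (fid_coef Lam (i, j)) => a b [c d].
Qed.

(** Rounded functionals live in a countable type and so sort the protocols into countably many
    cells; within a cell the real and imaginary parts of a coefficient vary by at most the mesh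
    [l.+1%:R^-1]. *)
Definition grid (l : nat) Lam : {ffun block * block -> int * int} :=
  [ffun z => (Num.floor (l.+1%:R * complex.Re (fid_coef Lam z)),
              Num.floor (l.+1%:R * complex.Im (fid_coef Lam z)))].

Lemma floor_close (l : nat) (x y : R) :
  Num.floor (l.+1%:R * x) = Num.floor (l.+1%:R * y) -> `|x - y| <= l.+1%:R^-1.
Proof.
move=> e; have l0 : 0 < l.+1%:R :> R by rewrite ltr0n.
rewrite -(ler_pM2l l0) divff ?gt_eqF // -{1}[l.+1%:R]ger0_norm ?ler0n // -normrM mulrBr.
have hx := floor_le (l.+1%:R * x); have hx' := floorD1_gt (l.+1%:R * x).
have hy := floor_le (l.+1%:R * y); have hy' := floorD1_gt (l.+1%:R * y).
rewrite e in hx hx'; move: hx hx' hy hy'; rewrite intrD rmorph1.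
move: ((Num.floor (l.+1%:R * y))%:~R : R) (l.+1%:R * x) (l.+1%:R * y) => c u v h1 h2 h3 h4.
by rewrite ler_norml; apply/andP; split; lra.
Qed.

Lemma grid_close l Lam Lam' X : locc_channel Lam -> locc_channel Lam' ->
  grid l Lam = grid l Lam' ->
  fidelity (Lam X) - fidelity (Lam' X) <=
  (\sum_(z : block * block) (`|complex.Re (entry X z.1 z.2)| + `|complex.Im (entry X z.1 z.2)|)) / l.+1%:R.
Proof.
move=> hL hL' e; rewrite (fidelity_coef X hL) (fidelity_coef X hL') -sumrB mulr_suml.
apply: ler_sum => z _; have := congr1 (fun f : {ffun block * block -> int * int} => f z) e.
rewrite !ffunE => -[/floor_close e1 /floor_close e2].
move: (complex.Re (entry X _ _)) (complex.Im (entry X _ _)) => a b.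
move: (complex.Re (fid_coef Lam z)) (complex.Re (fid_coef Lam' z)) e1 => c c' e1.
move: (complex.Im (fid_coef Lam z)) (complex.Im (fid_coef Lam' z)) e2 => d d' e2.
have -> : a * c - b * d - (a * c' - b * d') = a * (c - c') - b * (d - d') by ring.
apply: le_trans (ler_norm _) _; apply: le_trans (ler_normB _ _) _.
by rewrite !normrM mulrDl lerD // ler_wpM2l.
Qed.

End Coefficients.

Lemma trash_candidate : exists c : candidate R A B, cand_out c = 0%N.
Proof.
have [Lam hL _] := channel_trash R (pow A 1) (pow B 1).
by exists (@Candidate R A B 1 isT 0 1 ltr01 Lam hL).
Qed.

Lemma inv_succ_gt0 (u : nat) : 0 < u.+1%:R^-1 :> R.
Proof. by rewrite invr_gt0 ltr0n. Qed.

(** An index encodes block length, output size, code loss, mesh and cell, and choice picks one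
    protocol in each inhabited cell. [c0] fills the indices that decode to nothing or to an empty
    cell. *)
Lemma dense_candidates : exists cand : nat -> candidate R A B,
  forall m k u (Lam : op R (pow A m.+1 * pow B m.+1) -> op R (qubits k * qubits k))
    (rho : op R (A * B)) (eps : R), locc_channel Lam -> 0 < eps ->
  exists j, [/\ cand_rate (cand j) = (k%:R - u.+1%:R^-1 * k.+1%:R) / m.+1%:R,
    cand_tol (cand j) = code_tol (u.+1%:R^-1 : R) &
    fidelity (Lam (tensor_pow m.+1 rho)) - fidelity (cand_state (cand j) rho) <= eps].
Proof.
have [c0 _] := trash_candidate.
pose P m k l code (Lam : op R (pow A m.+1 * pow B m.+1) -> op R (qubits k * qubits k)) :=
  locc_channel Lam /\ pickle (grid l Lam) = code.
pose cand n : candidate R A B :=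
  if unpickle n is Some (m, k, u, l, code) then
    if pselect (exists Lam, @P m k l code Lam) is left h then
      @Candidate R A B m.+1 isT k _ (inv_succ_gt0 u) (projT1 (cid h)) (projT2 (cid h)).1
    else c0
  else c0.
exists cand => m k u Lam rho eps hL eps0.
set X := tensor_pow m.+1 rho.
pose S := \sum_(z : (pow A m.+1 * pow B m.+1) * (pow A m.+1 * pow B m.+1))
  (`|complex.Re (entry X z.1 z.2)| + `|complex.Im (entry X z.1 z.2)|).
(* The mesh may depend on the state through [S], since it is part of the index. *)
pose l := Num.truncn (S / eps).
have Sl : S / l.+1%:R <= eps.
  have : S / eps < l.+1%:R by exact: truncnS_gt.
  by rewrite ltr_pdivrMr // ler_pdivrMr ?ltr0n // mulrC => /ltW.
exists (pickle (m, k, u, l, pickle (grid l Lam))).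
rewrite /cand pickleK; case: pselect => [h|]; last by case; exists Lam.
case: (cid h) => Lam' [hL' e]; split=> //; apply: le_trans Sl.
have e' : grid l Lam = grid l Lam' := pcan_inj pickleK (esym e).
exact: (grid_close X hL hL' e').
Qed.

End Density.

Local Open Scope classical_set_scope.
Local Open Scope complex_scope.
Local Open Scope ring_scope.

(** * Approaching the distillable entanglement; letting the list grow *)

Section Universal.
Variables (R : realType) (A B : finType).

Fact rate_arith (r d mu k m : R) : 0 < m -> 0 <= r -> 0 < mu -> mu * (r + 1) <= d / 2 -> 1 <= d / 2 * m ->
  1 <= m -> r * m - 1 <= k -> k <= r * m -> r - d <= (k - mu * (k + 1)) / m.
Proof.
move=> m0 r0 mu0 h1 h2 m1 k1 k2; rewrite ler_pdivlMr //.
have h3 : mu * (k + 1) <= mu * ((r + 1) * m).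
  by rewrite ler_pM2l // mulrDl mul1r lerD.
have h4 : mu * ((r + 1) * m) <= d / 2 * m by rewrite mulrA ler_pM2r.
lra.
Qed.

(** One large member of the distillation sequence is enough, since [good] asks for a fixed
    threshold. Half of the threshold covers the trace-norm error, half the passage to an enumerated
    protocol. *)
Lemma distillable_candidate (cand : nat -> candidate R A B) :
  (forall m k u (Lam : op R (pow A m.+1 * pow B m.+1) -> op R (qubits k * qubits k))
    (rho : op R (A * B)) (eps : R), locc_channel Lam -> 0 < eps ->
  exists j, [/\ cand_rate (cand j) = (k%:R - u.+1%:R^-1 * k.+1%:R) / m.+1%:R,
    cand_tol (cand j) = code_tol (u.+1%:R^-1 : R) &
    fidelity (Lam (tensor_pow m.+1 rho)) - fidelity (cand_state (cand j) rho) <= eps]) ->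
  forall (rho : op R (A * B)) (r d : R), distillable_rate rho r -> 0 < d ->
  exists2 j, good (cand j) rho & r - d <= cand_rate (cand j).
Proof.
move=> dense rho r d [r0 [Lam [hL cv]]] d0.
(* The code costs at most [mu * (r + 1)] in rate, which takes half of [d]. *)
pose u := Num.truncn ((r + 1) * 2 / d).
pose mu : R := u.+1%:R^-1.
have hmu : mu * (r + 1) <= d / 2.
  have : (r + 1) * 2 / d < u.+1%:R by exact: truncnS_gt.
  rewrite ltr_pdivrMr // => h; rewrite /mu mulrC ler_pdivrMr ?ltr0n //.
  by move: (u.+1%:R : R) h => x; lra.
pose tau : R := (32 * code_tol mu)%:R^-1.
have tau0 : 0 < tau by rewrite invr_gt0 ltr0n muln_gt0 code_tol_gt0.
have tau2 : 0 < tau / 2 by rewrite divr_gt0.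
move/cvgrPdist_le : cv => /(_ _ tau2)[N _ hN].
(* Rounding the number of output qubits costs at most [1 / m.+1] in rate, the other half of [d]. *)
pose m := maxn N (Num.truncn (2 / d)).
have hm := hN m.+1 (leqW (leq_maxl _ _)).
rewrite /= sub0r normrN ger0_norm ?trnorm_ge0 // in hm.
have [j [jr jt jf]] := dense m _ u (Lam m.+1) rho (tau / 2) (hL m.+1) tau2.
exists j.
  rewrite /good jt -/mu -/tau; have := fidelity_ge_trnorm (Lam m.+1 (tensor_pow m.+1 rho)).
  move: hm jf; move: (trnorm _) (fidelity _) (fidelity _) => x y z; lra.
have rm0 : 0 <= r * m.+1%:R by rewrite mulr_ge0 ?ler0n.
rewrite jr; set k := Num.truncn _; rewrite -[k.+1%:R]natr1; apply: rate_arith => //.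
- have : 2 / d < m.+1%:R.
    by apply: lt_le_trans (truncnS_gt _) _; rewrite ler_nat ltnS leq_maxr.
  by rewrite ltr_pdivrMr //; move: (m.+1%:R : R) => x; lra.
- by rewrite ler1n.
- by rewrite lerBlDr natr1 ltW // truncnS_gt.
- by rewrite truncn_le.
Qed.

Variable cand : nat -> candidate R A B.

Definition by_rate J : seq nat :=
  sort (fun i j => cand_rate (cand j) <= cand_rate (cand i)) (iota 0 J).

(** A diagonal argument: at length [n] the list length is the largest [J <= n] with [n0 J <= n], or
    0. [M 0 = 1] is demanded because at [n = 0] the rate is a division by 0, hence 0, and allows no
    output qubits. *)
Lemma universal_protocols (delta : R) : 0 < delta ->
  exists (M : nat -> nat) (p w : forall n, op R (A * B) -> 'I_(M n) -> R),
  [/\ M 0%N = 1%N, forall n, protocol n (M n) (p n) (w n) &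
    forall J : nat, exists n0, forall n, (n0 <= n)%N -> exists2 J', (J <= J')%N &
      guarantee cand (by_rate J') J'.+1%:R^-1 delta n (p n) (w n)].
Proof.
move=> d0.
have sb J : sorted (fun i j => cand_rate (cand j) <= cand_rate (cand i)) (by_rate J).
  by apply: sort_sorted => i j; exact: le_total.
pose n0 J := projT1 (cid (select_list (sb J) d0 (@inv_succ_gt0 R J))).
have hn0 J := projT2 (cid (select_list (sb J) d0 (@inv_succ_gt0 R J))).
pose data := {M : nat & ((op R (A * B) -> 'I_M -> R) * (op R (A * B) -> 'I_M -> R))%type}.
pose spec n (D : data) := let: existT M (p, w) := D in
  [/\ n = 0%N -> M = 1%N, protocol n M p w & exists2 J',
      guarantee cand (by_rate J') J'.+1%:R^-1 delta n p w &
      forall J, (J <= n)%N -> (0 < n)%N -> (n0 J <= n)%N -> (J <= J')%N].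
have step n : exists D, spec n D.
  have trash : exists M (p w : op R (A * B) -> 'I_M -> R),
    [/\ n = 0%N -> M = 1%N, protocol n M p w & guarantee cand (by_rate 0) 1%:R^-1 delta n p w].
    exists 1%N, (fun _ x => (x == 0 :> nat)%:R), (fun _ x => (x == 0 :> nat)%:R).
    split=> //; first exact: protocol_trash.
    move=> rho _; split=> [|j]; last by rewrite in_nil.
    by rewrite big1 ?invr_ge0 ?ler0n // => x _; rewrite subrr.
  have [M [p [w [M1 pr gu]]]] := trash.
  have [n_0|n_gt0] := posnP n.
    by exists (existT _ M (p, w)); split=> //; exists 0%N => // J _; rewrite n_0.
  pose P J := (J == 0%N) || ((n0 J <= n) && (J <= n))%N.
  have [J' PJ' maxJ'] : exists2 J', P J' & forall J, P J -> (J <= J')%N.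
    have h1 : exists J, P J by exists 0%N.
    have h2 J : P J -> (J <= n)%N by case/orP => [/eqP->//|/andP[]].
    by case: (ex_maxnP h1 h2) => J' h3 h4; exists J'.
  have hJ' J : (J <= n)%N -> (0 < n)%N -> (n0 J <= n)%N -> (J <= J')%N.
    by move=> h _ h'; apply: maxJ'; rewrite /P h h' orbT.
  have [J0|Jn0] := eqVneq J' 0%N.
    by exists (existT _ M (p, w)); split=> //; exists 0%N => // J h1 h2 h3; rewrite -J0; exact: hJ'.
  move: PJ'; rewrite /P (negPf Jn0) /= => /andP[le _].
  have [M0 hM0] := hn0 J' n le.
  have [p' [w' [pr' gu']]] := hM0 M0 (leqnn _).
  exists (existT _ M0 (p', w')); split=> //; first by move=> n_0; rewrite n_0 in n_gt0.
  exists J'; first exact: gu'.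
  by move=> J h1 _; exact: hJ'.
have [D hD] := choice step.
exists (fun n => projT1 (D n)), (fun n => (projT2 (D n)).1), (fun n => (projT2 (D n)).2).
split=> [|n|J].
- by have := hD 0%N; case: (D 0%N) => M [p w] [h _ _]; exact: h.
- by have := hD n; case: (D n) => M [p w] [].
exists (maxn (n0 J) J.+1) => n; rewrite geq_max => /andP[h1 h2].
have := hD n; case: (D n) => M [p w] [_ _ [J' g h]]; exists J' => //.
by apply: h => //; [exact: ltnW|exact: leq_ltn_trans h2].
Qed.

End Universal.

(** * From fidelities to the averaged trace-norm error; the theorem *)

Section Error.
Variable R : realType.

Lemma density_normalize (I : finType) (Y : op R I) : psd Y -> rtrace Y != 0 ->
  density ((rtrace Y)^-1%:C *: Y).
Proof.
move=> hY t0; have tY : \tr Y = (rtrace Y)%:C.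
  by rewrite [LHS]complexE (ger0_Im (psd_tr_ge0 hY)) mulr0 addr0.
split.
  move=> v; rewrite -scalemxAr -scalemxAl mxE mulr_ge0 //.
  by rewrite ler0c invr_ge0 psd_rtrace_ge0.
by rewrite mxtraceZ tY -rmorphM mulVf // rmorph1.
Qed.

(** Weighting by the probability of the outcome clears the normalization and leaves a bound linear
    in that probability and the subnormalized fidelity, ready to be summed over outcomes. *)
Lemma weighted_trnorm k (Y : op R (qubits k * qubits k)) (t : R) : psd Y -> 0 < t -> t <= 1 ->
  rtrace Y * trnorm ((rtrace Y)^-1%:C *: Y - bells R k) <=
  rtrace Y * t + 2 * (rtrace Y - fidelity Y) / t.
Proof.
move=> hY t0 t1; have [e|ne] := eqVneq (rtrace Y) 0.
  have h : 0 <= rtrace Y - fidelity Y by rewrite subr_ge0 fidelity_le_tr.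
  rewrite {1}e mul0r; apply: addr_ge0; first by rewrite e mul0r.
  by apply: divr_ge0 (ltW t0); apply: mulr_ge0 h.
have := trnorm_le_fidelity (density_normalize hY ne) t0 t1.
rewrite fidelityZ => /(ler_wpM2l (psd_rtrace_ge0 hY)) /le_trans; apply.
rewrite mulrDr lerD2l le_eqVlt; apply/orP; left; apply/eqP.
move: ne; move: (rtrace Y) (fidelity Y) => x y ne.
by field; rewrite ne gt_eqF.
Qed.

End Error.

Theorem theorem4 (R : realType) (A B : finType) (delta : R)
    (delta_gt0 : 0 < delta) :
  exists (X : nat -> finType) (r : forall n : nat, X n -> R)
    (q : forall n : nat, X n -> nat)
    (Lam : forall (n : nat) (x : X n),
       op R (pow A n * pow B n) -> op R (qubits (q n x) * qubits (q n x))),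
    [/\ forall (n : nat) (x : X n), Posz (q n x) = Num.floor (n%:R * r n x),
        forall n : nat,
          @locc_instrument R (X n) (fun x => qubits (q n x))
            (fun x => qubits (q n x)) (pow A n) (pow B n) (Lam n)
      & forall rho : op R (A * B), density rho ->
        let p (n : nat) (x : X n) : R :=
          rtrace (Lam n x (tensor_pow n rho)) in
        (fun n : nat => \sum_(x : X n)
           p n x * trnorm ((p n x)^-1%:C *: Lam n x (tensor_pow n rho)
                           - bells R (q n x))) @ \oo --> (0 : R)
        /\
        (fun n : nat => \sum_(x : X n |
             r n x < distillable_entanglement rho - delta) p n x)
          @ \oo --> (0 : R)].
Proof.
have [cand dense] := dense_candidates R A B.
(* Of the slack, [delta / 2] goes to approaching the supremum, [delta / 4] to the candidate and
   [delta / 4] to the universal protocol. *)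
have d4 : 0 < delta / 4 by rewrite divr_gt0.
have [M [p [w [M0 prot guar]]]] := universal_protocols cand d4.
pose Lam n := s2val (cid2 (prot n)).
have LamL n := s2valP (cid2 (prot n)); have LamE n := s2valP' (cid2 (prot n)).
exists (fun n => 'I_(M n)), (fun n (x : 'I_(M n)) => x%:R / n%:R),
  (fun n (x : 'I_(M n)) => nat_of_ord x), Lam; split => //.
  case=> [|n] x.
    rewrite mul0r floor0; have : (x < 1)%N by rewrite -M0.
    by rewrite ltnS leqn0 => /eqP ->.
  by rewrite mulrC divfK ?pnatr_eq0 // [x%:R]pmulrn intrKfloor.
move=> rho hrho P.
have small (n : nat) (J J' : nat) : (J <= J')%N -> J'.+1%:R^-1 <= J.+1%:R^-1 :> R.
  by move=> h; rewrite lef_pV2 ?posrE ?ltr0n // ler_nat ltnS.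
have tiny (e : R) : 0 < e -> exists J, J.+1%:R^-1 <= e.
  move=> e0; exists (Num.truncn e^-1); rewrite -[leRHS]invrK lef_pV2 ?posrE ?invr_gt0 ?ltr0n //.
  exact/ltW/truncnS_gt.
split.
  apply/cvgrPdist_le => e e0.
  (* The first terms of [weighted_trnorm] then sum to at most [e / 2], and so do the second ones as
     soon as the total infidelity is at most [e / 4 * t]. *)
  pose t := Num.min 1 (e / 2).
  have t0 : 0 < t by rewrite lt_min ltr01 divr_gt0.
  have t1 : t <= 1 by rewrite ge_min lexx.
  have te : t <= e / 2 by rewrite ge_min lexx orbT.
  have [J hJ] := tiny (e / 4 * t) (mulr_gt0 (divr_gt0 e0 (ltr0n _ 4)) t0).
  have [n0 hn0] := guar J; exists n0 => // n /= /hn0[J' JJ' g].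
  have [ginf _] := g rho hrho.
  have [B1 S1] := protocol_bounds (prot n) hrho.
  rewrite sub0r normrN ger0_norm; last first.
    apply: sumr_ge0 => x _; rewrite mulr_ge0 ?trnorm_ge0 // /P (LamE n rho hrho x).1.
    by have /andP[h1 h2] := B1 x; exact: le_trans h2.
  apply: (@le_trans _ _ (\sum_x (p n rho x * t + 2 * (p n rho x - w n rho x) / t))).
    apply: ler_sum => x _; have [<- <-] := LamE n rho hrho x.
    apply: weighted_trnorm => //; apply: (locc_psd (LamL n)).
    exact: (density_tensor_pow n hrho).1.
  rewrite big_split /= -mulr_suml S1 mul1r -mulr_suml -mulr_sumr.
  have h : \sum_x (p n rho x - w n rho x) <= e / 4 * t.
    by apply: le_trans ginf _; apply: le_trans hJ; exact: small.
  have h2 : 2 * (\sum_x (p n rho x - w n rho x)) / t <= e / 2.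
    rewrite ler_pdivrMr //; move: h; move: (\sum_x _) => y; lra.
  by move: te h2; move: (2 * _ / t) => y; lra.
pose E := distillable_entanglement rho.
(* For [E <= delta] the threshold is not positive while all rates are nonnegative, so the sum is
   empty. *)
have [Ed|Ed] := leP E delta.
  apply/cvgrPdist_le => e e0; exists 0%N => // n _ /=.
  rewrite big_pred0 ?subr0 ?normr0 ?ltW // => x.
  apply/negbTE; rewrite -leNgt; apply: (@le_trans _ _ 0); first by rewrite subr_le0.
  by rewrite divr_ge0 ?ler0n.
(* Without a supremum [sup] would take its default value 0, against [delta < E]. *)
have hs : has_sup [set r : R | distillable_rate rho r].
  apply: contrapT => /sup_out h; move: Ed; rewrite /E /distillable_entanglement h.
  by rewrite ltNge (ltW delta_gt0).
have d2 : 0 < delta / 2 by rewrite divr_gt0.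
have [r hr Er] := sup_adherent d2 hs.
have [j gj rj] := distillable_candidate dense hr d4.
apply/cvgrPdist_le => e e0.
have [J hJ] := tiny e e0.
(* [J] makes the error small, and [j.+1] puts the candidate [j] on the list. *)
have [n0 hn0] := guar (maxn J j.+1); exists (maxn n0 1) => // n /=.
rewrite geq_max => /andP[/hn0[J' JJ' g] n1].
have [_ /(_ j _ gj) gr] := g rho hrho.
have [B1 S1] := protocol_bounds (prot n) hrho.
have p0 x : 0 <= p n rho x by have /andP[h1 h2] := B1 x; exact: le_trans h2.
rewrite sub0r normrN.
have PE x : P n x = p n rho x := (LamE n rho hrho x).1.
rewrite ger0_norm; last by apply: sumr_ge0 => x _; rewrite PE.
have jJ : j \in by_rate cand J'.
  by rewrite mem_sort mem_iota add0n /= (leq_trans _ JJ') // leq_maxr.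
apply: (@le_trans _ _ J'.+1%:R^-1); last first.
  by apply: le_trans hJ; apply: small => //; apply: leq_trans JJ'; exact: leq_maxl.
apply: le_trans (gr jJ).
rewrite big_mkcond [leRHS]big_mkcond; apply: ler_sum => x _ /=.
case: ifP => [h|_]; last by case: ifP.
rewrite PE ifT //; move: h; rewrite ltr_pdivrMr ?ltr0n // => /lt_le_trans; apply.
rewrite ler_wpM2r ?ler0n //; move: Er rj; rewrite /distillable_entanglement.
by move: (sup _) => s; lra.
Qed.
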